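(* Let $d\ge2$ and let $A$ be a bi-Koszul algebra determined by $\varDelta_d$, with $E=E(A)$. Then $A$ is strongly bi-Koszul if and only if for any $A_\infty$-algebra $(E(A);\{m_i\})$ and all $k\ge1$, $$\mathbf U^{3k+2}\subseteq m_2(E^2_{d+1}E^{3k})$$ and $$\mathbf V^{3k+2}\subseteq\sum_{\substack{k_1+k_2=k\\ k_1\ge1,\,k_2\ge0}}m_2(E^{3k_1}E^{3k_2+2})+\sum_{\substack{k_1+k_2=k\\ k_1\ge0,\,k_2\ge1}}m_2(E^{3k_1+2}E^{3k_2}).$$
   Context: Fix a field $\mathbb F$. All graded algebras $A=\mathbb F\oplus A_1\oplus A_2\oplus\cdots$ are locally finite, connected and generated in degree 1; $J=A_{\ge1}$, and $\mathbb F$ also denotes the trivial graded left module $A/J$. Put $E(A)=\bigoplus_{p,j}E^p_j(A)$ with $E^p_j(A)=\underline{\mathrm{Ext}}^p_A(\mathbb F,\mathbb F)_{-j}$, and for a graded left module $M$, $\mathsf E^p_j(M)=\underline{\mathrm{Ext}}^p_A(M,\mathbb F)_{-j}$, where $\underline{\mathrm{Ext}}$ is the derived functor of $\underline{\mathrm{Hom}}_A(M,N)=\bigoplus_n\mathrm{Hom}_{Gr(A)}(M,N[n])$ (degree-zero graded maps, $N[n]_j=N_{n+j}$); $p$ is the cohomological degree and $j$ the lower grading; $E^p(A)=\bigoplus_j E^p_j(A)$. For $d\ge2$ let $\varDelta_d(3k)=(2dk,2dk)$, $\varDelta_d(3k+1)=(2dk+1,2dk+1)$, $\varDelta_d(3k+2)=(2dk+d,2dk+d+1)$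 for $k\ge 0$. $A$ is a bi-Koszul algebra determined by $\varDelta_d$ if the trivial module $\mathbb F$ has a minimal graded free resolution $P$ in which $P_n$ is generated in degrees $\varDelta_d(n)$ (the pair viewed as a set) for all $n\ge0$. For such $A$ there are isomorphisms of vector spaces $E^{3n+2}(A)\cong E^2(A)E^{3n}(A)\oplus\mathsf E^2_{2nd+d+1}(J\Omega^{3n}(\mathbb F))$, $n\ge1$, where $\Omega^{3n}(\mathbb F)$ is the $3n$-th syzygy in the minimal graded free resolution; $A$ is strongly bi-Koszul if the obstruction $\mathsf E^2_{2nd+d+1}(J\Omega^{3n}(\mathbb F))$ vanishes for all $n\ge1$. An $A_\infty$-algebra is a $\mathbb Z$-graded vector space $E$ with linear maps $m_n:E^{\otimes n}\to E$ of degree $2-n$ ($n\ge1$) such that for all $n\ge1$, $\sum(-1)^{i+jt}m_{i+1+j}(1^{\otimes i}\otimes m_t\otimes 1^{\otimes j})=0$, the sum over $n=i+t+j$, $i,j\ge0$, $t\ge1$. All $A_\infty$-algebras are strictly unital. An $A_\infty$-algebra $(E(A);\{m_i\})$ means an $A_\infty$-Ext-algebra structure, i.e. one obtained by the minimality theorem (Kadeishvili) from the differential graded algebra $\mathrm{End}_A(P)$, $P$ a free resolution of ${}_A\mathbb F$: thus $m_1=0$, $m_2$ is the Yoneda product, every $m_n$ preserves the lower grading, and $E(A)$ is quasi-isomorphic to $\mathrm{End}_A(P)$. Write $m_l(X_1\cdots X_l)$ for the image $m_l(X_1\otimes\cdots\otimes X_l)$. $\mathbf U^{3k+2}$ is the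 sum of the images of $m_3$ on all permutations of $E^{3k_1},E^{3k_2+1},E^{3k_3+2}_{2dk_3+d}$ over all $k_1\ge1$, $k_2,k_3\ge0$ with $k_1+k_2+k_3=k$. $\mathbf V^{3k+2}$ is the sum of the images of $m_3$ on all permutations of $E^{3k_1+2}_{2dk_1+d},E^{3k_2+2}_{2dk_2+d},E^{3k_3+2}_{2dk_3+d+1}$ over all $k_1,k_2,k_3\ge0$ with $k_1+k_2+k_3=k-1$. *)

(* Defs.v *)
From HB Require Import structures.
From mathcomp Require Import all_boot all_algebra.
From mathcomp Require Import generic_quotient ring_quotient.
From mathcomp Require Import boolp classical_sets functions.

Set Implicit Arguments.
Unset Strict Implicit.
Unset Printing Implicit Defensive.

Import GRing.Theory.
Local Open Scope ring_scope.
Local Open Scope classical_set_scope.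

(* Gradings are internal: a graded object is one module together with the
   family of its homogeneous components, given as subsets.  Sums, shifts and
   compositions of homogeneous maps then need no transport along equalities
   of degrees.  Only closure under subtraction is asked of a component: closure
   under F follows from the compatibility with the component of degree 0, which
   is F. *)

Definition lspan (R : pzRingType) (V : lmodType R) (S : set V) : set V :=
  [set v | exists n (c : 'I_n -> R) (s : 'I_n -> V),
     (forall i, S (s i)) /\ v = \sum_(i < n) c i *: s i].

Definition is_grading (I : eqType) (V : zmodType) (G : I -> set V) : Prop :=
  [/\ forall i, G i 0 /\ forall x y, G i x -> G i y -> G i (x - y),
      forall v, exists (s : seq I) (c : I -> V),
        [/\ uniq s, forall i, G i (c i) & v = \sum_(i <- s) c i]
    & forall (s : seq I) (c : I -> V), uniq s -> (forall i, G i (c i)) ->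
        \sum_(i <- s) c i = 0 -> forall i, i \in s -> c i = 0].

Record graded_algebra (F : fieldType) := GradedAlgebra {
  galg :> algType F;
  gcomp : nat -> set galg;
  gcomp_grading : is_grading gcomp;
  gcomp_mul : forall i j a b,
    gcomp i a -> gcomp j b -> gcomp (i + j)%N (a * b);
  gcomp_connected : gcomp 0%N = [set k%:A | k in [set: F]];
  gcomp_locally_finite : forall n, exists s : seq galg,
    gcomp n `<=` lspan [set` s];
  gcomp_generated : forall n,
    gcomp n = lspan [set \prod_(a <- s) a | s in
                [set s : seq galg | size s = n /\ [set` s] `<=` gcomp 1%N]]
}.

Section LspanTheory.
Variables (R : pzRingType) (V : lmodType R).
Implicit Types (S : set V) (u v : V).

Lemma lspan0 S : lspan S 0.
Proof.
by exists 0%N, (fun=> 0), (fun=> 0); split => [[]//|]; rewrite big_ord0.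
Qed.

Lemma lspan_incl S : S `<=` lspan S.
Proof.
move=> v Sv; exists 1%N, (fun=> 1), (fun=> v).
by split=> //; rewrite big_ord1 scale1r.
Qed.

Lemma lspanZ S k v : lspan S v -> lspan S (k *: v).
Proof.
move=> [n [c [s [Ss ->]]]]; exists n, (fun i => k * c i), s; split=> //.
by rewrite scaler_sumr; apply: eq_bigr => i _; rewrite scalerA.
Qed.

Lemma lspanD S u v : lspan S u -> lspan S v -> lspan S (u + v).
Proof.
move=> [n [c [s [Ss ->]]]] [n' [c' [s' [Ss' ->]]]].
exists (n + n')%N,
  (fun i : 'I_(n + n') => match fintype.split i with inl j => c j | inr j => c' j end),
  (fun i : 'I_(n + n') => match fintype.split i with inl j => s j | inr j => s' j end).
split=> [i|]; first by case: fintype.splitP.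
rewrite big_split_ord /=; congr (_ + _); apply: eq_bigr => i _.
  by case: splitP => j /= e; [rewrite (ord_inj e)|
     by have := ltn_ord i; rewrite e ltnNge leq_addr].
case: splitP => j /= e; first by have := ltn_ord j; rewrite -e ltnNge leq_addr.
by move/addnI/ord_inj: e => <-.
Qed.

Lemma lspan_sum S (I : Type) (r : seq I) (P : pred I) (f : I -> V) :
  (forall i, P i -> lspan S (f i)) -> lspan S (\sum_(i <- r | P i) f i).
Proof.
by move=> h; elim/big_ind: _ => //; [exact: lspan0 | exact: lspanD].
Qed.

Lemma lspanN S v : lspan S v -> lspan S (- v).
Proof. by move=> h; rewrite -scaleN1r; exact: lspanZ. Qed.

Lemma lspan_min S (T : set V) : T 0 -> (forall u v, T u -> T v -> T (u + v)) ->
  (forall k v, T v -> T (k *: v)) -> S `<=` T -> lspan S `<=` T.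
Proof.
move=> T0 TD TZ ST _ [n [c [s [Ss ->]]]].
by elim/big_ind: _ => // i _; apply/TZ/ST.
Qed.

End LspanTheory.

Section Augmentation.
Variables (F : fieldType) (A : graded_algebra F).

Definition aug_ideal : set A :=
  lspan (\bigcup_(n in [set n | (0 < n)%N]) gcomp n).

(* the quotient map A -> A / J = F *)
Definition aug (a : A) : F := xget 0 [set k | aug_ideal (a - k%:A)].

Lemma aug_ideal_sum a : aug_ideal a -> exists (s : seq nat) (c : nat -> A),
  [/\ 0%N \notin s, uniq s, forall i, gcomp i (c i) & a = \sum_(i <- s) c i].
Proof.
have [G0 Gs _] := gcomp_grading A.
have GD i (x y : A) : gcomp i x -> gcomp i y -> gcomp i (x + y).
  move=> gx gy; rewrite -[y]opprK; apply: (G0 i).2 => //.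
  by rewrite -sub0r; apply: (G0 i).2 => //; exact: (G0 i).1.
have GZ i k (x : A) : gcomp i x -> gcomp i (k *: x).
  move=> gx; rewrite -[k *: x]mul1r -scalerAr scalerAl -[i]add0n.
  by apply: gcomp_mul => //; rewrite gcomp_connected; exists k.
pose T : set A := [set a | exists (s : seq nat) (c : nat -> A),
  [/\ 0%N \notin s, uniq s, forall i, gcomp i (c i) & a = \sum_(i <- s) c i]].
suff JT : aug_ideal `<=` T by exact: JT.
apply: lspan_min.
- exists [::], (fun=> 0); split=> // [i|]; first exact: (G0 i).1.
  by rewrite big_nil.
- move=> u v [s [c [s0 us gc ->]]] [t [e [t0 ut ge ->]]].
  exists (undup (s ++ t)),
    (fun i => (if i \in s then c i else 0) + (if i \in t then e i else 0)).
  split; [by rewrite mem_undup mem_cat negb_or s0|exact: undup_uniq| |].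
    by move=> i; apply: GD; case: ifP => // _; exact: (G0 i).1.
  rewrite big_split /=; congr (_ + _).
    rewrite -[RHS]big_mkcond -[RHS]big_filter /=; apply: perm_big; apply: uniq_perm => // [|i].
      by rewrite filter_uniq // undup_uniq.
    by rewrite mem_filter mem_undup mem_cat; case: (i \in s).
  rewrite -[RHS]big_mkcond -[RHS]big_filter /=; apply: perm_big.
  apply: uniq_perm => // [|i].
    by rewrite filter_uniq // undup_uniq.
  by rewrite mem_filter mem_undup mem_cat orbC; case: (i \in t).
- move=> k v [s [c [s0 us gc ->]]]; exists s, (fun i => k *: c i).
  by split=> // [i|]; [exact: GZ | rewrite scaler_sumr].
- move=> x [n /= n0 gx]; exists [:: n], (fun i => if i == n then x else 0).
  split=> //; first by rewrite inE eq_sym -lt0n.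
    by move=> i; case: eqP => [->//|_]; exact: (G0 i).1.
  by rewrite big_seq1 eqxx.
Qed.

Lemma aug_ideal_const k : aug_ideal (k%:A : A) -> k = 0.
Proof.
move=> /aug_ideal_sum [s [c [s0 us gc e]]].
have [G0 _ Gi] := gcomp_grading A.
have := Gi (0%N :: s) (fun i => if i == 0%N then - k%:A else c i).
rewrite /= s0 us => /(_ isT) /=.
have gc' i : gcomp i (if i == 0%N then - (k%:A : A) else c i).
  case: eqP => [->|_//]; rewrite -sub0r; apply: (G0 0%N).2.
    exact: (G0 0%N).1.
  by rewrite gcomp_connected; exists k.
move=> /(_ gc'); rewrite big_cons eqxx.
rewrite [X in _ + X](_ : _ = k%:A); last first.
  rewrite e big_seq [RHS]big_seq; apply: eq_bigr => i si.
  by case: eqP => // i0; rewrite i0 (negPf s0) in si.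
rewrite addNr => /(_ erefl 0%N); rewrite inE eqxx => /(_ isT) /eqP.
by rewrite oppr_eq0 scaler_eq0 oner_eq0 orbF => /eqP.
Qed.

Lemma augP a : aug_ideal (a - (aug a)%:A).
Proof.
suff [k kP] : exists k, aug_ideal (a - k%:A).
  by rewrite /aug; case: xgetP => [k' -> //|/(_ k)/(_ kP)].
have [G0 Gs _] := gcomp_grading A.
have [s [c [us gc ->]]] := Gs a.
have : gcomp 0%N (\sum_(i <- s | i == 0%N) c i).
  have [s0|s0] := boolP (0%N \in s).
    by rewrite -big_filter filter_pred1_uniq // big_seq1; exact: gc.
  rewrite big_seq_cond big1 => [|i /andP[si /eqP i0]].
    exact: (G0 0%N).1.
  by rewrite i0 (negPf s0) in si.
rewrite gcomp_connected => -[k _ e]; exists k.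
rewrite (bigID (fun i => i == 0%N)) /= -e addrAC subrr add0r.
apply: lspan_sum => i; rewrite -lt0n => i0.
by apply: lspan_incl; exists i.
Qed.

Lemma aug_uniq a k : aug_ideal (a - k%:A) -> aug a = k.
Proof.
move=> h; apply/eqP; rewrite -subr_eq0; apply/eqP/aug_ideal_const.
rewrite scalerBl; have -> : (aug a)%:A - k%:A = (a - k%:A) - (a - (aug a)%:A).
  by rewrite opprB [RHS]addrC addrA subrK.
by apply: lspanD => //; apply/lspanN/augP.
Qed.

Lemma aug_idealMr a b : aug_ideal a -> aug_ideal (a * b).
Proof.
suff JT : aug_ideal `<=` [set a | aug_ideal (a * b)] by exact: JT.
apply: lspan_min => /=.
- by rewrite mul0r; exact: lspan0.
- by move=> u v hu hv; rewrite mulrDl; exact: lspanD.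
- by move=> k v hv; rewrite -scalerAl; exact: lspanZ.
- move=> x [n /= n0 gx]; have [_ Gs _] := gcomp_grading A.
  have [s [c [_ gc ->]]] := Gs b; rewrite mulr_sumr.
  apply: lspan_sum => i _; apply: lspan_incl; exists (n + i)%N => /=.
    by rewrite addn_gt0 n0.
  exact: gcomp_mul.
Qed.

Lemma aug_is_zmod_morphism : zmod_morphism aug.
Proof.
move=> a b; apply: aug_uniq.
have -> : a - b - (aug a - aug b)%:A = (a - (aug a)%:A) - (b - (aug b)%:A).
  by rewrite scalerBl !opprB addrACA [RHS]addrACA; congr (_ + _); rewrite addrC.
by apply: lspanD; [exact: augP | apply/lspanN/augP].
Qed.

HB.instance Definition _ :=
  GRing.isZmodMorphism.Build A F aug aug_is_zmod_morphism.

Lemma aug_is_monoid_morphism : monoid_morphism aug.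
Proof.
split=> [|a b]; apply: aug_uniq.
  by rewrite scale1r subrr; exact: lspan0.
have -> : a * b - (aug a * aug b)%:A =
    (a - (aug a)%:A) * b + aug a *: (b - (aug b)%:A).
  by rewrite mulrBl scalerBr scalerA -scalerAl mul1r addrA subrK.
by apply: lspanD; [apply/aug_idealMr/augP | apply/lspanZ/augP].
Qed.

HB.instance Definition _ :=
  GRing.isMonoidMorphism.Build A F aug aug_is_monoid_morphism.

End Augmentation.

(* the trivial module A / J, with underlying space F *)
Definition triv (F : fieldType) (A : graded_algebra F) : Type := F.

Section TrivialModule.
Variables (F : fieldType) (A : graded_algebra F).

HB.instance Definition _ := GRing.Zmodule.copy (triv A) F.

Definition triv_scale (a : A) (x : triv A) : triv A := aug a * (x : F).

Lemma triv_scalerA a b v :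
  triv_scale a (triv_scale b v) = triv_scale (a * b) v.
Proof. by rewrite /triv_scale rmorphM mulrA. Qed.
Lemma triv_scale1r : left_id 1 triv_scale.
Proof. by move=> v; rewrite /triv_scale rmorph1 mul1r. Qed.
Lemma triv_scalerDr : right_distributive triv_scale +%R.
Proof. by move=> a u v; exact: mulrDr. Qed.
Lemma triv_scalerDl v : {morph triv_scale^~ v : a b / a + b}.
Proof. by move=> a b; rewrite /triv_scale rmorphD; exact: mulrDl. Qed.

HB.instance Definition _ := GRing.Zmodule_isLmodule.Build A (triv A)
  triv_scalerA triv_scale1r triv_scalerDr triv_scalerDl.

Definition triv_gr (j : int) : set (triv A) :=
  if j == 0 then [set: triv A] else [set 0].

End TrivialModule.

(* A graded free resolution of the graded submodule N of the module M, whose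
   homogeneous components are cut out by G; N = setT gives a resolution of M
   itself.  The total module of the resolution carries all the P_n at once:
   res_gr P (n, j) is the part of internal degree j of P_n. *)
Record resolution (F : fieldType) (A : graded_algebra F) (M : lmodType A)
    (G : int -> set M) (N : set M) := Resolution {
  res_mod :> lmodType A;
  res_gr : int * int -> set res_mod;
  res_d : {linear res_mod -> res_mod};
  res_eps : {linear res_mod -> M};
  res_grading : is_grading res_gr;
  res_gr_scale : forall i n j a x,
    gcomp i a -> res_gr (n, j) x -> res_gr (n, i%:Z + j) (a *: x);
  res_gr_neg : forall n j, (n < 0)%R -> res_gr (n, j) = [set 0];
  res_free : exists B : set res_mod,
    [/\ forall b, B b -> exists nj, res_gr nj b,
        lspan B = setT
      & forall k (c : 'I_k -> A) (b : 'I_k -> res_mod), injective b ->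
          (forall i, B (b i)) -> \sum_(i < k) c i *: b i = 0 ->
          forall i, c i = 0];
  res_d_gr : forall n j x, res_gr (n, j) x -> res_gr (n - 1, j) (res_d x);
  res_eps_gr0 : forall j x, res_gr (0, j) x -> G j (res_eps x);
  res_eps_gr : forall n j x, n != 0 -> res_gr (n, j) x -> res_eps x = 0;
  res_dd : forall x, res_d (res_d x) = 0;
  res_eps_d : forall x, res_eps (res_d x) = 0;
  res_exact : forall x, res_d x = 0 -> res_eps x = 0 -> exists y, x = res_d y;
  res_eps_im : range res_eps = N
}.

Arguments res_gr {F A M G N} r _ _.
Arguments res_d {F A M G N} r.
Arguments res_eps {F A M G N} r.

Definition triv_resolution (F : fieldType) (A : graded_algebra F) :=
  resolution (@triv_gr F A) [set: triv A].

Section Ext.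
Variables (F : fieldType) (A : graded_algebra F).

Definition Jmul (V : lmodType A) (W : set V) : set V :=
  lspan [set v | exists a w, [/\ aug_ideal a, W w & v = a *: w]].

Variables (M : lmodType A) (G : int -> set M) (N : set M).
Variable P : resolution G N.

Definition res_comp (n : int) : set P := lspan (\bigcup_j res_gr P (n, j)).

Definition minimal : Prop := range (res_d P) `<=` Jmul [set: P].

(* the n-th syzygy, as a submodule of P_(n-1); only meaningful for n > 0 *)
Definition syzygy (n : nat) : set P :=
  [set x | [/\ res_comp (n%:Z - 1) x, res_d P x = 0 & res_eps P x = 0]].

(* Hom_Gr(P_p, F[-j]), for b = (p, j) *)
Definition cochain_at (b : int * int) : set (P -> F^o) :=
  [set phi | (forall (a : A) x y, phi (a *: x + y) = aug a * phi x + phi y) /\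
     forall b' x, b' != b -> res_gr P b' x -> phi x = 0].

Definition cochain : set (P -> F^o) := lspan (\bigcup_b cochain_at b).

Definition cocycle : (P -> F^o) -> bool :=
  fun phi => `[< cochain phi /\ phi \o res_d P = 0 >].

Lemma cocycle_subsemimod_closed : GRing.subsemimod_closed cocycle.
Proof.
split; [split|].
- by apply/asboolP; split; [exact: lspan0 | apply/funext].
- move=> f g /asboolP[hf df] /asboolP[hg dg]; apply/asboolP; split.
    exact: lspanD.
  apply/funext => x; have := congr1 (@^~ x) df; have := congr1 (@^~ x) dg.
  by rewrite /= /GRing.add /= => -> ->; rewrite addr0.
- move=> k f /asboolP[hf df]; apply/asboolP; split; first exact: lspanZ.
  apply/funext => x; have := congr1 (@^~ x) df.
  by rewrite /= => e; rewrite -[LHS]/(k *: (f (res_d P x))) e; exact: scaler0.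
Qed.

HB.instance Definition _ :=
  GRing.isSubmodClosed.Build F (P -> F^o) cocycle cocycle_subsemimod_closed.

Definition cocycles : Type := {phi : P -> F^o | cocycle phi}.
HB.instance Definition _ := SubChoice.on cocycles.
HB.instance Definition _ := [SubChoice_isSubLmodule of cocycles by <:].

Definition coboundary : cocycles -> bool :=
  fun z => `[< exists2 psi, cochain psi & val z = psi \o res_d P >].

Lemma coboundary_subsemimod_closed : GRing.subsemimod_closed coboundary.
Proof.
split; [split|].
- apply/asboolP; exists 0; first exact: lspan0.
  by rewrite raddf0; apply/funext.
- move=> f g /asboolP[p hp ep] /asboolP[q hq eq]; apply/asboolP.
  by exists (p + q); [exact: lspanD | rewrite raddfD /= ep eq].
- move=> k f /asboolP[p hp ep]; apply/asboolP.
  by exists (k *: p); [exact: lspanZ | rewrite linearZ /= ep].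
Qed.

HB.instance Definition _ :=
  GRing.isSubmodClosed.Build F cocycles coboundary coboundary_subsemimod_closed.

(* Ext_A(N, F), as the cohomology of Hom_A(P, F) *)
Definition coboundaries := GRing.ZmodClosed.clone cocycles coboundary _.
Definition Ext : Type := Quotient.quot coboundaries.
HB.instance Definition _ := GRing.Zmodule.on Ext.

Definition Ext_class (z : cocycles) : Ext := (\pi_(Quotient.quot coboundaries) z)%qT.

Lemma Ext_classP (z t : cocycles) :
  Ext_class z = Ext_class t <-> coboundary (z - t).
Proof.
split=> [/eqP|h]; last apply/eqP.
  by rewrite -Quotient.idealrBE.
by rewrite -Quotient.idealrBE.
Qed.

Lemma Ext_class_surj (x : Ext) : exists z, Ext_class z = x.
Proof. by exists (repr x); exact: reprK. Qed.

Lemma Ext_classD z t : Ext_class (z + t) = Ext_class z + Ext_class t.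
Proof. exact: raddfD. Qed.

Definition Ext_scale (k : F) (x : Ext) : Ext :=
  Ext_class (k *: (repr (x : Quotient.quot coboundaries))).

Lemma Ext_scale_class k z : Ext_scale k (Ext_class z) = Ext_class (k *: z).
Proof.
apply/Ext_classP; rewrite -scalerBr.
have /Ext_classP h : Ext_class (repr (Ext_class z : Quotient.quot coboundaries))
  = Ext_class z by exact: reprK.
have [_] := coboundary_subsemimod_closed; exact.
Qed.

Lemma Ext_scalerA a b x : Ext_scale a (Ext_scale b x) = Ext_scale (a * b) x.
Proof. by have [z <-] := Ext_class_surj x; rewrite !Ext_scale_class scalerA. Qed.
Lemma Ext_scale1r : left_id 1 Ext_scale.
Proof.
by move=> x; have [z <-] := Ext_class_surj x; rewrite Ext_scale_class scale1r.
Qed.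
Lemma Ext_scalerDr : right_distributive Ext_scale +%R.
Proof.
move=> a x y; have [z <-] := Ext_class_surj x.
have [t <-] := Ext_class_surj y.
by rewrite -Ext_classD !Ext_scale_class scalerDr Ext_classD.
Qed.
Lemma Ext_scalerDl x : {morph Ext_scale^~ x : a b / a + b}.
Proof.
move=> a b; have [z <-] := Ext_class_surj x.
by rewrite !Ext_scale_class scalerDl Ext_classD.
Qed.

HB.instance Definition _ := GRing.Zmodule_isLmodule.Build F Ext
  Ext_scalerA Ext_scale1r Ext_scalerDr Ext_scalerDl.

Definition represents (x : Ext) (phi : P -> F^o) : Prop :=
  exists z : cocycles, val z = phi /\ x = Ext_class z.

Definition Ext_bi (b : int * int) : set Ext :=
  [set x | exists2 phi, cochain_at b phi & represents x phi].

Definition Ext_deg (p : int) : set Ext := lspan (\bigcup_j Ext_bi (p, j)).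

(* b = (p, j) stands for degree p and internal degree -j, as for Ext:
   bihomogeneous elements of End_A(P) of cohomological degree b.1 and lower
   degree b.2, and the differential of End_A(P) in cohomological degree p *)
Definition endo (b : int * int) : set (P -> P) :=
  [set f | (forall (a : A) x y, f (a *: x + y) = a *: f x + f y) /\
     forall n j x, res_gr P (n, j) x -> res_gr P (n - b.1, j - b.2) (f x)].

Definition endo_d (p : int) (f : P -> P) : P -> P :=
  fun x => res_d P (f x) - f (res_d P x) *~ ((-1) ^ p).

End Ext.

Arguments res_comp {F A M G N} P _ _.
Arguments minimal {F A M G N} P.
Arguments syzygy {F A M G N} P _ _.
Arguments cochain_at {F A M G N} P _ _.
Arguments cochain {F A M G N} P _.
Arguments Ext_bi {F A M G N} P _ _.
Arguments Ext_deg {F A M G N} P _ _.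

(* Multilinear operations m_n (n > 0) are packed into one function on words:
   m_n (x_1, ..., x_n) is m [:: x_1; ...; x_n]; the empty word is irrelevant. *)

Section AInfinity.
Variables (F : fieldType) (E : lmodType F).
Implicit Types (m : seq E -> E) (xs : seq E).

Definition homogeneous (I : nmodType) (G : I -> set E) (ds : seq I) xs : Prop :=
  size ds = size xs /\
  forall i, (i < size xs)%N -> G (nth 0 ds i) (nth 0 xs i).

(* the sum over n = i + t + j of
   (-1)^(i + j t) g_(i+1+j) (1^i (x) m_t (x) 1^j) on x_1 (x) ... (x) x_n, where
   x_k has degree p_k: moving m_t, of degree 2 - t, past x_1, ..., x_i gives the
   Koszul sign (-1)^((2 - t)(p_1 + ... + p_i)) *)
Definition stasheff (V : zmodType) (g : seq E -> V) m (ps : seq int) xs : V :=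
  let n := size xs in
  \sum_(0 <= i < n) \sum_(1 <= t < (n - i).+1)
    g (take i xs ++ m (take t (drop i xs)) :: drop (i + t) xs) *~
    (-1) ^ (i%:Z + ((n - i - t) * t)%N%:Z
            + (2 - t%:Z) * \sum_(p <- take i ps) p).

Record ainf_algebra (G : int -> set E) m : Prop := {
  ainf_linear : forall (c : F) s t x y,
    m (s ++ (c *: x + y) :: t) = c *: m (s ++ x :: t) + m (s ++ y :: t);
  ainf_degree : forall ps xs, (0 < size xs)%N -> homogeneous G ps xs ->
    G (\sum_(p <- ps) p + (2 - (size xs)%:Z)) (m xs);
  ainf_stasheff : forall ps xs, (0 < size xs)%N -> homogeneous G ps xs ->
    stasheff m m ps xs = 0;
  ainf_unital : exists u, [/\ G 0 u, m [:: u] = 0,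
    forall x, m [:: u; x] = x /\ m [:: x; u] = x
    & forall s t, (2 <= size s + size t)%N -> m (s ++ u :: t) = 0]
}.

Definition op_image m (Xs : seq (set E)) : set E :=
  lspan [set m xs | xs in [set xs | size xs = size Xs /\
    forall i, (i < size Xs)%N -> nth set0 Xs i (nth 0 xs i)]].

End AInfinity.

Section AInfinityExt.
Variables (F : fieldType) (A : graded_algebra F) (P : triv_resolution A).
Implicit Types (m : seq (Ext P) -> Ext P) (f : seq (Ext P) -> P -> P).

(* An A-infinity morphism f from (Ext P, m) to the differential graded algebra
   End_A(P) lifting the identity of its cohomology Ext P.  As End_A(P) has no
   operations m_r with r > 2, the right-hand side of the morphism identity
   reduces to the terms r = 1 and r = 2.  A cocycle theta of End_A(P)
   has class represented by eps \o theta in Ext P. *)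
Record ainf_lift m f : Prop := {
  lift_linear : forall (c : F) s t x y v,
    f (s ++ (c *: x + y) :: t) v =
      (c%:A : A) *: f (s ++ x :: t) v + f (s ++ y :: t) v;
  lift_degree : forall bs xs, (0 < size xs)%N ->
    homogeneous (Ext_bi P) bs xs ->
    endo (\sum_(b <- bs) b + (1 - (size xs)%:Z, 0)) (f xs);
  lift_morphism : forall ps xs, (0 < size xs)%N ->
    homogeneous (Ext_deg P) ps xs ->
    let n := size xs in
    stasheff f m ps xs =
      endo_d (\sum_(p <- ps) p + (1 - n%:Z)) (f xs) +
      \sum_(1 <= i < n) (f (take i xs) \o f (drop i xs)) *~
        (-1) ^ (i%:Z - 1 + (1 - (n - i)%N%:Z) * \sum_(p <- take i ps) p);
  lift_id : forall b x, Ext_bi P b x -> represents x (res_eps P \o f [:: x])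
}.

Definition is_yoneda m : Prop := forall b c theta eta x y,
  endo b theta -> endo_d b.1 theta = 0 -> endo c eta -> endo_d c.1 eta = 0 ->
  represents x (res_eps P \o theta) -> represents y (res_eps P \o eta) ->
  represents (m [:: x; y]) (res_eps P \o (theta \o eta)).

Record ainf_ext m : Prop := {
  ext_ainf : ainf_algebra (Ext_deg P) m;
  ext_minimal : forall x, m [:: x] = 0;
  ext_yoneda : is_yoneda m;
  ext_bidegree : forall bs xs, (0 < size xs)%N ->
    homogeneous (Ext_bi P) bs xs ->
    Ext_bi P (\sum_(b <- bs) b + (2 - (size xs)%:Z, 0)) (m xs);
  ext_lift : exists f, ainf_lift m f
}.

End AInfinityExt.

Section BiKoszul.
Variables (F : fieldType) (A : graded_algebra F) (d : nat).

Definition Delta (n : nat) : nat * nat :=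
  let e := (2 * d * (n %/ 3))%N in
  if (n %% 3 == 0)%N then (e, e)
  else if (n %% 3 == 1)%N then (e + 1, e + 1)%N
  else (e + d, e + d + 1)%N.

(* a component in one of the two degrees may be zero *)
Definition bi_koszul : Prop := exists P : triv_resolution A, minimal P /\
  forall n : nat, res_comp P n =
    lspan (res_gr P (n%:Z, (Delta n).1%:Z) `|` res_gr P (n%:Z, (Delta n).2%:Z)).

(* the obstruction spaces are computed from an arbitrary graded free
   resolution Q of J Omega^(3n), a graded submodule of P_(3n-1) *)
Definition strongly_bi_koszul : Prop := bi_koszul /\
  forall P : triv_resolution A, minimal P -> forall n : nat, (1 <= n)%N ->
  forall Q : resolution (fun j => res_gr P ((3 * n)%N%:Z - 1, j))
                        (Jmul (syzygy P (3 * n))),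
    Ext_bi Q (2, (2 * n * d + d + 1)%N%:Z) = [set 0].

Variables (P : triv_resolution A) (m : seq (Ext P) -> Ext P).

(* the sum of the images of m_3 on all permutations of X, Y, Z *)
Definition perm_image (X Y Z : set (Ext P)) : set (Ext P) :=
  lspan [set y | exists2 s, perm_eq s [:: 0; 1; 2]%N &
           op_image m [seq nth set0 [:: X; Y; Z] i | i <- s] y].

Definition U (k : nat) : set (Ext P) :=
  lspan [set y | exists k1 k2 k3 : nat,
    [/\ (1 <= k1)%N, (k1 + k2 + k3 = k)%N &
        perm_image (Ext_deg P (3 * k1)%N%:Z)
                   (Ext_deg P (3 * k2 + 1)%N%:Z)
                   (Ext_bi P ((3 * k3 + 2)%N%:Z, (2 * d * k3 + d)%N%:Z)) y]].

Definition V (k : nat) : set (Ext P) :=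
  lspan [set y | exists k1 k2 k3 : nat,
    (k1 + k2 + k3 + 1 = k)%N /\
        perm_image (Ext_bi P ((3 * k1 + 2)%N%:Z, (2 * d * k1 + d)%N%:Z))
                   (Ext_bi P ((3 * k2 + 2)%N%:Z, (2 * d * k2 + d)%N%:Z))
                   (Ext_bi P ((3 * k3 + 2)%N%:Z, (2 * d * k3 + d + 1)%N%:Z)) y].

(* the two sums over k1 + k2 = k bounding V k *)
Definition W (k : nat) : set (Ext P) :=
  lspan ([set y | exists k1 k2 : nat, [/\ (k1 + k2 = k)%N, (1 <= k1)%N &
            op_image m [:: Ext_deg P (3 * k1)%N%:Z;
                           Ext_deg P (3 * k2 + 2)%N%:Z] y]]
     `|` [set y | exists k1 k2 : nat, [/\ (k1 + k2 = k)%N, (1 <= k2)%N &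
            op_image m [:: Ext_deg P (3 * k1 + 2)%N%:Z;
                           Ext_deg P (3 * k2)%N%:Z] y]]).

End BiKoszul.

(* Main.v *)
(* A minimal resolution P has an F-linear contraction s onto F; transferring the
   multiplication of End_A(P) along it gives a particular A-infinity structure on
   E = Ext P.  In that structure E^{3k+2}_{2dk+d+1} is spanned by the elements
   m_{d+1}(x_1, ..., x_d, m_2(x, z)) with x_i, x in E^1 and z in E^{3k}: up to
   sign m_{d+1} composes cochains with copies of s, and s is injective on cycles.
   The Stasheff identity for x_1, ..., x_d, x, z moves such an element into
   U^{3k+2} + E^2_{d+1} E^{3k}, all the other terms being zero for degree reasons;
   hence the condition on U forces E^{3k+2}_{2dk+d+1} = E^2_{d+1} E^{3k}.

   The latter equality is equivalent to the vanishing of the obstruction: lifts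
   theta_v of a basis of E^{3k} form a chain map Theta from P to copies of P
   shifted by 3k, the truncated cone of Theta resolves J Omega^{3k}, and its
   cohomology in bidegree (2, 2dk+d+1) is the cokernel of
   (psi_v) |-> sum_v psi_v theta_v.

   The equality does not depend on the resolution nor on the higher operations,
   and U and V lie in E^{3k+2}_{2dk+d+1}, which gives the converse. *)

From HB Require Import structures.
From mathcomp Require Import all_boot all_order all_algebra.
From mathcomp Require Import boolp classical_sets functions.
From mathcomp Require Import zify ring.
Require Import Defs.

Set Implicit Arguments.
Unset Strict Implicit.
Unset Printing Implicit Defensive.

Import Order.TTheory GRing.Theory Num.Theory.
Local Open Scope ring_scope.
Local Open Scope classical_set_scope.

(** * Homotopy transfer on words *)

(** The transfer is carried out in bar form: once the parities are absorbed into the involutions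
    [tau] and [sg], every identity is an unsigned sum over factorizations of words, and [twist]
    restores the signs only at the end. Strict unitality shapes the contraction: besides h h = 0, h
    i = 0 and p h = 0, the lift of the unit must be exactly the identity of P. This holds because s
    vanishes on the basis of P, which is why the complement of the cycles defining s has to contain
    that basis. Spanning is obtained by duality. The spaces E^n_j are finite-dimensional, as A is
    locally finite and each P_n has few generator degrees, so it suffices that the operations
    separate the generators of P; each letter of E^1 strips one degree from a coefficient in A until
    a nonzero scalar remains. The transferred structure is constructed on a minimal resolution,
    whereas the condition concerns every resolution. From the obstruction to U and V, the
    factorization is therefore made on a minimal P0 and carried over by comparison maps, using just
    that m_2 is the Yoneda product. *)

Section Splitting.
Variables (T : Type).

(* sum over all factorizations xs = u ++ v *)
Fixpoint spl (V : zmodType) (G : seq T -> seq T -> V) (xs : seq T) : V :=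
  if xs is x :: xs' then G [::] xs + spl (fun u v => G (x :: u) v) xs'
  else G [::] [::].

Lemma eq_spl (V : zmodType) (G H : seq T -> seq T -> V) xs :
  (forall u v, u ++ v = xs -> G u v = H u v) -> spl G xs = spl H xs.
Proof.
elim: xs G H => [|x xs IH] G H GH /=; first exact: GH.
by rewrite GH //; congr (_ + _); apply: IH => u v uv; apply: GH; rewrite /= uv.
Qed.

Lemma splD (V : zmodType) (G H : seq T -> seq T -> V) xs :
  spl (fun u v => G u v + H u v) xs = spl G xs + spl H xs.
Proof. by elim: xs G H => [|x xs IH] G H //=; rewrite IH addrACA. Qed.

Lemma spl0 (V : zmodType) xs : spl (fun _ _ => 0 : V) xs = 0.
Proof. by elim: xs => [|x xs IH] //=; rewrite IH addr0. Qed.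

Lemma raddf_spl (V W : zmodType) (f : V -> W) (G : seq T -> seq T -> V) xs :
  {morph f : x y / x + y} -> f (spl G xs) = spl (fun u v => f (G u v)) xs.
Proof. by move=> fD; elim: xs G => [|x xs IH] G //=; rewrite fD IH. Qed.

(** Coassociativity of deconcatenation; through it the associativity of the product enters the
    transfer. *)
Lemma spl_assoc (V : zmodType) (G : seq T -> seq T -> seq T -> V) xs :
  spl (fun u v => spl (fun a b => G u a b) v) xs =
  spl (fun u v => spl (fun a b => G a b v) u) xs.
Proof.
elim: xs G => [|x xs IH] G //=.
by rewrite IH -addrA; congr (_ + _); rewrite -splD; apply: eq_spl.
Qed.

Lemma spl_cons (V : zmodType) (G : seq T -> seq T -> V) x xs :
  spl G (x :: xs) = G [::] (x :: xs) + spl (fun u v => G (x :: u) v) xs.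
Proof. by []. Qed.

Lemma spl_closed (V : zmodType) (Q : set V) (G : seq T -> seq T -> V) xs :
  (forall x y, Q x -> Q y -> Q (x + y)) ->
  (forall u v, u ++ v = xs -> Q (G u v)) -> Q (spl G xs).
Proof.
move=> QD; elim: xs G => [|x xs IH] G QG /=; first exact: QG.
by apply: QD; [exact: QG|apply: IH => u v uv; apply: QG; rewrite /= uv].
Qed.

Lemma spl_rcons (V : zmodType) (G : seq T -> seq T -> V) xs x :
  spl G (rcons xs x) = spl (fun u v => G u (rcons v x)) xs + G (rcons xs x) [::].
Proof. by elim: xs G => [|y xs IH] G //=; rewrite IH addrA. Qed.

Lemma spl_index (V : zmodType) (G : seq T -> seq T -> V) xs :
  spl G xs = \sum_(0 <= i < (size xs).+1) G (take i xs) (drop i xs).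
Proof.
elim: xs G => [|x xs IH] G /=; first by rewrite big_nat1.
by rewrite IH big_nat_recl.
Qed.

End Splitting.

Section Insertion.
Variables (E : zmodType).

(* sum of g (sg u ++ mu v :: w) over all xs = u ++ v ++ w with v nonempty *)
Fixpoint ins (mu : seq E -> E) (sg : E -> E) (V : zmodType) (g : seq E -> V)
    (xs : seq E) : V :=
  if xs is x :: xs' then
    spl (fun v w => g (mu (x :: v) :: w)) xs' +
    ins mu sg (fun ys => g (sg x :: ys)) xs'
  else 0.

Variables (mu : seq E -> E) (sg : E -> E).

Lemma ins_cons (V : zmodType) (g : seq E -> V) x xs :
  ins mu sg g (x :: xs) = spl (fun v w => g (mu (x :: v) :: w)) xs +
    ins mu sg (fun ys => g (sg x :: ys)) xs.
Proof. by []. Qed.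

Lemma eq_ins (V : zmodType) (g g' : seq E -> V) xs :
  g =1 g' -> ins mu sg g xs = ins mu sg g' xs.
Proof.
elim: xs g g' => [|x xs IH] g g' gg //=.
by congr (_ + _); [exact: eq_spl|apply: IH => ys; exact: gg].
Qed.

Lemma insD (V : zmodType) (g g' : seq E -> V) xs :
  ins mu sg (fun ys => g ys + g' ys) xs = ins mu sg g xs + ins mu sg g' xs.
Proof.
by elim: xs g g' => [|x xs IH] g g' /=; rewrite ?addr0 // IH splD addrACA.
Qed.

Lemma raddf_ins (V W : zmodType) (f : V -> W) (g : seq E -> V) xs :
  {morph f : x y / x + y} -> f (ins mu sg g xs) = ins mu sg (f \o g) xs.
Proof.
move=> fD; have f0 : f 0 = 0 by apply: (addIr (f 0)); rewrite -fD !add0r.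
elim: xs g => [|x xs IH] g //=.
by rewrite fD IH raddf_spl.
Qed.

Lemma ins0 (V : zmodType) xs : ins mu sg (fun=> 0 : V) xs = 0.
Proof. by elim: xs => [|x xs IH] //=; rewrite IH spl0 addr0. Qed.

(** Insertion is a coderivation for deconcatenation: it takes place in one of the two factors, and
    when this is the right one, [sg] has passed over the whole left factor. *)
Lemma ins_spl (V : zmodType) (G : seq E -> seq E -> V) xs :
  ins mu sg (fun ys => spl G ys) xs =
  spl (fun v w => ins mu sg (fun y => G y w) v +
                  ins mu sg (fun y => G (map sg v) y) w) xs.
Proof.
elim: xs G => [|x xs IH] G /=; first by rewrite addr0.
rewrite add0r insD splD IH addrACA; congr (_ + _).
rewrite (spl_assoc (fun u a b => G (mu (x :: u) :: a) b)) -splD.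
by apply: eq_spl => u v _; rewrite addrA.
Qed.

End Insertion.

Definition multiadd (E V : zmodType) (g : seq E -> V) : Prop :=
  forall s t x y, g (s ++ (x + y) :: t) = g (s ++ x :: t) + g (s ++ y :: t).

Definition multilin (F : pzRingType) (E V : lmodType F) (g : seq E -> V) : Prop :=
  forall (c : F) s t x y,
    g (s ++ (c *: x + y) :: t) = c *: g (s ++ x :: t) + g (s ++ y :: t).

Section Multilinear.
Variables (F : pzRingType) (E V : lmodType F).
Implicit Types (g : seq E -> V).

Lemma multilin_add g : multilin g -> multiadd g.
Proof. by move=> gL s t x y; have := gL 1 s t x y; rewrite !scale1r. Qed.

Lemma multilin_cons g x : multilin g -> multilin (fun ys => g (x :: ys)).
Proof. by move=> gL c s t y z; exact: (gL c (x :: s)). Qed.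

Lemma multilinZ g s t c x : multilin g ->
  g (s ++ c *: x :: t) = c *: g (s ++ x :: t).
Proof.
move=> gL; have g0 : g (s ++ 0 :: t) = 0.
  have := multilin_add gL s t 0 0; rewrite addr0 => /esym/eqP.
  by rewrite -subr_eq0 addrK => /eqP.
by have := gL c s t x 0; rewrite addr0 g0 addr0.
Qed.

Lemma spl_multilin (G : seq E -> seq E -> V) :
  (forall u, multilin (G u)) -> (forall v, multilin (G^~ v)) ->
  multilin (spl G).
Proof.
move=> GL GR c s; elim: s G GL GR => [|a s IH] G GL GR t x y /=.
  rewrite (GL [::] c [::]) /= scalerDr addrACA; congr (_ + _).
  have ZD : {morph (fun z : V => c *: z) : z z' / z + z'}.
    by move=> *; rewrite scalerDr.
  rewrite (raddf_spl _ _ ZD) -splD.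
  by apply: eq_spl => u v _; exact: (GR v c [::]).
rewrite (GL [::] c (a :: s)) /= (IH (fun u v => G (a :: u) v)).
- by rewrite scalerDr addrACA.
- by move=> u; exact: GL.
- by move=> v; exact: multilin_cons (GR v).
Qed.

End Multilinear.

Section MultiAdditive.
Variables (E V : zmodType) (g : seq E -> V).
Hypothesis gD : multiadd g.

Lemma multiadd0 s t : g (s ++ 0 :: t) = 0.
Proof.
have := gD s t 0 0; rewrite addr0 => /esym/eqP.
by rewrite -subr_eq0 addrK => /eqP.
Qed.

Lemma multiaddN s t x : g (s ++ - x :: t) = - g (s ++ x :: t).
Proof.
by apply/eqP; rewrite -addr_eq0 -gD addNr multiadd0.
Qed.

Lemma multiadd_cons x : multiadd (fun ys => g (x :: ys)).
Proof. by move=> s t y z; exact: (gD (x :: s)). Qed.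

Lemma multiaddD t x y : g ((x + y) :: t) = g (x :: t) + g (y :: t).
Proof. exact: (gD [::]). Qed.

End MultiAdditive.

Section InsertionTheory.
Variables (E : zmodType) (mu : seq E -> E) (sg : E -> E).
Hypothesis sgK : involutive sg.
Hypothesis mu_sg : forall xs, mu (map sg xs) = - sg (mu xs).

(** Two insertions at disjoint places arise in both orders, and in one of them [mu] is evaluated on
    letters already moved by [sg]; by [mu_sg] the two contributions are opposite. Only nested
    insertions remain, and the outer one carries no sign because [sg] has acted twice. *)
Lemma ins_ins (V : zmodType) (g : seq E -> V) xs : multiadd g ->
  ins mu sg (ins mu sg g) xs = ins (ins mu sg mu) id g xs.
Proof.
elim: xs g => [//|x xs IH] g gD; rewrite /=.
have gDr := multiaddD gD.
rewrite insD splD ins_spl splD -IH; last exact: multiadd_cons.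
have sgKE : (fun ys => ins mu sg (fun zs => g (sg (sg x) :: zs)) ys) =1
    ins mu sg (fun ys => g (x :: ys)) by move=> ys; rewrite sgK.
rewrite (eq_ins _ _ _ sgKE).
rewrite addrA; congr (_ + _).
rewrite (spl_assoc (fun v a b => g (mu (mu (x :: v) :: a) :: b))) -!splD.
apply: eq_spl => v w _; rewrite gDr -!addrA.
have gwD : {morph (fun z => g (z :: w)) : a b / a + b} by move=> a b; rewrite gDr.
congr (_ + _).
  by apply/esym; apply: (raddf_spl _ _ gwD).
rewrite (raddf_ins _ _ _ _ gwD).
rewrite addrCA [X in _ + X](_ : _ = 0) ?addr0 // -insD -[RHS](ins0 mu sg V w).
apply: eq_ins => ys; rewrite -/(map sg (x :: v)) mu_sg.
by rewrite (multiaddN gD [::]) /= addrN.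
Qed.

(** Since [mu] kills single letters, every insertion that counts makes the word strictly shorter.
    This lets an induction on length pass under [ins]. *)
Lemma eq_ins_size (V : zmodType) (g g' : seq E -> V) xs :
  (forall x, mu [:: x] = 0) -> (forall s t, g (s ++ 0 :: t) = g' (s ++ 0 :: t)) ->
  (forall ys, (size ys < size xs)%N -> g ys = g' ys) ->
  ins mu sg g xs = ins mu sg g' xs.
Proof.
move=> mu1; elim: xs g g' => [//|x xs IH] g g' g0 gg /=; congr (_ + _).
  apply: eq_spl => -[|a v] w e; first by rewrite mu1; exact: (g0 [::]).
  by apply: gg; rewrite -e /= size_cat !ltnS leq_addl.
by apply: IH => [s t|ys ltys]; [exact: (g0 (sg x :: s))|exact: gg].
Qed.

Lemma ins_nil (V : zmodType) (g : seq E -> V) xs :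
  (forall x ys, g (x :: ys) = 0) -> ins mu sg g xs = 0.
Proof.
elim: xs g => [//|x xs IH] g g0 /=.
by rewrite IH // addr0 -[RHS](spl0 _ xs); apply: eq_spl.
Qed.

Lemma ins_long (V : zmodType) (g : seq E -> V) xs :
  (forall x y ys, g (x :: y :: ys) = 0) ->
  xs != [::] -> ins mu sg g xs = g [:: mu xs].
Proof.
case: xs => [//|x xs] g0 _ /=.
rewrite ins_nil // addr0; elim/last_ind: xs => [//|ys y _].
rewrite spl_rcons /= [X in X + _](_ : _ = 0) ?add0r //.
rewrite -[RHS](spl0 _ ys); apply: eq_spl => u v _.
by case: v => [|a v]; rewrite g0.
Qed.

Lemma ins_eq0 (V : zmodType) (g : seq E -> V) xs : multiadd g ->
  (forall ys, (size ys <= size xs)%N -> mu ys = 0) -> ins mu sg g xs = 0.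
Proof.
elim: xs g => [//|x xs IH] g gD mu0 /=.
rewrite IH ?addr0; first last.
- by move=> ys /leqW; exact: mu0.
- exact: multiadd_cons.
rewrite -[RHS](spl0 _ xs); apply: eq_spl => u v e.
by rewrite mu0 ?(multiadd0 gD [::]) //= -e size_cat ltnS leq_addr.
Qed.

Lemma ins_short (V : zmodType) (g : seq E -> V) xs : multiadd g ->
  xs != [::] -> (forall ys, (size ys < size xs)%N -> mu ys = 0) ->
  ins mu sg g xs = g [:: mu xs].
Proof.
case: xs => [//|x xs] gD _ mu0 /=.
rewrite ins_eq0 ?addr0 //; last exact: multiadd_cons.
elim/last_ind: xs mu0 => [//|ys y _] mu0.
rewrite spl_rcons /= [X in X + _](_ : _ = 0) ?add0r //.
rewrite -[RHS](spl0 _ ys); apply: eq_spl => u v e.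
by rewrite mu0 ?(multiadd0 gD [::]) //= size_rcons -e size_cat !ltnS leq_addr.
Qed.

End InsertionTheory.

Lemma ins_multilin (F : pzRingType) (E V : lmodType F) (mu : seq E -> E)
    (sg : {linear E -> E}) (g : seq E -> V) :
  multilin mu -> multilin g -> multilin (ins mu sg g).
Proof.
move=> muL gL c s; elim: s g gL => [|a s IH] g gL t x y /=.
  rewrite linearP scalerDr addrACA; congr (_ + _).
    have ZD : {morph (fun z : V => c *: z) : z z' / z + z'}.
      by move=> *; rewrite scalerDr.
    rewrite (raddf_spl _ _ ZD) -splD; apply: eq_spl => u v _.
    by rewrite (muL c [::]) (gL c [::]).
  have ZD : {morph (fun z : V => c *: z) : z z' / z + z'}.
    by move=> *; rewrite scalerDr.
  by rewrite (raddf_ins _ _ _ _ ZD) -insD; apply: eq_ins => ys; exact: (gL c [::]).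
rewrite IH; last exact: multilin_cons.
rewrite (spl_multilin (G := fun v w => g (mu (a :: v) :: w))).
- by rewrite scalerDr addrACA.
- by move=> u; exact: multilin_cons.
- move=> v c' s' t' x' y' /=.
  by rewrite (muL c' (a :: s')) (gL c' [::]).
Qed.

Lemma linear_addm (R : pzRingType) (U V : lmodType R) (f : {linear U -> V}) :
  {morph f : x y / x + y}.
Proof. exact: linearD. Qed.

Lemma linear_scalem (R : pzRingType) (U V : lmodType R) (f : {linear U -> V}) a x :
  f (a *: x) = a *: f x.
Proof. exact: linearZ. Qed.

Section Transfer.
Variables (K : fieldType) (E B : lmodType K) (mul : B -> B -> B).
Variables (D tau h : {linear B -> B}) (i : {linear E -> B}) (p : {linear B -> E}).
Variable sg : {linear E -> E}.

(** The tree recursion of homotopy transfer: i on letters, and h of the sum of products of shorter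
    values on longer words. The fuel [n] stands for the length. Splittings with an empty factor call
    the recursion on the whole word, but they contribute 0 because the value on the empty word is
    0. *)
Fixpoint transfer_rec (n : nat) (xs : seq E) : B :=
  if n is n'.+1 then
    match xs with
    | [::] => 0
    | [:: x] => i x
    | _ => h (spl (fun u v => mul (tau (transfer_rec n' u)) (transfer_rec n' v)) xs)
    end
  else 0.

Definition transfer_map (xs : seq E) : B := transfer_rec (size xs) xs.

Definition transfer_prod (xs : seq E) : B :=
  spl (fun u v => mul (tau (transfer_map u)) (transfer_map v)) xs.

Definition transfer_op (xs : seq E) : E := p (transfer_prod xs).

Local Notation f := transfer_map.
Local Notation Phi := transfer_prod.
Local Notation mu := transfer_op.

Hypothesis mulDl : forall (c : K) x y z, mul (c *: x + y) z = c *: mul x z + mul y z.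
Hypothesis mulDr : forall (c : K) x y z, mul x (c *: y + z) = c *: mul x y + mul x z.

Lemma bmul0l x : mul 0 x = 0.
Proof. by have := mulDl (-1) 0 0 x; rewrite scaler0 addr0 scaleN1r addNr. Qed.
Lemma bmul0r x : mul x 0 = 0.
Proof. by have := mulDr (-1) x 0 0; rewrite scaler0 addr0 scaleN1r addNr. Qed.

Lemma transfer_rec_nil n : transfer_rec n [::] = 0.
Proof. by case: n. Qed.

Lemma transfer_recS n x y xs : transfer_rec n.+1 (x :: y :: xs) =
  h (spl (fun u v => mul (tau (transfer_rec n u)) (transfer_rec n v)) (x :: y :: xs)).
Proof. by []. Qed.

Lemma transfer_rec_stable n xs : (size xs <= n)%N -> transfer_rec n xs = f xs.
Proof.
rewrite /transfer_map; elim: n {-2}n (leqnn n) xs => [|N IH] [|n] // leN xs.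
- by rewrite leqn0 size_eq0 => /eqP ->.
- by rewrite leqn0 size_eq0 => /eqP ->.
case: xs => [|x [|y xs]] // les; rewrite [size _]/= !transfer_recS; congr (h _).
have IH' u : (size u <= (size xs).+1)%N ->
    transfer_rec n u = transfer_rec (size xs).+1 u.
  move=> leu; rewrite IH //; last exact: leq_trans leu _.
  by rewrite [RHS]IH //; exact: leq_trans les leN.
apply: eq_spl => u v /(congr1 size); rewrite size_cat => suv.
have [->|u0] := eqVneq u [::]; first by rewrite !transfer_rec_nil !linear0 !bmul0l.
have [->|v0] := eqVneq v [::]; first by rewrite !transfer_rec_nil !bmul0r.
rewrite -size_eq0 -lt0n in u0; rewrite -size_eq0 -lt0n in v0.
rewrite !IH' // -ltnS -[X in (_ < X)%N]suv.
  by rewrite -add1n leq_add2r.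
by rewrite -addn1 leq_add2l.
Qed.

Lemma transfer_map_nil : f [::] = 0. Proof. by []. Qed.

Lemma transfer_map1 x : f [:: x] = i x. Proof. by []. Qed.

Lemma transfer_mapE x y xs : f (x :: y :: xs) = h (Phi (x :: y :: xs)).
Proof.
rewrite {1}/transfer_map [size _]/= transfer_recS; congr (h _).
apply: eq_spl => u v /(congr1 size); rewrite size_cat => suv.
have [->|u0] := eqVneq u [::]; first by rewrite transfer_rec_nil transfer_map_nil !linear0 !bmul0l.
have [->|v0] := eqVneq v [::]; first by rewrite transfer_rec_nil transfer_map_nil !bmul0r.
rewrite -size_eq0 -lt0n in u0; rewrite -size_eq0 -lt0n in v0.
rewrite !transfer_rec_stable // -ltnS -[X in (_ < X)%N]suv.
  by rewrite -add1n leq_add2r.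
by rewrite -addn1 leq_add2l.
Qed.

Lemma transfer_prod1 x : Phi [:: x] = 0.
Proof. by rewrite /Phi /= transfer_map_nil linear0 bmul0l bmul0r addr0. Qed.

Lemma transfer_prod_nil : Phi [::] = 0.
Proof. by rewrite /Phi /= transfer_map_nil bmul0r. Qed.

Lemma transfer_op1 x : mu [:: x] = 0.
Proof. by rewrite /mu transfer_prod1 linear0. Qed.

Lemma prod_multilin (g : seq E -> B) : multilin g ->
  multilin (spl (fun u v => mul (tau (g u)) (g v))).
Proof.
move=> gL; apply: spl_multilin => [u|v] c s t x y.
  by rewrite gL mulDr.
by rewrite gL linearP mulDl.
Qed.

Lemma transfer_rec_multilin n : multilin (transfer_rec n).
Proof.
elim: n => [|n IH] c s t x y; first by rewrite /= scaler0 addr0.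
case: s t => [|a s] [|b t].
- by rewrite /= linearP.
- have := prod_multilin IH c [::] (b :: t) x y => /(congr1 h).
  by rewrite linearP.
- case: s => [|a' s].
  + have := prod_multilin IH c [:: a] [::] x y => /(congr1 h).
    by rewrite linearP.
  + have := prod_multilin IH c [:: a, a' & s] [::] x y => /(congr1 h).
    by rewrite linearP.
- case: s => [|a' s].
  + have := prod_multilin IH c [:: a] (b :: t) x y => /(congr1 h).
    by rewrite linearP.
  + have := prod_multilin IH c [:: a, a' & s] (b :: t) x y => /(congr1 h).
    by rewrite linearP.
Qed.

Lemma transfer_multilin : multilin f.
Proof.
move=> c s t x y; rewrite /transfer_map !size_cat /=.
exact: transfer_rec_multilin.
Qed.

Lemma transfer_prod_multilin : multilin Phi.
Proof. exact: prod_multilin transfer_multilin. Qed.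

Lemma transfer_op_multilin : multilin mu.
Proof.
by move=> c s t x y; rewrite /mu transfer_prod_multilin linearP.
Qed.

Hypothesis mulA : forall x y z, mul x (mul y z) = mul (mul x y) z.
Hypothesis tau_mul : forall x y, tau (mul x y) = mul (tau x) (tau y).
Hypothesis tauK : involutive tau.
Hypothesis sgK : involutive sg.
Hypothesis h_tau : forall x, tau (h x) = - h (tau x).
Hypothesis i_tau : forall x, tau (i x) = - i (sg x).
Hypothesis p_tau : forall b, sg (p b) = - p (tau b).

Lemma bmulNl x y : mul (- x) y = - mul x y.
Proof. by have := mulDl (-1) x 0 y; rewrite bmul0l !addr0 !scaleN1r. Qed.
Lemma bmulNr x y : mul x (- y) = - mul x y.
Proof. by have := mulDr (-1) x y 0; rewrite bmul0r !addr0 !scaleN1r. Qed.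
Lemma mulDDl x y z : mul (x + y) z = mul x z + mul y z.
Proof. by have := mulDl 1 x y z; rewrite !scale1r. Qed.
Lemma mulDDr x y z : mul x (y + z) = mul x y + mul x z.
Proof. by have := mulDr 1 x y z; rewrite !scale1r. Qed.

(** The parity of B is [tau] and that of E is [- sg]. On the shifted spaces they become [- tau] and
    [sg], and for these f has degree 0. *)
Lemma tau_transfer xs : tau (f xs) = - f (map sg xs).
Proof.
have [n] := ubnP (size xs); elim: n xs => // n IH xs.
case: xs => [|x [|y xs]] ltn; first by rewrite !transfer_map_nil linear0 oppr0.
  exact: i_tau.
rewrite transfer_mapE h_tau -[RHS]/(- f [:: sg x, sg y & map sg xs]) transfer_mapE.
congr (- h _); rewrite /Phi (raddf_spl _ _ (linear_addm tau)).
rewrite -[X in _ = spl _ X]/(map sg [:: x, y & xs]).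
move: (x :: y :: xs) ltn => ws.
have spl_map G (zs : seq E) : spl G (map sg zs) = spl (fun u v => G (map sg u) (map sg v)) zs :> B.
  by elim: zs G => [//|z zs IHz] G /=; rewrite IHz.
move=> ltn; rewrite spl_map; apply: eq_spl => u v /(congr1 size) /=; rewrite size_cat.
rewrite tau_mul => suv.
have [->|u0] := eqVneq u [::]; first by rewrite !transfer_map_nil !linear0 !bmul0l.
have [->|v0] := eqVneq v [::]; first by rewrite !transfer_map_nil !linear0 !bmul0r.
rewrite -size_eq0 -lt0n in u0; rewrite -size_eq0 -lt0n in v0.
rewrite [in tau (f v)]IH ?bmulNr; last first.
  by move: ltn; rewrite -suv ltnS; apply: leq_trans; rewrite -add1n leq_add2r.
rewrite [in tau (f u)]IH ?linearN ?bmulNl ?opprK //.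
by move: ltn; rewrite -suv ltnS; apply: leq_trans; rewrite -addn1 leq_add2l.
Qed.

Lemma tau_transfer' xs : tau (f (map sg xs)) = - f xs.
Proof.
have -> : f (map sg xs) = - tau (f xs) by rewrite tau_transfer opprK.
by rewrite linearN tauK.
Qed.

Lemma tau_transfer_prod xs : tau (Phi xs) = Phi (map sg xs).
Proof.
have spl_map G (zs : seq E) :
    spl G (map sg zs) = spl (fun u v => G (map sg u) (map sg v)) zs :> B.
  by elim: zs G => [//|z zs IHz] G /=; rewrite IHz.
rewrite /Phi (raddf_spl _ _ (linear_addm tau)) spl_map; apply: eq_spl => u v _.
by rewrite tau_mul tauK [tau (f v)]tau_transfer tau_transfer' bmulNl bmulNr.
Qed.

(** For the shifted parities the operations are odd; this is what [ins_ins] asks for. *)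
Lemma transfer_op_sg xs : mu (map sg xs) = - sg (mu xs).
Proof. by rewrite /mu p_tau opprK tau_transfer_prod. Qed.

Hypothesis D_mul : forall x y, D (mul x y) = mul (D x) y + mul (tau x) (D y).
Hypothesis D_tau : forall x, D (tau x) = - tau (D x).
Hypothesis D_i : forall x, D (i x) = 0.
Hypothesis p_D : forall b, p (D b) = 0.
Hypothesis p_i : forall x, p (i x) = x.
Hypothesis homotopy : forall b, D (h b) + h (D b) = i (p b) - b.
Hypothesis h_h : forall b, h (h b) = 0.
Hypothesis p_h : forall b, p (h b) = 0.

Local Notation del := (ins mu sg).

(* the A-infinity relations in bar form: F o b = m_2(F, F) + D F and b o b = 0 *)
Lemma transfer_relations xs :
  del f xs = Phi xs + D (f xs) /\ del mu xs = 0.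
Proof.
have fD := multilin_add transfer_multilin.
have muD := multilin_add transfer_op_multilin.
have [n] := ubnP (size xs); elim: n xs => // n IH xs ltn.
case: xs ltn => [|x [|y xs]] ltn.
- by rewrite /= /Phi /= transfer_map_nil linear0 bmul0l linear0 addr0.
- have d1 (V : zmodType) (g : seq E -> V) : del g [:: x] = g [:: mu [:: x]] + 0 by [].
  rewrite !d1 transfer_op1 transfer_prod1 [f [:: x]]transfer_map1 D_i !addr0.
  by split=> //; rewrite transfer_op1; exact: (multiadd0 fD [::] [::]).
set ws := [:: x, y & xs] in ltn *.
have ws0 : ws != [::] by [].
have PhiD := multilin_add transfer_prod_multilin.
have mu0 := multiadd0 muD; have f0 := multiadd0 fD.
have delfL : multilin (del f) by apply: ins_multilin; [exact: transfer_op_multilin|exact: transfer_multilin].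
have delf0 := multiadd0 (multilin_add delfL).
have Phi0 := multiadd0 PhiD.
have ltP ys : (size ys < size ws)%N -> (size ys < n)%N.
  by move=> h1; exact: leq_trans h1 ltn.
(* [D] is a derivation, and by induction [D f = del f - Phi] on the proper factors of the word. The
   terms with [Phi] cancel by associativity, which is [assoc]. *)
have DPhi : D (Phi ws) = - del Phi ws.
  rewrite /Phi (ins_spl _ _ (fun u v => mul (tau (f u)) (f v))) (raddf_spl _ _ (linear_addm D)).
  rewrite (_ : spl (fun v w => _ + _) ws =
    spl (fun u v => mul (tau (del f u)) (f v) - mul (f u) (del f v)) ws); last first.
    apply: eq_spl => u v _; congr (_ + _).
      have lD : {morph (fun z => mul (tau z) (f v)) : a b / a + b}.
        by move=> a b; rewrite linearD mulDDl.
      by rewrite (raddf_ins _ _ _ _ lD).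
    have rD : {morph (fun z => mul (tau (f (map sg u))) z) : a b / a + b}.
      by move=> a b; rewrite mulDDr.
    by rewrite -(raddf_ins _ _ _ _ rD) tau_transfer' bmulNl.
  have assoc : spl (fun u v => mul (tau (Phi u)) (f v) - mul (f u) (Phi v)) ws = 0.
    have oppD : {morph (fun z : B => - z) : a b / a + b} by move=> a b; rewrite opprD.
    rewrite splD -(raddf_spl _ _ oppD); apply/eqP; rewrite subr_eq0; apply/eqP.
    transitivity (spl (fun u v => spl (fun a b => mul (mul (f a) (tau (f b))) (f v)) u) ws).
      apply: eq_spl => u v _; rewrite /Phi (raddf_spl _ _ (linear_addm tau)).
      have lD : {morph mul^~ (f v) : a b / a + b} by move=> a b; rewrite mulDDl.
      by rewrite (raddf_spl _ _ lD); apply: eq_spl => a b _; rewrite tau_mul tauK.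
    rewrite -(spl_assoc (fun a b v => mul (mul (f a) (tau (f b))) (f v))).
    apply: eq_spl => u v _; rewrite /Phi.
    by rewrite (raddf_spl _ _ (mulDDr (f u))); apply: eq_spl => a b _; rewrite mulA.
  have oppD : {morph (fun z : B => - z) : a b / a + b} by move=> a b; rewrite opprD.
  rewrite (raddf_spl _ _ oppD) -[RHS]addr0 -{1}assoc -splD.
  apply: eq_spl => u v /(congr1 size); rewrite size_cat => suv.
  have del0 : del f [::] = 0 by [].
  have [->|u0] := eqVneq u [::].
    by rewrite del0 transfer_prod_nil transfer_map_nil !linear0 !bmul0l !linear0 !(subr0, oppr0, addr0).
  have [->|v0] := eqVneq v [::].
    by rewrite del0 transfer_prod_nil transfer_map_nil !bmul0r !linear0 !(subr0, oppr0, addr0).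
  rewrite -size_eq0 -lt0n in u0; rewrite -size_eq0 -lt0n in v0.
  have [|-> _] := IH u.
    by move: ltn; rewrite -suv ltnS; apply: leq_trans; rewrite -addn1 leq_add2l.
  have [|-> _] := IH v.
    by move: ltn; rewrite -suv ltnS; apply: leq_trans; rewrite -add1n leq_add2r.
  rewrite D_mul D_tau tauK bmulNl (linear_addm tau) mulDDl mulDDr.
  set a := mul (tau (Phi u)) _; set b := mul (tau (D _)) _.
  set a' := mul _ (Phi v); set b' := mul _ (D _).
  by rewrite opprB opprD [a' + b']addrC -!addrA (addrCA (- b) a) addKr
    (addrCA a') subrr addr0 addrC.
(* Under [del] the words are shorter, so [D f] may be replaced by [del f - Phi]. In [del (del f)]
   only the insertion of the whole word survives, because [del mu] vanishes on shorter words. *)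
have Ddel : D (del f ws) = i (del mu ws) + D (Phi ws).
  rewrite DPhi (raddf_ins _ _ _ _ (linear_addm D)).
  rewrite (@eq_ins_size _ _ _ _ _ (fun ys => del f ys - Phi ys)); first last.
  - by move=> ys /ltP lys /=; rewrite (IH _ lys).1 addrC addKr.
  - by move=> s t /=; rewrite f0 delf0 Phi0 linear0 subr0.
  - exact: transfer_op1.
  have oppD : {morph (fun z : B => - z) : a b / a + b} by move=> a b; rewrite opprD.
  rewrite insD -(raddf_ins _ _ _ _ oppD); congr (_ - _).
  rewrite ins_ins //; last exact: transfer_op_sg.
  rewrite ins_short // => ys /ltP lys; exact: (IH _ lys).2.
have delmu0 : del mu ws = 0.
  by have := congr1 p Ddel; rewrite (linear_addm p) !p_D p_i addr0 => <-.
split=> //; rewrite delmu0 linear0 add0r in Ddel.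
(* The map f is [f1] on letters plus [h] of [P2] on longer words. Hence [del f ws] is [i (mu ws)]
   plus an element of the image of [h], on which the homotopy identity simplifies through h h = 0
   and p h = 0. *)
pose f1 (zs : seq E) : B := if zs is [:: z] then i z else 0.
pose P2 (zs : seq E) : B := if zs is [:: _, _ & _] then Phi zs else 0.
have delE : del f ws = i (mu ws) + h (del P2 ws).
  rewrite (raddf_ins _ _ _ _ (linear_addm h)) -[i (mu ws)]/(f1 [:: mu ws]).
  rewrite -(@ins_long _ mu sg _ f1) // -insD; apply: eq_ins => -[|a [|b zs]] /=.
  - by rewrite linear0 addr0.
  - by rewrite linear0 addr0.
  - by rewrite add0r; exact: transfer_mapE.
have fE : f ws = h (Phi ws) by exact: transfer_mapE.
have homD : h (D (del f ws)) = - h (del P2 ws).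
  have := homotopy (h (del P2 ws)).
  rewrite h_h p_h !linear0 !add0r => <-.
  by rewrite delE (linear_addm D) D_i add0r.
have := homotopy (Phi ws); rewrite -Ddel homD => /eqP.
rewrite subr_eq => /eqP e.
by rewrite delE fE e addrA [i _ - _]addrC addrA subrr add0r.
Qed.

Hypothesis h_i : forall x, h (i x) = 0.
Variable one : E.
Hypothesis sg_one : sg one = - one.
Hypothesis mul1l : forall b, mul (i one) b = b.
Hypothesis mul1r : forall b, mul b (i one) = b.

Lemma tau_one : tau (i one) = i one.
Proof. by rewrite i_tau sg_one linearN opprK. Qed.

Lemma h_transfer xs : h (f xs) = 0.
Proof.
case: xs => [|x [|y xs]]; first by rewrite transfer_map_nil linear0.
  by rewrite transfer_map1 h_i.
by rewrite transfer_mapE h_h.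
Qed.

(** A factor containing [one] together with another letter contributes 0, so only the splittings
    that isolate [one] at an end of the word survive. *)
Lemma transfer_unit_rec n :
  (forall s t, (0 < size s + size t < n)%N -> f (s ++ one :: t) = 0) ->
  forall s t, (0 < size s + size t <= n)%N ->
  Phi (s ++ one :: t) =
    if s is [::] then f t else if t is [::] then tau (f s) else 0.
Proof.
move=> IH [|a s] [|b t] // /andP[_ len].
- rewrite /Phi !spl_cons transfer_map_nil linear0 bmul0l add0r.
  rewrite transfer_map1 tau_one mul1l.
  rewrite [X in _ + X](_ : _ = 0) ?addr0 // -[RHS](spl0 _ t).
  apply: eq_spl => u [|c v] e; first by rewrite transfer_map_nil bmul0r.
  rewrite [f _](IH [::]) ?linear0 ?bmul0l //=.
  by move: len; rewrite /= -e size_cat /=; lia.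
- rewrite cats1 /Phi spl_rcons transfer_map_nil bmul0r addr0.
  have [z [c ez]] : exists z c, a :: s = rcons z c.
    by exists (belast a s), (last a s); exact: lastI.
  rewrite ez spl_rcons [f (rcons [::] _)]transfer_map1 mul1r.
  rewrite [X in X + _](_ : _ = 0) ?add0r // -[RHS](spl0 _ z).
  apply: eq_spl => -[|e u] v ezz; first by rewrite transfer_map_nil linear0 bmul0l.
  rewrite -cats1 IH ?bmul0r //=.
  by move: len; have := congr1 size ez; rewrite !size_rcons -ezz /= size_cat; lia.
- rewrite /Phi -[RHS](spl0 _ ([:: a & s] ++ one :: b :: t)); apply: eq_spl => u v e.
  have [->|u0] := eqVneq u [::]; first by rewrite transfer_map_nil linear0 bmul0l.
  have [->|v0] := eqVneq v [::]; first by rewrite transfer_map_nil bmul0r.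
  rewrite -size_eq0 -lt0n in u0; rewrite -size_eq0 -lt0n in v0.
  have [le|lt] := leqP (size u) (size (a :: s)).
    have vE : v = drop (size u) (a :: s) ++ one :: b :: t.
      have := congr1 (drop (size u)) e; rewrite drop_size_cat // => ->.
      rewrite drop_cat; case: ltnP => // ge; have -> : size u = size (a :: s) by apply/eqP; rewrite eqn_leq le ge.
      by rewrite subnn drop0 drop_size.
    by rewrite vE IH ?bmul0r //; move: len le u0; rewrite size_drop /=; lia.
  have uE : u = (a :: s) ++ one :: take (size u - (size s).+2) (b :: t).
    have := congr1 (take (size u)) e; rewrite take_size_cat // => {1}->.
    rewrite take_cat ltnNge (ltnW lt) [~~ _]/=.
    by have -> : (size u - size (a :: s) = (size u - (size s).+2).+1)%N by move: lt => /=; lia.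
  have suv := congr1 size e; rewrite !size_cat /= in suv.
  rewrite uE IH ?linear0 ?bmul0l //.
  by move: len lt v0 suv; rewrite size_take /=; case: ifP; lia.
Qed.

(** The surviving product is a value of f, possibly under [tau], and [h] kills it because h h = 0
    and h i = 0. *)
Lemma transfer_map_unit s t :
  (0 < size s + size t)%N -> f (s ++ one :: t) = 0.
Proof.
have [n] := ubnP (size s + size t); elim: n s t => // n IH s t ltn lt0.
have fE : f (s ++ one :: t) = h (Phi (s ++ one :: t)).
  by case: s t {ltn} lt0 => [|a [|a' s]] [|b t] // _; exact: transfer_mapE.
rewrite fE (@transfer_unit_rec n) ?lt0 //; last first.
  by move=> s' t' /andP[? ?]; exact: IH.
case: s t {fE ltn} lt0 => [|a s] [|b t] // _; rewrite ?linear0 ?h_transfer //.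
by rewrite -[h _]opprK -h_tau h_transfer linear0 oppr0.
Qed.

(** With at least two further letters the surviving value of f lies in the image of [h], where [p]
    vanishes. With a single further letter it is [p (i x)] up to sign, the unit law. *)
Lemma transfer_op_unit s t :
  (2 <= size s + size t)%N -> mu (s ++ one :: t) = 0.
Proof.
move=> le2; rewrite /mu (@transfer_unit_rec (size s + size t)); first last.
- by rewrite leqnn (leq_trans _ le2).
- by move=> s' t' /andP[? _]; exact: transfer_map_unit.
have pf xs : (2 <= size xs)%N -> p (f xs) = 0.
  by case: xs => [|x [|y xs]] // _; rewrite transfer_mapE p_h.
case: s t le2 => [|a s] [|b t] //= le2; rewrite ?linear0 // ?pf //.
by rewrite -[p _]opprK -p_tau pf ?linear0 ?oppr0 //= -[(size s).+1]addn0.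
Qed.

Lemma transfer_op2 x y : mu [:: x; y] = - p (mul (i (sg x)) (i y)).
Proof.
rewrite /mu /Phi /= transfer_map_nil linear0 bmul0l bmul0r add0r addr0.
by rewrite !transfer_map1 i_tau bmulNl linearN.
Qed.

Lemma transfer_op_unitl x : mu [:: one; x] = x.
Proof. by rewrite transfer_op2 sg_one linearN bmulNl mul1l linearN opprK p_i. Qed.

Lemma transfer_op_unitr x : mu [:: x; one] = - sg x.
Proof. by rewrite transfer_op2 mul1r p_i. Qed.

End Transfer.

(** * Homogeneous words and the signs of the shift *)

Section Homogeneous.
Variables (F : fieldType) (E : lmodType F) (I : nmodType) (G : I -> set E).
Implicit Types (ds : seq I) (xs : seq E).

Lemma homogeneous_cons d ds x xs :
  homogeneous G (d :: ds) (x :: xs) <-> G d x /\ homogeneous G ds xs.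
Proof.
split=> [[/= [s] h]|[Gx [s h]]].
  by split; [exact: (h 0%N)|split=> // i; exact: (h i.+1)].
by split=> [|[|i]] //=; [rewrite s|exact: h].
Qed.

Lemma homogeneous_cat ds es xs ys :
  homogeneous G ds xs -> homogeneous G es ys ->
  homogeneous G (ds ++ es) (xs ++ ys).
Proof.
elim: xs ds => [|x xs IH] [|d ds] //=; try by case.
by move=> /homogeneous_cons[Gx h] h'; apply/homogeneous_cons; split; [|exact: IH].
Qed.

Lemma homogeneous_take n ds xs :
  homogeneous G ds xs -> homogeneous G (take n ds) (take n xs).
Proof.
elim: xs n ds => [|x xs IH] [|n] [|d ds] //; try by case.
by move=> /homogeneous_cons[Gx h]; apply/homogeneous_cons; split; [|exact: (IH n)].
Qed.

Lemma homogeneous_drop n ds xs :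
  homogeneous G ds xs -> homogeneous G (drop n ds) (drop n xs).
Proof.
elim: xs n ds => [|x xs IH] [|n] [|d ds] //; try by case.
by move=> /homogeneous_cons[Gx h]; exact: (IH n).
Qed.

Lemma homogeneous_size ds xs : homogeneous G ds xs -> size ds = size xs.
Proof. by case. Qed.

End Homogeneous.

Section Signs.
Variable (K : fieldType).

Definition eps (z : int) : K := (-1) ^ z.

Lemma epsD a b : eps (a + b) = eps a * eps b.
Proof. by rewrite /eps expfzDr // oppr_eq0 oner_eq0. Qed.

Lemma eps1 : eps 1 = -1. Proof. by rewrite /eps expr1z. Qed.

Lemma eps_sqr a : eps a * eps a = 1.
Proof. by rewrite /eps -expfzMl mulrNN mulr1 exp1rz. Qed.

Lemma eps_eq a b c : a = b + 2 * c -> eps a = eps b.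
Proof.
move=> ->; rewrite (_ : 2 * c = c + c); last by ring.
by rewrite !epsD eps_sqr mulr1.
Qed.

Lemma epsN a : eps (- a) = eps a.
Proof. by apply: (@eps_eq _ _ (- a)); ring. Qed.

Lemma mulrz_eps (V : lmodType K) (x : V) z : x *~ (-1) ^ z = eps z *: x.
Proof. by rewrite -scaler_int rmorphXz ?rmorphN1. Qed.

End Signs.

(** Exponent of the decalage sign: each letter is counted once for every later letter, since the
    shifts standing over those letters move past it. *)
Fixpoint wt (ps : seq int) : int :=
  if ps is p :: ps' then (size ps')%:Z * p + wt ps' else 0.

Lemma wt_cat us vs :
  wt (us ++ vs) = (size vs)%:Z * (\sum_(p <- us) p) + wt us + wt vs.
Proof.
elim: us => [|p us IH] /=; first by rewrite big_nil mulr0 !add0r.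
by rewrite IH big_cons size_cat PoszD; ring.
Qed.

Lemma sum_succ (us : seq int) :
  \sum_(p <- us) (p + 1) = \sum_(p <- us) p + (size us)%:Z.
Proof.
elim: us => [|p us IH]; first by rewrite !big_nil.
by rewrite !big_cons IH /= -[(size us).+1]addn1 PoszD; ring.
Qed.

Section Twisting.
Variables (K : fieldType) (E : lmodType K) (sg : {linear E -> E}) (G : int -> set E).
Hypothesis sgG : forall p x, G p x -> sg x = eps K (p + 1) *: x.

(* turns the operations of the bar construction into operations with the signs
   of an A-infinity algebra; - sg is the parity of E *)
Fixpoint twist (xs : seq E) : seq E :=
  if xs is x :: xs' then iter (size xs') (fun y => - sg y) x :: twist xs' else [::].

Lemma size_twist xs : size (twist xs) = size xs.
Proof. by elim: xs => //= x xs ->. Qed.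

Lemma iter_sg n p x : G p x -> iter n (fun y => - sg y) x = eps K (n%:Z * p) *: x.
Proof.
move=> Gx; elim: n => [|n IH] /=; first by rewrite mul0r scale1r.
rewrite IH linearZ (sgG Gx) /= scalerA -scaleNr; congr (_ *: x).
rewrite -mulN1r -eps1 -!epsD; apply: (@eps_eq _ _ _ 1).
by rewrite -[n.+1]addn1 PoszD; ring.
Qed.

Variables (V : lmodType K) (g : seq E -> V).
Hypothesis gL : multilin g.

Lemma multilin_twist_rec s ps xs : homogeneous G ps xs ->
  g (s ++ twist xs) = eps K (wt ps) *: g (s ++ xs).
Proof.
elim: xs s ps => [|x xs IH] s [|p ps]; try by case.
  by rewrite scale1r.
move=> /homogeneous_cons[Gx hxs] /=.
rewrite (iter_sg _ Gx) multilinZ // -cat_rcons (IH _ _ hxs) cat_rcons scalerA.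
by rewrite epsD (homogeneous_size hxs).
Qed.

Lemma multilin_twist ps xs : homogeneous G ps xs ->
  g (twist xs) = eps K (wt ps) *: g xs.
Proof. exact: (multilin_twist_rec [::]). Qed.

Lemma multilin_sg_rec s ps xs : homogeneous G ps xs ->
  g (s ++ map sg xs) = eps K (\sum_(p <- ps) (p + 1)) *: g (s ++ xs).
Proof.
elim: xs s ps => [|x xs IH] s [|p ps]; try by case.
  by rewrite big_nil scale1r.
move=> /homogeneous_cons[Gx hxs] /=.
rewrite (sgG Gx) multilinZ // -cat_rcons (IH _ _ hxs) cat_rcons scalerA.
by rewrite big_cons -epsD.
Qed.

Lemma multilin_sg ps xs : homogeneous G ps xs ->
  g (map sg xs) = eps K (\sum_(p <- ps) (p + 1)) *: g xs.
Proof. exact: (multilin_sg_rec [::]). Qed.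

End Twisting.

Lemma twist_multilin (K : fieldType) (E V : lmodType K) (sg : {linear E -> E})
    (g : seq E -> V) : multilin g -> multilin (fun xs => g (twist sg xs)).
Proof.
move=> gL c s t x y.
have H r s' : g (r ++ twist sg (s' ++ (c *: x + y) :: t)) =
    c *: g (r ++ twist sg (s' ++ x :: t)) + g (r ++ twist sg (s' ++ y :: t)).
  elim: s' r => [|a s' IH] r /=.
    have -> : iter (size t) (fun z => - sg z) (c *: x + y) =
        c *: iter (size t) (fun z => - sg z) x + iter (size t) (fun z => - sg z) y.
      by elim: (size t) => //= n ->; rewrite linearP opprD scalerN.
    exact: gL.
  by rewrite !size_cat /= -![r ++ _ :: _]cat_rcons IH.
exact: (H [::]).
Qed.

Lemma stasheff_map (K : fieldType) (E : lmodType K) (V W : zmodType)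
    (f : {additive V -> W}) (g : seq E -> V) m ps xs :
  stasheff (fun ys => f (g ys)) m ps xs = f (stasheff g m ps xs).
Proof.
rewrite /stasheff raddf_sum; apply: eq_bigr => i _; rewrite raddf_sum.
by apply: eq_bigr => t _; rewrite raddfMz.
Qed.

Fixpoint word_in (E : Type) (Ss : seq (set E)) (xs : seq E) : Prop :=
  match Ss, xs with
  | [::], [::] => True
  | S0 :: Ss', x :: xs' => S0 x /\ word_in Ss' xs'
  | _, _ => False
  end.

(** Reduces degree statements about E^p, the span of its bihomogeneous parts, to words with
    bihomogeneous letters. *)
Lemma multilin_span (K : fieldType) (E V : lmodType K) (g : seq E -> V)
    (T : set V) (Ss : seq (set E)) : multilin g ->
  T 0 -> (forall x y, T x -> T y -> T (x + y)) -> (forall c x, T x -> T (c *: x)) ->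
  (forall xs, word_in Ss xs -> T (g xs)) ->
  forall xs, word_in (map (@lspan K E) Ss) xs -> T (g xs).
Proof.
move=> gL T0 TD TZ; elim: Ss g gL => [|S0 Ss IH] g gL Tg [|x xs] //=.
  by move=> _; exact: Tg.
move=> [Sx hxs]; move: x Sx.
have h : lspan S0 `<=` [set x | T (g (x :: xs))].
  apply: lspan_min => /=.
  - by have -> : g (0 :: xs) = 0 by exact: (multiadd0 (multilin_add gL) [::]).
  - move=> u v hu hv; rewrite (multiaddD (multilin_add gL)); exact: TD.
  - by move=> k v hv; rewrite (multilinZ [::]) //; exact: TZ.
  - move=> x Sx; apply: (IH (fun ys => g (x :: ys))) => //; first exact: multilin_cons.
    by move=> ys hys; apply: Tg.
exact: h.
Qed.

Section Stasheff.
Variables (K : fieldType) (E : lmodType K) (sg : {linear E -> E}) (G : int -> set E).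
Hypothesis sgG : forall p x, G p x -> sg x = eps K (p + 1) *: x.
Variables (mu : seq E -> E).
Hypothesis muL : multilin mu.

Lemma ins_index (V : lmodType K) (g : seq E -> V) ps xs : multilin g ->
  homogeneous G ps xs ->
  ins mu sg g xs = \sum_(0 <= i < size xs) \sum_(1 <= t < (size xs - i).+1)
    eps K (\sum_(p <- take i ps) (p + 1)) *:
    g (take i xs ++ mu (take t (drop i xs)) :: drop (i + t) xs).
Proof.
elim: xs g ps => [|x xs IH] g [|p ps] gL; try by case.
  by rewrite big_geq.
move=> /homogeneous_cons[Gx hxs].
rewrite ins_cons [size _]/= big_nat_recl //; congr (_ + _).
  rewrite spl_index subn0 big_add1 /=; apply: eq_bigr => t _.
  by rewrite big_nil scale1r.
rewrite (IH _ ps) //; last exact: multilin_cons.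
apply: eq_bigr => i _; rewrite subSS; apply: eq_bigr => t _ /=.
by rewrite (sgG Gx) (multilinZ [::]) // scalerA big_cons -epsD addrC.
Qed.

Hypothesis GZ : forall p c x, G p x -> G p (c *: x).
Hypothesis mu_deg : forall ps xs, (0 < size xs)%N -> homogeneous G ps xs ->
  G (\sum_(p <- ps) p + (2 - (size xs)%:Z)) (mu xs).

(** Decalage turns the sign of the bar differential, where [sg] acts on the prefix only, into the
    sign i + j t of the Stasheff identity together with the Koszul sign. What remains of the twist
    is the common factor [eps K (wt ps)]. *)
Lemma stasheff_twist (V : lmodType K) (g : seq E -> V) ps xs : multilin g ->
  homogeneous G ps xs ->
  stasheff (fun ys => g (twist sg ys)) (fun ys => mu (twist sg ys)) ps xs =
  eps K (wt ps) *: ins mu sg g xs.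
Proof.
move=> gL hxs; rewrite (ins_index gL hxs) /stasheff scaler_sumr.
apply: eq_big_nat => i /andP[_ lti]; rewrite scaler_sumr.
apply: eq_big_nat => t /andP[t0 ltt].
set u := take i xs; set v := take t (drop i xs); set w := drop (i + t) xs.
have hu : homogeneous G (take i ps) u by exact: homogeneous_take.
have hv : homogeneous G (take t (drop i ps)) v.
  by apply/homogeneous_take/homogeneous_drop.
have hw : homogeneous G (drop (i + t) ps) w by exact: homogeneous_drop.
have psE : ps = take i ps ++ take t (drop i ps) ++ drop (i + t) ps.
  by rewrite -{1}[ps](cat_take_drop i) -{1}[drop i ps](cat_take_drop t) drop_drop addnC.
have su : size u = i by rewrite size_take lti.
have sv : size v = t.
  by rewrite size_take size_drop; case: ltnP; lia.
have sw : size w = (size xs - i - t)%N by rewrite size_drop subnDA.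
move: (take i ps) (take t (drop i ps)) (drop (i + t) ps) hu hv hw psE => us vs ws hu hv hw ->.
have v0 : (0 < size v)%N by rewrite sv.
rewrite (multilin_twist sgG muL hv) mulrz_eps.
have hq : G (\sum_(p <- vs) p + (2 - (size v)%:Z)) (mu v) by exact: mu_deg.
set q := \sum_(p <- vs) p + _ in hq.
have hmu : homogeneous G (us ++ q :: ws) (u ++ eps K (wt vs) *: mu v :: w).
  apply: homogeneous_cat => //; apply/homogeneous_cons; split=> //.
  exact: GZ.
rewrite (multilin_twist sgG gL hmu) multilinZ // !scalerA -!epsD; congr (_ *: _).
have sus := homogeneous_size hu; have svs := homogeneous_size hv.
have sws := homogeneous_size hw; rewrite su in sus; rewrite sv in svs.
have -> : (size xs - i - t)%N = size ws by rewrite sws sw.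
rewrite !wt_cat [wt (q :: ws)]/= sum_succ sus /q sv !size_cat /= svs.
set Su := \sum_(p <- us) p; set Sv := \sum_(p <- vs) p.
(* The witness is half the difference of the two exponents. *)
apply: (@eps_eq _ _ _ (Su - t%:Z * Su + (size ws)%:Z)).
by rewrite !PoszD PoszM -[(size ws).+1]addn1 PoszD; ring.
Qed.

End Stasheff.

(** * Graded modules and bases *)

Definition mklin (R : pzRingType) (U V : lmodType R) (f : U -> V)
    (fL : linear f) : {linear U -> V} :=
  HB.pack f (GRing.isLinear.Build R U V *:%R f fL).

Lemma mklinE (R : pzRingType) (U V : lmodType R) (f : U -> V) (fL : linear f) :
  mklin fL =1 f.
Proof. by []. Qed.

Lemma big_uniq_subset (I : eqType) (V : nmodType) (r r' : seq I) (f : I -> V) :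
  uniq r -> uniq r' -> {subset r <= r'} ->
  (forall i, i \in r' -> i \notin r -> f i = 0) ->
  \sum_(i <- r') f i = \sum_(i <- r) f i.
Proof.
move=> ur ur' rr' f0; rewrite (bigID (mem r)) /= [X in _ + X]big1_seq ?addr0.
  rewrite -big_filter; apply: perm_big; apply: uniq_perm => //; first exact: filter_uniq.
  by move=> i; rewrite mem_filter andb_idr //; exact: rr'.
by move=> i /andP[nr ir']; exact: f0.
Qed.

Section GradingProjection.
Variables (I : eqType) (V : zmodType) (G : I -> set V).
Hypothesis hG : is_grading G.

Let G0 i : G i 0. Proof. by have [h _ _] := hG; exact: (h i).1. Qed.
Let GB i x y : G i x -> G i y -> G i (x - y).
Proof. by have [h _ _] := hG; exact: (h i).2. Qed.
Let GN i x : G i x -> G i (- x).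
Proof. by move=> Gx; rewrite -sub0r; exact: GB. Qed.
Let GD i x y : G i x -> G i y -> G i (x + y).
Proof. by move=> Gx Gy; rewrite -[y]opprK; apply/GB/GN. Qed.

Lemma grading_sum i (J : Type) (r : seq J) (P : pred J) (f : J -> V) :
  (forall j, P j -> G i (f j)) -> G i (\sum_(j <- r | P j) f j).
Proof. by move=> h; elim/big_ind: _ => // x y; exact: GD. Qed.

Lemma grading_decomp x : exists sc : seq I * (I -> V),
  [/\ uniq sc.1, forall i, G i (sc.2 i), x = \sum_(i <- sc.1) sc.2 i
    & forall i, i \notin sc.1 -> sc.2 i = 0].
Proof.
have [_ /(_ x) [s [c [us Gc xE]]] _] := hG.
exists (s, fun i => if i \in s then c i else 0); split=> //=.
- by move=> i; case: ifP.
- by rewrite xE !big_seq; apply: eq_bigr => i ->.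
- by move=> i /negPf ->.
Qed.

Definition gproj (i : I) (x : V) : V := (projT1 (cid (grading_decomp x))).2 i.

Lemma gproj_in i x : G i (gproj i x).
Proof. by rewrite /gproj; case: cid => sc []. Qed.

Lemma gproj_sum x : exists s, [/\ uniq s, x = \sum_(i <- s) gproj i x &
  forall i, i \notin s -> gproj i x = 0].
Proof. by rewrite /gproj; case: cid => -[s c] /= [? ? ? ?]; exists s. Qed.

Lemma gproj_uniq (s : seq I) (c : I -> V) x : uniq s -> (forall i, G i (c i)) ->
  (forall i, i \notin s -> c i = 0) -> x = \sum_(i <- s) c i ->
  forall i, gproj i x = c i.
Proof.
move=> us Gc c0 xE i; have [t [ut xE' p0]] := gproj_sum x.
pose r := undup (s ++ t); have ur : uniq r by exact: undup_uniq.
have [_ _ /(_ r (fun j => gproj j x - c j) ur)] := hG.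
have hGc j : G j (gproj j x - c j) by apply: GB => //; exact: gproj_in.
move=> /(_ hGc); rewrite sumrB.
rewrite (@big_uniq_subset _ _ t r) //; first last.
- by move=> j _; exact: p0.
- by move=> j jt; rewrite mem_undup mem_cat jt orbT.
rewrite (@big_uniq_subset _ _ s r) //; first last.
- by move=> j _; exact: c0.
- by move=> j js; rewrite mem_undup mem_cat js.
rewrite -xE -xE' subrr => /(_ erefl) h.
have [/h /eqP|] := boolP (i \in r); first by rewrite subr_eq0 => /eqP.
by rewrite mem_undup mem_cat negb_or => /andP[/c0 -> /p0 ->].
Qed.

Lemma gproj_id i x : G i x -> gproj i x = x.
Proof.
move=> Gx; rewrite (@gproj_uniq [:: i] (fun j => if j == i then x else 0)) ?eqxx //.
- by move=> j; case: eqP => // ->.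
- by move=> j; rewrite inE => /negPf ->.
- by rewrite big_seq1 eqxx.
Qed.

Lemma gproj_ne i j x : i != j -> G i x -> gproj j x = 0.
Proof.
move=> ij Gx; rewrite (@gproj_uniq [:: i] (fun j => if j == i then x else 0)) //.
- by rewrite eq_sym (negPf ij).
- by move=> k; case: eqP => // ->.
- by move=> k; rewrite inE => /negPf ->.
- by rewrite big_seq1 eqxx.
Qed.

Lemma gprojB i : {morph gproj i : x y / x - y}.
Proof.
move=> x y; have [s [us xE sx]] := gproj_sum x; have [t [ut yE ty]] := gproj_sum y.
rewrite (@gproj_uniq (undup (s ++ t)) (fun i => gproj i x - gproj i y)) //.
- exact: undup_uniq.
- by move=> j; apply: GB; exact: gproj_in.
- by move=> j; rewrite mem_undup mem_cat negb_or => /andP[/sx -> /ty ->]; rewrite subr0.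
- rewrite sumrB {1}xE {1}yE; congr (_ - _); apply/esym/big_uniq_subset => //.
  + exact: undup_uniq.
  + by move=> j js; rewrite mem_undup mem_cat js.
  + by move=> j _; exact: sx.
  + exact: undup_uniq.
  + by move=> j jt; rewrite mem_undup mem_cat jt orbT.
  + by move=> j _; exact: ty.
Qed.

Lemma gproj0 i : gproj i 0 = 0. Proof. exact: gproj_id. Qed.

Lemma gprojD i : {morph gproj i : x y / x + y}.
Proof.
by move=> x y; rewrite -[in LHS](opprK y) gprojB -(sub0r y) gprojB gproj0 sub0r opprK.
Qed.

Lemma gproj_big i (J : Type) (r : seq J) (f : J -> V) :
  gproj i (\sum_(j <- r) f j) = \sum_(j <- r) gproj i (f j).
Proof. exact: (big_morph _ (gprojD i) (gproj0 i)). Qed.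

Lemma grading_ind (T : set V) : T 0 -> (forall x y, T x -> T y -> T (x + y)) ->
  (forall i x, G i x -> T x) -> forall x, T x.
Proof.
move=> T0 TD TG x; have [s [_ -> _]] := gproj_sum x.
by elim/big_ind: _ => // i _; apply: TG; exact: gproj_in.
Qed.

End GradingProjection.

Lemma lspan_uniq (R : pzRingType) (V : lmodType R) (S : set V) v : lspan S v ->
  exists rc : seq V * (V -> R), [/\ uniq rc.1, forall b, b \in rc.1 -> S b,
    forall b, b \notin rc.1 -> rc.2 b = 0 & v = \sum_(b <- rc.1) rc.2 b *: b].
Proof.
pose T : set V := [set v | exists rc : seq V * (V -> R),
  [/\ uniq rc.1, forall b, b \in rc.1 -> S b,
    forall b, b \notin rc.1 -> rc.2 b = 0 & v = \sum_(b <- rc.1) rc.2 b *: b]].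
suff h : lspan S `<=` T by exact: h.
apply: lspan_min.
- by exists ([::], fun=> 0); split=> //; rewrite big_nil.
- move=> u w [[r c] /= [ur rS c0 ->]] [[t e] /= [ut tS e0 ->]].
  exists (undup (r ++ t), fun b => c b + e b); split=> /=.
  + exact: undup_uniq.
  + by move=> b; rewrite mem_undup mem_cat => /orP[/rS|/tS].
  + by move=> b; rewrite mem_undup mem_cat negb_or => /andP[/c0 -> /e0 ->]; rewrite addr0.
  under [RHS]eq_bigr do rewrite scalerDl.
  rewrite big_split /=; congr (_ + _); apply/esym/big_uniq_subset => //; try exact: undup_uniq.
  + by move=> b br; rewrite mem_undup mem_cat br.
  + by move=> b _ /c0 ->; rewrite scale0r.
  + by move=> b bt; rewrite mem_undup mem_cat bt orbT.
  + by move=> b _ /e0 ->; rewrite scale0r.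
- move=> k u [[r c] /= [ur rS c0 ->]]; exists (r, fun b => k * c b); split=> //=.
  + by move=> b /c0 ->; rewrite mulr0.
  + by rewrite scaler_sumr; apply: eq_bigr => b _; rewrite scalerA.
- move=> b Sb; exists ([:: b], fun b' => if b' == b then 1 else 0); split=> //=.
  + by move=> b'; rewrite inE => /eqP ->.
  + by move=> b'; rewrite inE => /negPf ->.
  + by rewrite big_seq1 eqxx scale1r.
Qed.

Section FreeBasis.
Variables (R : pzRingType) (V : lmodType R) (B : set V).
Hypothesis spanB : lspan B = setT.
Hypothesis freeB : forall k (c : 'I_k -> R) (b : 'I_k -> V), injective b ->
  (forall i, B (b i)) -> \sum_(i < k) c i *: b i = 0 -> forall i, c i = 0.

Lemma free_seq (r : seq V) (c : V -> R) : uniq r -> (forall b, b \in r -> B b) ->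
  \sum_(b <- r) c b *: b = 0 -> forall b, b \in r -> c b = 0.
Proof.
move=> ur rB; rewrite -[in \sum_(b <- _) _](in_tupleE r) big_tuple => h b br.
have inj : injective (tnth (in_tuple r)).
  by move=> i j /eqP; rewrite !(tnth_nth 0) nth_uniq // => /eqP /ord_inj.
have := freeB inj _ h => h'.
have lt : (index b r < size r)%N by rewrite index_mem.
have := h' _ (Ordinal lt); rewrite (tnth_nth 0) /= nth_index //; apply.
by move=> i; apply: rB; rewrite (tnth_nth 0) mem_nth.
Qed.

Let decomp x : exists rc : seq V * (V -> R), [/\ uniq rc.1, forall b, b \in rc.1 -> B b,
    forall b, b \notin rc.1 -> rc.2 b = 0 & x = \sum_(b <- rc.1) rc.2 b *: b].
Proof. by apply: lspan_uniq; rewrite spanB. Qed.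

Definition coord_of (b x : V) : R := (projT1 (cid (decomp x))).2 b.

Lemma coord_sum x : exists r, [/\ uniq r, forall b, b \in r -> B b,
  forall b, b \notin r -> coord_of b x = 0 & x = \sum_(b <- r) coord_of b x *: b].
Proof. by rewrite /coord_of; case: cid => -[r c] /= [*]; exists r. Qed.

Lemma coord_uniq (r : seq V) (c : V -> R) x : uniq r -> (forall b, b \in r -> B b) ->
  (forall b, b \notin r -> c b = 0) -> x = \sum_(b <- r) c b *: b ->
  forall b, coord_of b x = c b.
Proof.
move=> ur rB c0 xE b; have [t [ut tB e0 xE']] := coord_sum x.
pose s := undup (r ++ t); have us : uniq s by exact: undup_uniq.
have sB b' : b' \in s -> B b' by rewrite mem_undup mem_cat => /orP[/rB|/tB].
have /(_ _ b) := @free_seq s (fun b => coord_of b x - c b) us sB.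
under [\sum_(_ <- _) _]eq_bigr do rewrite scalerBl.
rewrite sumrB (@big_uniq_subset _ _ t s) //; first last.
- by move=> b' _ /e0 ->; rewrite scale0r.
- by move=> b' bt; rewrite mem_undup mem_cat bt orbT.
rewrite (@big_uniq_subset _ _ r s) //; first last.
- by move=> b' _ /c0 ->; rewrite scale0r.
- by move=> b' br; rewrite mem_undup mem_cat br.
rewrite -xE -xE' subrr => /(_ erefl) h.
have [/h /eqP|] := boolP (b \in s); first by rewrite subr_eq0 => /eqP.
by rewrite mem_undup mem_cat negb_or => /andP[/c0 -> /e0 ->].
Qed.

Lemma coord_linear b a x y : coord_of b (a *: x + y) = a * coord_of b x + coord_of b y.
Proof.
have [r [ur rB c0 xE]] := coord_sum x; have [t [ut tB e0 yE]] := coord_sum y.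
rewrite (@coord_uniq (undup (r ++ t)) (fun b => a * coord_of b x + coord_of b y)) //.
- exact: undup_uniq.
- by move=> b'; rewrite mem_undup mem_cat => /orP[/rB|/tB].
- by move=> b'; rewrite mem_undup mem_cat negb_or => /andP[/c0 -> /e0 ->]; rewrite mulr0 addr0.
under [RHS]eq_bigr do rewrite scalerDl -scalerA.
rewrite big_split /= -scaler_sumr {1}xE {1}yE; congr (_ *: _ + _);
  apply/esym/big_uniq_subset => //; try exact: undup_uniq.
- by move=> b' br; rewrite mem_undup mem_cat br.
- by move=> b' _ /c0 ->; rewrite scale0r.
- by move=> b' bt; rewrite mem_undup mem_cat bt orbT.
- by move=> b' _ /e0 ->; rewrite scale0r.
Qed.

Lemma coord_of_basis b b' : B b -> coord_of b' b = (b' == b)%:R.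
Proof.
move=> Bb; rewrite (@coord_uniq [:: b] (fun b' => (b' == b)%:R)) //.
- by move=> c; rewrite inE => /eqP ->.
- by move=> c; rewrite inE => /negPf ->.
- by rewrite big_seq1 eqxx scale1r.
Qed.

Lemma basis_ext (W : lmodType R) (v : V -> W) :
  exists f : {linear V -> W}, forall b, B b -> f b = v b.
Proof.
pose f x := \sum_(b <- (projT1 (cid (coord_sum x)))) coord_of b x *: v b.
have fE x r : uniq r -> (forall b, b \notin r -> coord_of b x = 0) ->
    f x = \sum_(b <- r) coord_of b x *: v b.
  move=> ur c0; rewrite /f; case: cid => /= t [ut tB e0 _].
  rewrite -[LHS](@big_uniq_subset _ _ t (undup (r ++ t))) //; first last.
  - by move=> b _ /e0 ->; rewrite scale0r.
  - by move=> b bt; rewrite mem_undup mem_cat bt orbT.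
  - exact: undup_uniq.
  apply: big_uniq_subset => //; first exact: undup_uniq.
  - by move=> b br; rewrite mem_undup mem_cat br.
  - by move=> b _ /c0 ->; rewrite scale0r.
have fL : linear f.
  move=> a x y.
  have [r [ur _ c0 _]] := coord_sum x; have [t [ut _ e0 _]] := coord_sum y.
  have us : uniq (undup (r ++ t)) by exact: undup_uniq.
  set R' := undup (r ++ t) in us.
  have sx b : b \notin R' -> coord_of b x = 0.
    by rewrite mem_undup mem_cat negb_or => /andP[/c0].
  have sy b : b \notin R' -> coord_of b y = 0.
    by rewrite mem_undup mem_cat negb_or => /andP[_ /e0].
  rewrite (fE _ R' us sx) (fE _ R' us sy) (fE _ R' us); last first.
    by move=> b nb; rewrite coord_linear sx // sy // mulr0 addr0.
  rewrite scaler_sumr -big_split; apply: eq_bigr => b _ /=.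
  by rewrite coord_linear scalerDl scalerA.
exists (mklin fL) => b Bb; rewrite mklinE (@fE _ [:: b]) //.
  by rewrite big_seq1 coord_of_basis // eqxx scale1r.
by move=> b'; rewrite inE coord_of_basis // => /negPf ->.
Qed.

Lemma basis_span_ind (T : set V) : T 0 -> (forall x y, T x -> T y -> T (x + y)) ->
  (forall a x, T x -> T (a *: x)) -> B `<=` T -> forall x, T x.
Proof.
by move=> T0 TD TZ BT x; have : lspan B x; [rewrite spanB|exact: lspan_min].
Qed.

End FreeBasis.

(** * Graded free resolutions *)

Section GradedAlgebraTheory.
Variables (F : fieldType) (A : graded_algebra F).

Lemma gcomp_alg (c : F) : gcomp 0%N (c%:A : A).
Proof. by rewrite gcomp_connected; exists c. Qed.

Lemma aug_alg (c : F) : aug (c%:A : A) = c.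
Proof. by apply: aug_uniq; rewrite subrr; exact: lspan0. Qed.

Lemma aug_pos i (a : A) : (0 < i)%N -> gcomp i a -> aug a = 0.
Proof.
move=> i0 ga; apply: aug_uniq; rewrite scale0r subr0.
by apply: lspan_incl; exists i.
Qed.

Lemma gcomp0_alg (a : A) : gcomp 0%N a -> a = (aug a)%:A.
Proof. by rewrite gcomp_connected => -[c _ <-]; rewrite aug_alg. Qed.

Lemma aug_ideal_aug (a : A) : aug_ideal a <-> aug a = 0.
Proof.
split=> [h|a0]; first by apply: aug_uniq; rewrite scale0r subr0.
by have := augP a; rewrite a0 scale0r subr0.
Qed.

Lemma algC (c : F) (a : A) : c%:A * a = a * c%:A.
Proof. by rewrite -scalerAl mul1r -scalerAr mulr1. Qed.

Lemma alg_scaleC (V : lmodType A) (c : F) (a : A) (x : V) :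
  a *: (c%:A *: x) = c%:A *: (a *: x).
Proof. by rewrite !scalerA algC. Qed.

Lemma algM (V : lmodType A) (c k : F) (x : V) :
  (c%:A : A) *: (k%:A *: x) = (c * k)%:A *: x.
Proof. by rewrite scalerA -scalerAl mul1r scalerA. Qed.

Lemma algD (V : lmodType A) (c k : F) (x : V) :
  ((c + k)%:A : A) *: x = c%:A *: x + k%:A *: x.
Proof. by rewrite scalerDl scalerDl. Qed.

Lemma alg1 (V : lmodType A) (x : V) : ((1 : F)%:A : A) *: x = x.
Proof. by rewrite scale1r scale1r. Qed.

Lemma alg0 (V : lmodType A) (x : V) : ((0 : F)%:A : A) *: x = 0.
Proof. by rewrite !scale0r. Qed.

End GradedAlgebraTheory.

Section ResolutionTheory.
Variables (F : fieldType) (A : graded_algebra F) (M : lmodType A).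
Variables (G : int -> set M) (N : set M) (P : resolution G N).
Local Notation gr := (res_gr P).
Local Notation d := (res_d P).

Lemma gr0 nj : gr nj 0.
Proof. by have [h _ _] := res_grading P; exact: (h nj).1. Qed.
Lemma grB nj x y : gr nj x -> gr nj y -> gr nj (x - y).
Proof. by have [h _ _] := res_grading P; exact: (h nj).2. Qed.
Lemma grN nj x : gr nj x -> gr nj (- x).
Proof. by move=> Gx; rewrite -sub0r; apply: grB => //; exact: gr0. Qed.
Lemma grD nj x y : gr nj x -> gr nj y -> gr nj (x + y).
Proof. by move=> Gx Gy; rewrite -[y]opprK; apply/grB => //; exact: grN. Qed.
Lemma grZ nj (c : F) x : gr nj x -> gr nj ((c%:A : A) *: x).
Proof.
case: nj => n j gx; rewrite -[j]add0r.
exact: (res_gr_scale (gcomp_alg A c) gx).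
Qed.

Lemma gr_sum nj (I : Type) (r : seq I) (Q : pred I) (f : I -> P) :
  (forall i, Q i -> gr nj (f i)) -> gr nj (\sum_(i <- r | Q i) f i).
Proof. exact: (grading_sum (res_grading P)). Qed.

Definition pr := gproj (res_grading P).

Lemma pr_in nj x : gr nj (pr nj x). Proof. exact: gproj_in. Qed.
Lemma pr_id nj x : gr nj x -> pr nj x = x. Proof. exact: gproj_id. Qed.
Lemma pr_ne nj nj' x : nj != nj' -> gr nj x -> pr nj' x = 0.
Proof. exact: gproj_ne. Qed.
Lemma prD nj : {morph pr nj : x y / x + y}. Proof. exact: gprojD. Qed.
Lemma prB nj : {morph pr nj : x y / x - y}. Proof. exact: gprojB. Qed.
Lemma pr0 nj : pr nj 0 = 0. Proof. exact: gproj0. Qed.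

Lemma gr_uniq nj nj' x : gr nj x -> gr nj' x -> x != 0 -> nj = nj'.
Proof.
move=> h h' x0; apply/eqP; apply: contraNT x0 => ne.
by rewrite -(pr_id h') (pr_ne ne h).
Qed.

Lemma pr_morph (Q : zmodType) (GQ : int * int -> set Q) (hQ : is_grading GQ)
    (f : P -> Q) (s : int * int -> int * int) nj x :
  {morph f : x y / x + y} -> injective s ->
  (forall nj x, gr nj x -> GQ (s nj) (f x)) ->
  gproj hQ (s nj) (f x) = f (pr nj x).
Proof.
move=> fD sI fG; have f0 : f 0 = 0 by apply: (addIr (f 0)); rewrite -fD !add0r.
have [r [ur xE r0]] := gproj_sum (res_grading P) x.
rewrite {1}xE (big_morph f fD f0) gproj_big.
rewrite (eq_bigr (fun i => if i == nj then f (pr i x) else 0)); last first.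
  move=> i _; case: eqP => [->|/eqP ne]; first by apply: gproj_id; apply: fG; exact: gproj_in.
  apply: gproj_ne (fG _ _ (gproj_in _ _ _)).
  by apply: contra ne => /eqP /sI ->.
rewrite -big_mkcond /=; have [rnj|nrnj] := boolP (nj \in r).
  by rewrite -big_filter filter_pred1_uniq // big_seq1.
rewrite big_seq_cond big1 ?[pr nj x]r0 // => i /andP[ir /eqP e].
by rewrite e (negPf nrnj) in ir.
Qed.

Lemma pr_scale i a n j x : gcomp i a -> pr (n, i%:Z + j) (a *: x) = a *: pr (n, j) x.
Proof.
move=> ga; rewrite -[(n, i%:Z + j)]/((fun nj => (nj.1, i%:Z + nj.2)) (n, j)).
apply: pr_morph => [y z|[n1 j1] [n2 j2] /= [-> /addrI ->]//|[n' j'] y].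
  exact: scalerDr.
exact: res_gr_scale.
Qed.

Lemma prZ nj (c : F) x : pr nj ((c%:A : A) *: x) = (c%:A : A) *: pr nj x.
Proof.
by case: nj => n j; rewrite -[X in pr (n, X) (_ *: x)]add0r (pr_scale _ _ _ (gcomp_alg A c)).
Qed.

Lemma pr_d n j x : pr (n - 1, j) (d x) = d (pr (n, j) x).
Proof.
rewrite -[(n - 1, j)]/((fun nj => (nj.1 - 1, nj.2)) (n, j)).
apply: (@pr_morph P gr (res_grading P) d); first exact: linear_addm.
  by move=> [n1 j1] [n2 j2] /= [/addIr -> ->].
by move=> [n' j'] y /=; exact: res_d_gr.
Qed.

Lemma gr_neg0 n j x : n < 0 -> gr (n, j) x -> x = 0.
Proof. by move=> n0; rewrite res_gr_neg. Qed.

Lemma d_gr0 j x : gr (0, j) x -> d x = 0.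
Proof. by move=> /res_d_gr; apply: gr_neg0. Qed.

Definition bas : set P := projT1 (cid (res_free P)).

Lemma bas_span : lspan bas = setT.
Proof. by rewrite /bas; case: cid => B /= []. Qed.

Lemma bas_free k (c : 'I_k -> A) (b : 'I_k -> P) : injective b ->
  (forall i, bas (b i)) -> \sum_(i < k) c i *: b i = 0 -> forall i, c i = 0.
Proof. by rewrite /bas; case: cid => B /= [_ _]; apply. Qed.

Definition deg (b : P) : int * int := xget (0, 0) [set nj | gr nj b].

Lemma deg_bas b : bas b -> gr (deg b) b.
Proof.
move=> Bb; rewrite /deg; case: xgetP => [nj _ //|/= h].
have : exists nj, gr nj b by move: Bb; rewrite /bas; case: cid => B /= [h' _ _] /h'.
by case=> nj /h.
Qed.

Definition co : P -> P -> A := coord_of bas_span.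

Lemma co_linear b a x y : co b (a *: x + y) = a * co b x + co b y.
Proof. exact: coord_linear bas_free _ _ _ _. Qed.
Lemma co_bas b b' : bas b -> co b' b = (b' == b)%:R.
Proof. exact: coord_of_basis bas_free _ _. Qed.
Lemma co_sum x : exists r, [/\ uniq r, forall b, b \in r -> bas b,
  forall b, b \notin r -> co b x = 0 & x = \sum_(b <- r) co b x *: b].
Proof. exact: coord_sum. Qed.

Lemma co0 b : co b 0 = 0.
Proof. by have := co_linear b (-1) 0 0; rewrite scaler0 addr0 mulN1r addNr. Qed.

Lemma bas_neq0 b : bas b -> b != 0.
Proof.
move=> Bb; apply/negP => /eqP b0; have := co_bas b Bb.
by rewrite eqxx b0 co0 => /esym/eqP; rewrite oner_eq0.
Qed.

Lemma deg_uniq nj b : bas b -> gr nj b -> deg b = nj.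
Proof. by move=> Bb h; apply: gr_uniq (deg_bas Bb) h (bas_neq0 Bb). Qed.

Lemma deg_ge0 b : bas b -> 0 <= (deg b).1.
Proof.
move=> Bb; rewrite leNgt; apply/negP => lt0; have := deg_bas Bb.
rewrite [deg b]surjective_pairing => /(gr_neg0 lt0) b0.
by have := bas_neq0 Bb; rewrite b0 eqxx.
Qed.

Lemma d_bas b : bas b -> gr ((deg b).1 - 1, (deg b).2) (d b).
Proof. by move=> /deg_bas; case: (deg b) => n j; exact: res_d_gr. Qed.

Lemma gr_ind n j (T : set P) : T 0 -> (forall x y, T x -> T y -> T (x + y)) ->
  (forall i a b j', gcomp i a -> bas b -> deg b = (n, j') -> i%:Z + j' = j ->
     T (a *: b)) -> forall x, gr (n, j) x -> T x.
Proof.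
move=> T0 TD TB x gx; rewrite -(pr_id gx).
(* The claim is strengthened to all multiples of x, so that it passes through the A-span of the
   basis. *)
suff : forall a, T (pr (n, j) (a *: x)) by move=> /(_ 1); rewrite scale1r.
move: x {gx}.
apply: (basis_span_ind bas_span (T := [set x | forall a, T (pr (n, j) (a *: x))])).
- by move=> a; rewrite scaler0 pr0.
- by move=> x y hx hy a; rewrite scalerDr prD; exact: TD.
- by move=> a x hx a'; rewrite scalerA; exact: hx.
move=> b Bb a; apply: (grading_ind (gcomp_grading A) (T := fun a => T (pr (n, j) (a *: b)))).
- by rewrite scale0r pr0.
- by move=> a1 a2 h1 h2; rewrite scalerDl prD; exact: TD.
move=> i a' ga; have := deg_bas Bb; case e: (deg b) => [n' j'] gb.
have gab := res_gr_scale ga gb.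
have [E|ne] := eqVneq (n', i%:Z + j') (n, j).
  rewrite pr_id -?E //; case: E => E1 E2; apply: (TB i a' b j') => //.
  by rewrite e E1.
by rewrite (pr_ne ne gab).
Qed.

Lemma bas_ind (R : P -> Prop) :
  (forall b, bas b -> (forall b', bas b' -> (deg b').1 + 1 = (deg b).1 -> R b') -> R b) ->
  forall b, bas b -> R b.
Proof.
move=> h b Bb; have [n] := ubnP `|(deg b).1|%N; elim: n b Bb => // n IH b Bb ltn.
apply: h => // b' Bb' e; apply: IH => //.
by have := deg_ge0 Bb; have := deg_ge0 Bb'; lia.
Qed.

Lemma lin_ind (T : set P) : T 0 -> (forall x y, T x -> T y -> T (x + y)) ->
  (forall a x, T x -> T (a *: x)) -> (forall b, bas b -> T (d b) -> T b) ->
  forall x, T x.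
Proof.
move=> T0 TD TZ TB; apply: (basis_span_ind bas_span) => //; apply: bas_ind => b Bb IH.
apply: TB => //; apply: (gr_ind _ _ _ (d_bas Bb)) => // i a b' j' ga Bb' e _.
by apply: TZ; apply: IH => //; rewrite e /= subrK.
Qed.

(** The uniqueness principle matching recursion along the differential. *)
Lemma lin_eq (Q : lmodType A) (k k' : {linear P -> Q}) :
  (forall b, bas b -> k (d b) = k' (d b) -> k b = k' b) -> k =1 k'.
Proof.
move=> h x; apply: (lin_ind (T := [set x | k x = k' x])) => /=.
- by rewrite !linear0.
- by move=> y z; rewrite !linearD => -> ->.
- by move=> a y; rewrite !linearZ => ->.
- exact: h.
Qed.

Definition ext (Q : lmodType A) (v : P -> Q) : {linear P -> Q} :=
  projT1 (cid (basis_ext bas_span bas_free v)).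

Lemma extE (Q : lmodType A) (v : P -> Q) b : bas b -> ext v b = v b.
Proof. by rewrite /ext; case: cid => f /= h; exact: h. Qed.

(** The value on a basis element b may depend on the value on [d b], which only involves basis
    elements of one homological degree less. [K m] is an approximation with m rounds of recursion;
    on b it is stable as soon as m exceeds the homological degree of b. *)
Lemma rec_ext (Q : lmodType A) (S : P -> Q -> Q) :
  exists k : {linear P -> Q}, forall b, bas b -> k b = S b (k (d b)).
Proof.
pose K := fix K (m : nat) : {linear P -> Q} :=
  if m is m'.+1 then ext (fun b => S b (K m' (d b))) else ext (fun=> 0).
pose hd b := `|(deg b).1|%N.
have gr_eq (k k' : {linear P -> Q}) b : bas b ->
    (forall b', bas b' -> (deg b').1 + 1 = (deg b).1 -> k b' = k' b') ->
    k (d b) = k' (d b).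
  move=> Bb h; apply: (gr_ind (T := [set x | k x = k' x]) _ _ _ (d_bas Bb)) => /=.
  - by rewrite !linear0.
  - by move=> y z; rewrite !linearD => -> ->.
  - move=> i a b' j' ga Bb' e _; rewrite !linearZ h //.
    by rewrite e /= subrK.
have hdS b b' : bas b -> bas b' -> (deg b').1 + 1 = (deg b).1 -> hd b = (hd b').+1.
  by move=> /deg_ge0 h /deg_ge0 h' e; rewrite /hd; lia.
have KS m b : bas b -> K m.+1 b = S b (K m (d b)) by exact: extE.
have stable b : bas b -> forall m, (hd b < m)%N -> K m b = K (hd b).+1 b.
  move: b; apply: bas_ind => b Bb IH [//|m]; rewrite ltnS => le.
  rewrite !KS //; congr (S b _); apply: gr_eq => // b' Bb' e.
  have hdb := hdS _ _ Bb Bb' e.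
  by rewrite IH // ?hdb // (leq_trans _ le) // hdb.
exists (ext (fun b => K (hd b).+1 b)) => b Bb; rewrite extE // KS //; congr (S b _).
apply: gr_eq => // b' Bb' e; rewrite extE //.
by rewrite (hdS _ _ Bb Bb' e).
Qed.

End ResolutionTheory.

Arguments bas {F A M G N} P _.
Arguments pr {F A M G N} P _ _.
Arguments co {F A M G N} P _ _.

Lemma algN1_opp (F : fieldType) (A : graded_algebra F) (V : lmodType A) (x : V) :
  ((-1 : F)%:A : A) *: x = - x.
Proof. by rewrite scaleN1r scaleN1r. Qed.

Section Augmented.
Variables (F : fieldType) (A : graded_algebra F) (P : triv_resolution A).
Local Notation gr := (res_gr P).
Local Notation d := (res_d P).

Definition ev (x : P) : F := res_eps P x.

Lemma evP a x y : ev (a *: x + y) = aug a * ev x + ev y.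
Proof. by rewrite /ev linearP. Qed.
Lemma evZ a x : ev (a *: x) = aug a * ev x.
Proof. by rewrite /ev linearZ. Qed.
Lemma evD : {morph ev : x y / x + y}.
Proof. by move=> x y; rewrite /ev linearD. Qed.
Lemma ev0 : ev 0 = 0.
Proof. by rewrite /ev linear0. Qed.
Lemma evN x : ev (- x) = - ev x.
Proof. by rewrite /ev linearN. Qed.
Lemma evB : {morph ev : x y / x - y}.
Proof. by move=> x y; rewrite evD evN. Qed.
Lemma ev_d x : ev (d x) = 0. Proof. by rewrite /ev res_eps_d. Qed.

Lemma ev_gr nj x : nj != (0, 0) -> gr nj x -> ev x = 0.
Proof.
case: nj => n j; have [->|n0 _ /(res_eps_gr n0)//] := eqVneq n 0.
rewrite xpair_eqE eqxx /= => j0 /res_eps_gr0; rewrite /triv_gr.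
by move: j0; case: eqP.
Qed.

Lemma ev_surj : exists x, ev x = 1.
Proof.
have h := res_eps_im P.
have : (range (res_eps P)) (1 : F) by rewrite h.
by move=> [x _ e]; exists x.
Qed.

Lemma ev_bas : exists b, [/\ bas P b, gr (0, 0) b & ev b != 0].
Proof.
have [x e] := ev_surj; apply: contrapT => h.
suff : ev x = 0 by rewrite e => /eqP; rewrite oner_eq0.
apply: (basis_span_ind (bas_span P) (T := [set x | ev x = 0])) => /=.
- exact: ev0.
- by move=> y z; rewrite evD => -> ->; rewrite addr0.
- by move=> a y; rewrite evZ => ->; rewrite mulr0.
move=> b Bb; apply: contrapT => /eqP e0; apply: h; exists b; split=> //.
have gb := deg_bas Bb; have [<- //|ne] := eqVneq (deg b) (0, 0).
by rewrite (ev_gr ne gb) eqxx in e0.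
Qed.

Lemma exactP x : d x = 0 -> ev x = 0 -> exists y, x = d y.
Proof. exact: res_exact. Qed.

Hypothesis hmin : minimal P.

(* the F-span of the basis of P *)
Definition generators : set P := [set x | forall b, co P b x = (aug (co P b x))%:A].

Lemma minimal_co x b : aug (co P b (d x)) = 0.
Proof.
have : Jmul [set: P] (d x) by apply: hmin; exists x.
have h : Jmul [set: P] `<=` [set x | aug (co P b x) = 0].
  apply: lspan_min => /=.
  - by rewrite co0 rmorph0.
  - by move=> u v hu hv; rewrite -[u]scale1r co_linear mul1r rmorphD /= hu hv addr0.
  - by move=> k v hv; rewrite -[k *: v]addr0 co_linear co0 addr0 rmorphM /= hv mulr0.
  - move=> _ [a [w [/aug_ideal_aug a0 _ ->]]] /=.
    by rewrite -[a *: w]addr0 co_linear co0 addr0 rmorphM /= a0 mul0r.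
exact: h.
Qed.

Lemma generatorsP (c : F) x y : generators x -> generators y ->
  generators (c%:A *: x + y).
Proof.
move=> hx hy b; rewrite co_linear hx hy rmorphD rmorphM /= !aug_alg.
by rewrite -scalerAl mul1r scalerA -scalerDl.
Qed.

Lemma generators_bas b : bas P b -> generators b.
Proof.
move=> Bb b'; rewrite co_bas //; case: (_ == _); rewrite ?rmorph1 ?rmorph0.
  by rewrite scale1r.
by rewrite scale0r.
Qed.

(** Such a cycle is a boundary, so by minimality its coordinates lie in J; those of an element of
    [generators] are scalars. *)
Lemma generators_cycle x : generators x -> d x = 0 -> ev x = 0 -> x = 0.
Proof.
move=> gx dx ex; have [y xE] := exactP dx ex.
have [r [_ _ _ ->]] := co_sum x; rewrite big1 // => b _.
by rewrite gx xE minimal_co scale0r scale0r.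
Qed.

Lemma generators_pr nj x : generators x -> generators (pr P nj x).
Proof.
move=> gx b; have [r [ur rB r0 xE]] := co_sum x.
have prE : pr P nj x = \sum_(b <- r) (if deg b == nj then co P b x *: b else 0).
  rewrite {1}xE /pr gproj_big !big_seq; apply: eq_bigr => b' /rB Bb'.
  have g : gr (deg b') (co P b' x *: b') by rewrite gx; apply: grZ; exact: deg_bas.
  by case: eqP => [<-|/eqP ne]; [exact: gproj_id|exact: gproj_ne ne g].
have gen0 : generators (0 : P) by move=> b'; rewrite co0 rmorph0 scale0r.
suff : generators (pr P nj x) by [].
rewrite prE big_seq; elim/big_ind: _ => // [u v hu hv|b' /rB Bb'].
  by rewrite -[u]alg1; exact: generatorsP.
case: ifP => // _; rewrite gx -[_ *: b']addr0; apply: generatorsP => //.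
exact: generators_bas.
Qed.

Local Notation Z := [set x : P | d x = 0 /\ ev x = 0].

(* a graded F-complement of the cycles that contains the basis, by Zorn's lemma:
   minimality keeps the span of the basis away from the cycles *)
Lemma complement_exists : exists C : set P,
  [/\ forall c x y, C x -> C y -> C ((c%:A : A) *: x + y), generators `<=` C,
      forall x, C x -> Z x -> x = 0, forall nj x, C x -> C (pr P nj x)
    & forall x, exists c, C c /\ Z (x - c)].
Proof.
(* The alternative [C = set0] accommodates the union of the empty chain in Zorn's lemma. *)
pose Q : set (set P) := [set C | [/\
  forall c x y, C x -> C y -> C ((c%:A : A) *: x + y),
  forall x, C x -> Z x -> x = 0, forall nj x, C x -> C (pr P nj x)
  & C = set0 \/ generators `<=` C]].
have [|C [[CP CZ Cpr C0] maxC]] := @Zorn_bigcup P Q.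
  move=> FF FQ tot; split.
  - move=> c x y [X FX Xx] [Y FY Yy].
    have [XY|YX] := tot _ _ FX FY.
      by exists Y => //; have [h _ _ _] := FQ _ FY; apply: h => //; exact: XY.
    by exists X => //; have [h _ _ _] := FQ _ FX; apply: h => //; exact: YX.
  - by move=> x [X FX Xx]; have [_ h _ _] := FQ _ FX; exact: h.
  - by move=> nj x [X FX Xx]; have [_ _ h _] := FQ _ FX; exists X => //; exact: h.
  - have [[X [FX gX]]|h] := pselect (exists X, FF X /\ generators `<=` X).
      by right=> x /gX Xx; exists X.
    left; apply/seteqP; split=> // x [X FX Xx].
    have [_ _ _ [X0|gX]] := FQ _ FX; first by rewrite X0 in Xx.
    by apply: h; exists X.
have gen0 : generators (0 : P) by move=> b'; rewrite co0 rmorph0 scale0r.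
have gC : generators `<=` C.
  case: C0 => // C0; exfalso; apply: (maxC (generators : set P)).
    by rewrite C0; split=> [//|/(_ 0 gen0)].
  split; [exact: generatorsP| |exact: generators_pr|by right].
  by move=> x gx [dx ex]; exact: generators_cycle.
have C00 : C 0 by exact: gC.
have CD x y : C x -> C y -> C (x + y) by rewrite -{2}[x]alg1; exact: CP.
have CZl (c : F) x : C x -> C ((c%:A : A) *: x).
  by move=> Cx; rewrite -[_ *: x]addr0; exact: CP.
exists C; split=> //.
have Z0 : Z 0 by split; rewrite ?linear0 ?ev0.
have ZD x y : Z x -> Z y -> Z (x + y).
  by move=> [dx ex] [dy ey]; split; rewrite ?linearD ?evD ?dx ?dy ?ex ?ey addr0.
have ZZl (c : F) x : Z x -> Z ((c%:A : A) *: x).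
  by move=> [dx ex]; split; rewrite ?linearZ /= ?evZ ?dx ?ex ?scaler0 ?mulr0.
apply: (grading_ind (res_grading P) (T := [set x | exists c, C c /\ Z (x - c)])).
- by exists 0; rewrite subr0.
- move=> x y [c [Cc Zc]] [e [Ce Ze]]; exists (c + e); split; first exact: CD.
  by rewrite opprD addrACA; exact: ZD.
move=> nj x gx; apply: contrapT => h.
(* If x is not in C + Z, the sum of C and the line of x still meets the cycles trivially, and it is
   graded because x is homogeneous. This contradicts maximality. *)
pose C' : set P := [set y | exists c k, C c /\ y = c + (k%:A : A) *: x].
apply: (maxC C').
  split=> [y Cy|CC']; first by exists y, 0; rewrite alg0 addr0.
  apply: h; exists x; split; last by rewrite subrr.
  by apply: CC'; exists 0, 1; rewrite alg1 add0r.
split.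
- move=> c y z [e [k [Ce ->]]] [e' [k' [Ce' ->]]].
  exists (c%:A *: e + e'), (c * k + k'); split; first exact: CP.
  by rewrite scalerDr algM algD addrACA.
- move=> y [c [k [Cc ->]]] Zy; have [k0|k0] := eqVneq k 0.
    by move: Zy; rewrite k0 alg0 addr0; exact: CZ.
  exfalso; apply: h; exists ((- k^-1)%:A *: c); split; first exact: CZl.
  have := ZZl k^-1 _ Zy; rewrite scalerDr algM mulVf // alg1 addrC.
  by rewrite scaleNr scaleNr opprK.
- move=> nj' y [c [k [Cc ->]]]; rewrite prD prZ.
  have [<-|ne] := eqVneq nj nj'.
    by exists (pr P nj c), k; split; [exact: Cpr|rewrite (pr_id gx)].
  by exists (pr P nj' c), 0; split; [exact: Cpr|rewrite (pr_ne ne gx) scaler0 alg0].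
- by right=> y /gC Cy; exists y, 0; rewrite alg0 addr0.
Qed.

(** For the complement C of the cycles Z, [s x] is the unique y in C with [ev y = 0] and [x - d y]
    in C: it inverts d on Z and vanishes on C. As its values lie in C, s s = 0. Minimality makes P_0
    free on the single generator [e0]. *)
Lemma contraction_exists : exists (e0 : P) (s : P -> P),
  [/\ [/\ gr (0, 0) e0, ev e0 = 1 & forall b, bas P b -> (deg b).1 = 0 -> b = ((ev b)%:A : A) *: e0],
      forall (c : F) x y, s ((c%:A : A) *: x + y) = (c%:A : A) *: s x + s y,
      forall n j x, gr (n, j) x -> gr (n + 1, j) (s x),
      forall x, d (s x) + s (d x) = x - ((ev x)%:A : A) *: e0
    & [/\ forall x, s (s x) = 0, s e0 = 0, forall x, ev (s x) = 0
        & forall x, generators x -> s x = 0]].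
Proof.
have [C [CP gC CZ Cpr CZx]] := complement_exists.
have [b0 [Bb0 gb0 eb0]] := ev_bas.
pose e0 := ((ev b0)^-1%:A : A) *: b0.
have ge0 : gr (0, 0) e0 by exact: grZ.
have ee0 : ev e0 = 1 by rewrite evZ aug_alg mulVf.
have de0 : d e0 = 0 by exact: d_gr0 ge0.
have gen0 : generators (0 : P) by move=> b'; rewrite co0 rmorph0 scale0r.
have gene0 : generators e0.
  by rewrite -[e0]addr0; apply: generatorsP => //; exact: generators_bas.
have C00 : C 0 by exact: gC.
have Ce0 : C e0 by exact: gC.
have CD x y : C x -> C y -> C (x + y) by rewrite -{2}[x]alg1; exact: CP.
have CZl (c : F) x : C x -> C ((c%:A : A) *: x).
  by move=> Cx; rewrite -[_ *: x]addr0; exact: CP.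
have CB x y : C x -> C y -> C (x - y).
  by move=> Cx Cy; rewrite -algN1_opp addrC; exact: CP.
pose R x y := [/\ C y, ev y = 0 & C (x - d y)].
have Rex x : exists y, R x y.
  have [c [Cc [dxc exc]]] := CZx x; have [y0 y0E] := exactP dxc exc.
  have [c' [Cc' [dc' _]]] := CZx y0.
  exists (c' - ((ev c')%:A : A) *: e0); split.
  - by apply: CB => //; exact: CZl.
  - by rewrite evB evZ aug_alg ee0 mulr1 subrr.
  rewrite linearB linearZ /= de0 scaler0 subr0.
  have -> : d c' = d y0 by apply/esym/eqP; rewrite -subr_eq0 -linearB dc'.
  by rewrite -y0E opprB addrC subrK.
have Runiq x y y' : R x y -> R x y' -> y = y'.
  move=> [Cy ey Cxy] [Cy' ey' Cxy']; apply/eqP; rewrite -subr_eq0; apply/eqP.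
  apply: (CZ _); first exact: CB.
  split; last by rewrite evB ey ey' subrr.
  apply: CZ; last by split; [exact: res_dd|exact: ev_d].
  have := CB _ _ Cxy' Cxy; rewrite opprB addrACA [- _ + _]addrC addrACA subrr add0r.
  by rewrite linearB addrC.
pose s x := projT1 (cid (Rex x)).
have sR x : R x (s x) by rewrite /s; case: cid.
have sE x y : R x y -> s x = y by move=> Rxy; exact: Runiq (sR x) Rxy.
have s0C x : C x -> s x = 0.
  by move=> Cx; apply: sE; split; rewrite ?ev0 // linear0 subr0.
exists e0, s; split.
- split=> // b Bb db0; apply/eqP; rewrite -subr_eq0; apply/eqP.
  have gb := deg_bas Bb; rewrite [deg b]surjective_pairing db0 in gb.
  apply: generators_cycle.
  + rewrite -scaleNr -scaleNr addrC; apply: generatorsP => //; exact: generators_bas.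
  + by rewrite linearB linearZ /= de0 (d_gr0 gb) scaler0 subr0.
  + by rewrite evB evZ aug_alg ee0 mulr1 subrr.
- move=> c x y; have [Cx ex Cdx] := sR x; have [Cy ey Cdy] := sR y.
  apply: sE; split; first exact: CP.
    by rewrite evP ex ey mulr0 addr0.
  rewrite linearP opprD addrACA -scalerBr; exact: CP.
- move=> n j x gx; have [Cx ex Cdx] := sR x.
  suff -> : s x = pr P (n + 1, j) (s x) by exact: pr_in.
  apply: sE; split; first exact: Cpr.
    have [E|ne] := eqVneq (n + 1, j) (0, 0); last exact: ev_gr ne (pr_in _ _).
    have n0 : n < 0 by case: E => E _; lia.
    by rewrite (gr_neg0 n0 gx) s0C // pr0 ev0.
  have -> : x - d (pr P (n + 1, j) (s x)) = pr P (n, j) (x - d (s x)).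
    by rewrite prB (pr_id gx) -pr_d addrK.
  exact: Cpr.
- move=> x; have [Cx ex Cdx] := sR x.
  have -> : s (d x) = x - ((ev x)%:A : A) *: e0 - d (s x).
    apply: sE; split.
    + by rewrite addrAC; apply: CB => //; exact: CZl.
    + by rewrite !evB evZ aug_alg ee0 mulr1 subrr ev_d subr0.
    have -> : d (x - ((ev x)%:A : A) *: e0 - d (s x)) = d x.
      by rewrite 2!linearB linearZ /= de0 res_dd scaler0 !subr0.
    by rewrite subrr.
  by rewrite addrC subrK.
split.
- by move=> x; have [Cx _ _] := sR x; exact: s0C.
- exact: s0C.
- by move=> x; have [_ ex _] := sR x.
- by move=> x gx; apply: s0C; exact: gC.
Qed.

End Augmented.

Lemma sc_eps (F : fieldType) (A : graded_algebra F) (V : lmodType A) z (x : V) :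
  ((eps F z)%:A : A) *: x = x *~ (-1) ^ z.
Proof.
have -> : eps F z = ((-1) ^ z : int)%:~R by rewrite /eps rmorphXz ?rmorphN1.
by rewrite scaler_int scaler_int.
Qed.

Section Parity.
Variables (F : fieldType) (A : graded_algebra F) (M : lmodType A).
Variables (G : int -> set M) (N : set M) (P : resolution G N).
Local Notation gr := (res_gr P).
Local Notation d := (res_d P).
Local Notation sc c x := (((c : F)%:A : A) *: x).

(** Having the parity as a linear map allows the signs of End_A(P) to be written without mentioning
    degrees. *)
Definition par : {linear P -> P} := ext (fun b : P => sc (eps F (deg b).1) b).

Lemma par_gr n j x : gr (n, j) x -> par x = sc (eps F n) x.
Proof.
apply: (gr_ind (T := [set x | par x = sc (eps F n) x])) => /=.
- by rewrite linear0 scaler0.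
- by move=> y z hy hz; rewrite linearD /= hy hz scalerDr.
- by move=> i a b j' _ Bb e _; rewrite linearZ /= extE // e alg_scaleC.
Qed.

Lemma homogeneous_ind (T : set P) : T 0 -> (forall x y, T x -> T y -> T (x + y)) ->
  (forall n j x, gr (n, j) x -> T x) -> forall x, T x.
Proof.
by move=> T0 TD TG; apply: (grading_ind (res_grading P)) => // -[n j]; exact: TG.
Qed.

Lemma parK x : par (par x) = x.
Proof.
move: x; apply: (homogeneous_ind (T := [set x | par (par x) = x])) => /=.
- by rewrite !linear0.
- by move=> y z hy hz; rewrite !linearD /= hy hz.
- move=> n j x gx; rewrite (par_gr gx) linearZ /= (par_gr gx) algM.
  by rewrite eps_sqr alg1.
Qed.

Lemma par_d x : par (d x) = - d (par x).
Proof.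
move: x; apply: (homogeneous_ind (T := [set x | par (d x) = - d (par x)])) => /=.
- by rewrite !linear0 ?oppr0.
- by move=> y z hy hz; rewrite !linearD /= hy hz -opprD.
- move=> n j x gx; rewrite (par_gr gx) (par_gr (res_d_gr gx)) linearZ /=.
  by rewrite epsD epsN eps1 mulrN1 !scaleNr.
Qed.

Lemma d_par x : d (par x) = - par (d x).
Proof. by rewrite par_d opprK. Qed.

Lemma par_dbas b : bas P b -> par (d b) = sc (eps F ((deg b).1 - 1)) (d b).
Proof. by move=> /d_bas; exact: par_gr. Qed.

Lemma par_bas b : bas P b -> par b = sc (eps F (deg b).1) b.
Proof. by move=> Bb; rewrite [LHS]extE. Qed.

End Parity.

Arguments par {F A M G N} P.

(** * The endomorphism algebra retracts onto Ext *)

Section Lifting.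
Variables (F : fieldType) (A : graded_algebra F) (P : triv_resolution A).
Local Notation gr := (res_gr P).
Local Notation d := (res_d P).
Local Notation par := (par P).
Local Notation sc c x := (((c : F)%:A : A) *: x).
Local Notation ev := (@ev F A P).

Lemma ev_par x : ev (par x) = ev x.
Proof.
move: x; apply: (homogeneous_ind (T := [set x | ev (par x) = ev x])) => /=.
- by rewrite linear0.
- by move=> y z hy hz; rewrite linearD /= !evD hy hz.
- move=> n j x gx; rewrite (par_gr gx) evZ aug_alg.
  have [[-> _]|ne] := eqVneq (n, j) (0, 0); first by rewrite mul1r.
  by rewrite (ev_gr ne gx) mulr0.
Qed.

Definition alin (phi : P -> F) := forall (a : A) x y, phi (a *: x + y) = aug a * phi x + phi y.

Lemma alinD phi : alin phi -> {morph phi : x y / x + y}.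
Proof. by move=> h x y; have := h 1 x y; rewrite scale1r rmorph1 mul1r. Qed.
Lemma alin0 phi : alin phi -> phi 0 = 0.
Proof. by move=> /alinD h; apply: (addIr (phi 0)); rewrite -h !add0r. Qed.
Lemma alinZ phi a x : alin phi -> phi (a *: x) = aug a * phi x.
Proof. by move=> h; have := h a x 0; rewrite !addr0 alin0 // addr0. Qed.
Lemma alinN phi x : alin phi -> phi (- x) = - phi x.
Proof. by move=> h; rewrite -scaleN1r alinZ // rmorphN1 mulN1r. Qed.

Lemma alin_ev (g : {linear P -> P}) : alin (ev \o g).
Proof. by move=> a x y /=; rewrite linearP evP. Qed.

Lemma alin_eq phi psi : alin phi -> alin psi ->
  (forall b, bas P b -> phi b = psi b) -> phi =1 psi.
Proof.
move=> h h' e; apply: (basis_span_ind (bas_span P) (T := [set x | phi x = psi x])) => //=.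
- by rewrite !alin0.
- by move=> x y hx hy; rewrite !alinD // hx hy.
- by move=> a x hx; rewrite !alinZ // hx.
Qed.

Hypothesis hmin : minimal P.

(** By minimality [d x] lies in J P. Hence the differential of Hom_A(P, F) is zero. *)
Lemma alin_d phi x : alin phi -> phi (d x) = 0.
Proof.
move=> h; have [r [_ _ _ e]] := co_sum (d x); rewrite e.
elim: r {e} => [|b r IH]; first by rewrite big_nil alin0.
by rewrite big_cons alinD // IH alinZ // minimal_co // mul0r addr0.
Qed.

Variables (e0 : P) (s : P -> P).
Hypothesis ge0 : gr (0, 0) e0.
Hypothesis ev_e0 : ev e0 = 1.
Hypothesis bas_deg0 : forall b, bas P b -> (deg b).1 = 0 -> b = sc (ev b) e0.
Hypothesis sP : forall (c : F) x y, s (sc c x + y) = sc c (s x) + s y.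
Hypothesis s_gr : forall n j x, gr (n, j) x -> gr (n + 1, j) (s x).
Hypothesis ds : forall x, d (s x) + s (d x) = x - sc (ev x) e0.
Hypothesis ss : forall x, s (s x) = 0.
Hypothesis s_e0 : s e0 = 0.
Hypothesis ev_s : forall x, ev (s x) = 0.
Hypothesis s_gen : forall x, generators x -> s x = 0.

Lemma sD : {morph s : x y / x + y}.
Proof. by move=> x y; have := sP 1 x y; rewrite !alg1. Qed.
Lemma s0 : s 0 = 0.
Proof. by apply: (addIr (s 0)); rewrite -sD !add0r. Qed.
Lemma sZ c x : s (sc c x) = sc c (s x).
Proof. by have := sP c x 0; rewrite !addr0 s0 addr0. Qed.
Lemma sN x : s (- x) = - s x.
Proof. by rewrite -algN1_opp sZ algN1_opp. Qed.

Lemma par_s x : par (s x) = - s (par x).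
Proof.
move: x; apply: (homogeneous_ind (T := [set x | par (s x) = - s (par x)])) => /=.
- by rewrite !(linear0, s0) ?oppr0.
- by move=> y z hy hz; rewrite sD !linearD /= sD hy hz opprD.
- move=> n j x gx; rewrite (par_gr gx) (par_gr (s_gr gx)) sZ.
  by rewrite epsD eps1 mulrN1 !scaleNr.
Qed.

Lemma par_e0 : par e0 = e0.
Proof. by rewrite (par_gr ge0) alg1. Qed.

Lemma d_e0 : d e0 = 0.
Proof. exact: d_gr0 ge0. Qed.

(** Up to the terms supplied by the other half of the homotopy identity, D k = - g reads d (k b) = -
    g b + par (k (par (d b))) on b. The right-hand side is known by recursion, and s inverts d on
    cycles of augmentation 0. *)
Lemma hfun_exists (g : P -> P) : exists k : {linear P -> P},
  forall b, bas P b -> k b = s (- g b + par (k (par (d b)))).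
Proof.
have [k kE] := @rec_ext _ _ _ _ _ P P
  (fun b y => s (- g b + sc (eps F ((deg b).1 - 1)) (par y))).
by exists k => b Bb; rewrite kE // par_dbas // !linearZ.
Qed.

(* hfun is a contracting homotopy of End_A(P) onto Ext P, ifun the inclusion of
   Ext P: both are defined on the basis, recursively along the differential *)
Definition hfun (g : P -> P) : {linear P -> P} := projT1 (cid (hfun_exists g)).

Lemma hfunE g b : bas P b -> hfun g b = s (- g b + par (hfun g (par (d b)))).
Proof. by rewrite /hfun; case: cid => k /= kE; exact: kE. Qed.

(** A cycle k of End_A(P) satisfies d (k b) = par (k (par (d b))). Applying s solves this equation,
    and the multiple of [e0] makes the augmentation equal to [phi]. *)
Lemma ifun_exists (phi : P -> F) : exists k : {linear P -> P},
  forall b, bas P b -> k b = sc (phi b) e0 + s (par (k (par (d b)))).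
Proof.
have [k kE] := @rec_ext _ _ _ _ _ P P
  (fun b y => sc (phi b) e0 + s (sc (eps F ((deg b).1 - 1)) (par y))).
by exists k => b Bb; rewrite kE // par_dbas // !linearZ.
Qed.

Definition ifun (phi : P -> F) : {linear P -> P} := projT1 (cid (ifun_exists phi)).

Lemma ifunE phi b : bas P b -> ifun phi b = sc (phi b) e0 + s (par (ifun phi (par (d b)))).
Proof. by rewrite /ifun; case: cid => k /= kE; exact: kE. Qed.

Lemma ev_hfun g x : ev (hfun g x) = 0.
Proof.
apply: (@alin_eq _ (fun=> 0) (alin_ev (hfun g))) => [a y z|b Bb].
  by rewrite mulr0 addr0.
by rewrite /= hfunE // ev_s.
Qed.

Lemma ev_ifun phi x : alin phi -> ev (ifun phi x) = phi x.
Proof.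
move=> h; move: x; apply: alin_eq => // [|b Bb]; first exact: alin_ev.
by rewrite ifunE // evD evZ aug_alg ev_e0 mulr1 ev_s addr0.
Qed.

Lemma lin_eq2 (k k' : {linear P -> P}) :
  (forall b, bas P b -> k (par (d b)) = k' (par (d b)) -> k b = k' b) -> k =1 k'.
Proof.
move=> h; apply: lin_eq => b Bb e; apply: h => //.
by rewrite par_dbas // !linearZ /= e.
Qed.

Definition lin0 : {linear P -> P} := \0.

Lemma hfun_hfun g x : hfun (hfun g) x = 0.
Proof.
apply: (@lin_eq2 (hfun (hfun g)) lin0) => b Bb /= e.
by rewrite hfunE // e linear0 addr0 hfunE // sN ss oppr0.
Qed.

Lemma hfun_ifun phi x : hfun (ifun phi) x = 0.
Proof.
apply: (@lin_eq2 (hfun (ifun phi)) lin0) => b Bb /= e.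
by rewrite hfunE // e linear0 addr0 ifunE // sN sP s_e0 ss scaler0 addr0 oppr0.
Qed.

(** Here s has to vanish on the basis: then [s (d b) = b - ev b e0] exactly, so the lift of the unit
    is the identity and not merely homotopic to it. *)
Lemma ifun_ev x : ifun ev x = x.
Proof.
apply: (@lin_eq2 (ifun ev) idfun) => b Bb /= e.
rewrite ifunE // e parK; have := ds b.
rewrite s_gen; last exact: generators_bas.
by rewrite linear0 add0r => ->; rewrite addrC subrK.
Qed.

(** Conjugation by the parity is the sign automorphism of End_A(P), and [Df] is its differential in
    degree-free form; [tauf_endo] and [Df_endo] give the usual signs on bihomogeneous
    endomorphisms. *)
Definition tauf (g : P -> P) : P -> P := fun x => par (g (par x)).
Definition Df (g : P -> P) : P -> P := fun x => d (g x) - par (g (par (d x))).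

Lemma tauf_lin (g : {linear P -> P}) : linear (tauf g).
Proof. by move=> a x y; rewrite /tauf !linearP. Qed.

Lemma Df_lin (g : {linear P -> P}) : linear (Df g).
Proof.
pose L : {linear P -> P} := (d \o g) \- (par \o (g \o (par \o d))).
exact: (linearP L).
Qed.

(** With y the argument of s in the recursion for [hfun g b], the contraction gives d (s y) = y - ev
    y e0 - s (d y), and the identity already known at [d b] evaluates d y. *)
Lemma homotopyE (g : {linear P -> P}) x :
  Df (hfun g) x + hfun (Df g) x = ifun (ev \o g) x - g x.
Proof.
pose L1 : {linear P -> P} := mklin (Df_lin (hfun g)) \+ hfun (Df g).
pose L2 : {linear P -> P} := ifun (ev \o g) \- g.
suff : L1 =1 L2 by exact.
apply: lin_eq => b Bb /= IH.
set c := eps F ((deg b).1 - 1).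
set K := hfun g in IH *; set L := hfun (Df g) in IH *; set I := ifun _ in IH *.
have pb : par (d b) = sc c (d b) by exact: par_dbas.
pose y := - g b + par (K (par (d b))).
have Kb : K b = s y by exact: hfunE.
have evy : ev y = - ev (g b) by rewrite evD evN ev_par ev_hfun addr0.
have dK z : d (K z) = Df K z + par (K (par (d z))) by rewrite /Df subrK.
have dpd : d (par (d b)) = 0 by rewrite d_par res_dd linear0 oppr0.
have dy : d y = - d (g b) - sc c (par (I (d b) - g (d b) - L (d b))).
  rewrite /y linearD linearN /= d_par dK dpd !linear0 addr0 pb.
  rewrite -[Df K _]/(mklin (Df_lin K) _) linearZ /= [par (sc _ _)]linearZ /=.
  by rewrite -IH addrK.
have DKb : Df K b = - g b + sc (ev (g b)) e0 - s (d y).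
  have dsy : d (s y) = y + sc (ev (g b)) e0 - s (d y).
    by rewrite -[LHS](addrK (s (d y))) ds evy scaleNr scaleNr opprK.
  rewrite /Df Kb dsy /y -!addrA; congr (_ + _).
  by rewrite addrC -!addrA addNr addr0.
have Lb : L b = s (- (d (g b) - sc c (par (g (d b)))) + sc c (par (L (d b)))).
  by rewrite /L hfunE // -/L /Df pb !linearZ.
have Ib : I b = sc (ev (g b)) e0 + s (sc c (par (I (d b)))).
  by rewrite /I ifunE // -/I pb !linearZ.
rewrite DKb Lb Ib -addrA [- s _ + _]addrC -sN -sD [RHS]addrC !addrA.
congr (_ + s _).
rewrite dy !opprD !opprK linearD linearB /= !(scalerDr, scalerN) linearN /= scalerN.
set a := d (g b); set g' := sc c (par (g _)); set l := sc c (par (L _)).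
rewrite addrA -[- a + g' + l]addrA [- a + _ + a]addrAC addNr add0r.
by rewrite -[_ - g' - l]addrA -opprD addrC subrK.
Qed.

(** Put y = par (I (par (d b))). Then d y = 0 by the identity at [d b], and [ev y] is a value of
    [phi] on a boundary, hence 0 by minimality. So d (s y) = y. *)
Lemma Df_ifun phi x : alin phi -> Df (ifun phi) x = 0.
Proof.
move=> h; pose L1 : {linear P -> P} := mklin (Df_lin (ifun phi)).
suff : L1 =1 lin0 by exact.
apply: lin_eq => b Bb /= IH.
set I := ifun phi in IH *; set c := eps F ((deg b).1 - 1).
have pb : par (d b) = sc c (d b) by exact: par_dbas.
have dpd : d (par (d b)) = 0 by rewrite d_par res_dd linear0 oppr0.
pose y := par (I (par (d b))).
have evy : ev y = 0 by rewrite /y ev_par ev_ifun // pb alinZ // alin_d // mulr0.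
have dI z : d (I z) = Df I z + par (I (par (d z))) by rewrite /Df subrK.
have dy : d y = 0.
  rewrite /y d_par dI dpd !linear0 addr0 pb.
  by rewrite -[Df I _]/(mklin (Df_lin I) _) linearZ /= IH scaler0 linear0 oppr0.
rewrite /Df {1}/I ifunE // -/I -/y linearD linearZ /= d_e0 scaler0 add0r.
have := ds y; rewrite dy s0 addr0 evy alg0 subr0 => ->.
by rewrite subrr.
Qed.

Lemma ev_Df (g : {linear P -> P}) x : ev (Df g x) = 0.
Proof.
have hg := alin_ev g.
rewrite /Df evB ev_d ev_par -[ev (g _)]/((ev \o g) _) par_d (alinN _ hg).
by rewrite (alin_d _ hg) oppr0 subr0.
Qed.

Lemma hfunP (c : F) g g' x :
  hfun (fun x => sc c (g x) + g' x) x = sc c (hfun g x) + hfun g' x.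
Proof.
have L : linear (fun x => sc c (hfun g x) + hfun g' x).
  by move=> a y z; rewrite !linearP /= scalerDr -alg_scaleC addrACA -scalerDr.
apply: (@lin_eq2 _ (mklin L)) => b Bb /= IH.
rewrite hfunE // IH (hfunE g Bb) (hfunE g' Bb) -sP; congr (s _).
by rewrite opprD -scalerN [par _]linearP /= addrACA -scalerDr.
Qed.

Lemma ifunP (c : F) phi psi x :
  ifun (fun x => c * phi x + psi x) x = sc c (ifun phi x) + ifun psi x.
Proof.
have L : linear (fun x => sc c (ifun phi x) + ifun psi x).
  by move=> a y z; rewrite !linearP /= scalerDr -alg_scaleC addrACA -scalerDr.
apply: (@lin_eq2 _ (mklin L)) => b Bb /= IH.
rewrite ifunE // IH (ifunE phi Bb) (ifunE psi Bb) scalerDr addrACA algM -algD -sP; congr (_ + s _).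
by rewrite linearP.
Qed.

Lemma eps_pred n : eps F (n - 1) = - eps F n.
Proof. by rewrite epsD epsN eps1 mulrN1. Qed.

Lemma tauf_hfun (g : {linear P -> P}) x : tauf (hfun g) x = - hfun (tauf g) x.
Proof.
pose L1 : {linear P -> P} := mklin (tauf_lin (hfun g)).
suff : L1 =1 \- hfun (tauf g) by exact.
apply: lin_eq => b Bb /= IH.
have pb : par (d b) = sc (eps F ((deg b).1 - 1)) (d b) by exact: par_dbas.
have -> : hfun (tauf g) b = s (- tauf g b + par (hfun (tauf g) (par (d b)))) by exact: hfunE.
have e1 : hfun (tauf g) (par (d b)) = sc (eps F (deg b).1) (tauf (hfun g) (d b)).
  by rewrite pb linearZ /= IH eps_pred scalerN !scaleNr.
rewrite e1 /tauf (par_bas Bb) linearZ /= (hfunE g Bb) [LHS]linearZ /= par_s scalerN.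
congr (- _); rewrite -sZ; congr (s _); rewrite (linear_scalem g) !(linear_scalem par) -scalerN -scalerDr.
by congr (_ *: _); rewrite linearD linearN.
Qed.

Lemma tauf_ifun phi x : alin phi -> tauf (ifun phi) x = ifun (phi \o par) x.
Proof.
move=> h; pose L1 : {linear P -> P} := mklin (tauf_lin (ifun phi)).
suff : L1 =1 ifun (phi \o par) by exact.
apply: lin_eq => b Bb /= IH.
have pb : par (d b) = sc (eps F ((deg b).1 - 1)) (d b) by exact: par_dbas.
rewrite (ifunE (phi \o par) Bb) pb linearZ /= -IH /tauf (par_bas Bb) (alinZ _ _ h) aug_alg.
rewrite [in LHS]linearZ [LHS]linearZ /= (ifunE phi Bb) linearD linearZ /= par_e0 par_s.
rewrite scalerDr algM scalerN -sZ -sN; congr (_ + s _).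
rewrite (linear_scalem par) !parK pb (linear_scalem (ifun phi)) !algM eps_pred.
by rewrite mulrNN mulrN !eps_sqr algN1_opp opprK alg1.
Qed.

Lemma endo_ext (b : int * int) (k : {linear P -> P}) :
  (forall x, bas P x -> gr ((deg x).1 - b.1, (deg x).2 - b.2) (k x)) -> endo b k.
Proof.
move=> h; split=> [a x y|n j x]; first exact: linearP.
apply: (gr_ind (T := [set x | gr (n - b.1, j - b.2) (k x)])) => /=.
- by rewrite linear0; exact: gr0.
- by move=> y z hy hz; rewrite linearD; exact: grD.
- move=> i a c j' ga Bc e e'; rewrite linearZ /= -e' -addrA.
  by apply: res_gr_scale => //; have := h c Bc; rewrite e.
Qed.

Lemma endo_gr b (g : P -> P) n j x : endo b g -> gr (n, j) x -> gr (n - b.1, j - b.2) (g x).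
Proof. by move=> [_ h]; exact: h. Qed.

Lemma endo_par b g : endo b g -> endo b (fun x => par (g (par x))).
Proof.
move=> [gL gG]; split=> [a x y|n j x gx]; first by rewrite !(linearP, gL).
rewrite (par_gr gx).
have gZ : g (sc (eps F n) x) = sc (eps F n) (g x).
  by have := gL (eps F n)%:A x 0; rewrite !addr0 (_ : g 0 = 0) ?addr0 //;
    have := gL (-1) 0 0; rewrite scaler0 addr0 scaleN1r addNr.
rewrite gZ linearZ /= (par_gr (gG _ _ _ gx)).
by apply/grZ/grZ; exact: gG.
Qed.

Lemma hfun_endo b g : endo b g -> endo (b.1 - 1, b.2) (hfun g).
Proof.
move=> eg; apply: endo_ext; apply: bas_ind => c Bc IH /=.
rewrite hfunE //; set n := (deg c).1; set j := (deg c).2.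
have -> : n - (b.1 - 1) = n - b.1 + 1 by rewrite opprB addrA addrAC.
apply: s_gr; apply: grD.
  by apply: grN; apply: (endo_gr eg); rewrite /n /j -surjective_pairing; exact: deg_bas.
rewrite par_dbas // linearZ /= linearZ /=; apply: grZ.
suff h : gr (n - b.1, j - b.2) (hfun g (d c)) by rewrite (par_gr h); exact: grZ.
apply: (gr_ind (T := [set x | gr (n - b.1, j - b.2) (hfun g x)]) _ _ _ (d_bas Bc)) => /=.
- by rewrite linear0; exact: gr0.
- by move=> y z hy hz; rewrite linearD; exact: grD.
- move=> i a c' j' ga Bc' e e'; rewrite linearZ /= /j -e' -(addrA i%:Z).
  apply: res_gr_scale => //; have := IH c' Bc'; rewrite e /= subrK => /(_ erefl).
  by have -> : (deg c).1 - 1 - (b.1 - 1) = n - b.1 by rewrite /n; ring.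
Qed.

Lemma ifun_endo b phi : cochain_at P b phi -> endo b (ifun phi).
Proof.
move=> [phiL phiG]; apply: endo_ext; apply: bas_ind => c Bc IH /=.
rewrite ifunE //; set n := (deg c).1; set j := (deg c).2.
apply: grD.
  have [e|ne] := eqVneq (deg c) b.
    by rewrite /n /j e !subrr; exact: grZ.
  by rewrite (phiG _ _ ne (deg_bas Bc)) alg0; exact: gr0.
have -> : n - b.1 = n - 1 - b.1 + 1 by rewrite addrAC subrK.
apply: s_gr; rewrite par_dbas // linearZ /= linearZ /=; apply: grZ.
suff h : gr (n - 1 - b.1, j - b.2) (ifun phi (d c)) by rewrite (par_gr h); exact: grZ.
apply: (gr_ind (T := [set x | gr (n - 1 - b.1, j - b.2) (ifun phi x)]) _ _ _ (d_bas Bc)) => /=.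
- by rewrite linear0; exact: gr0.
- by move=> y z hy hz; rewrite linearD; exact: grD.
- move=> i a c' j' ga Bc' e e'; rewrite linearZ /= /j -e' -(addrA i%:Z).
  by apply: res_gr_scale => //; have := IH c' Bc'; rewrite e /= subrK => /(_ erefl).
Qed.

Lemma Df_endo b g : endo b g -> Df g =1 endo_d b.1 g.
Proof.
move=> eg; have [gL gG] := eg.
have gD : {morph g : x y / x + y} by move=> x y; have := gL 1 x y; rewrite !scale1r.
have g0 : g 0 = 0 by apply: (addIr (g 0)); rewrite -gD !add0r.
have gZ (c : F) x : g (sc c x) = sc c (g x).
  by have := gL c%:A x 0; rewrite !addr0 g0 addr0.
have gN x : g (- x) = - g x by rewrite -algN1_opp gZ algN1_opp.
apply: (homogeneous_ind (T := [set x | Df g x = endo_d b.1 g x])); rewrite /Df /endo_d /=.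
- by rewrite (linear0 d) (linear0 par) !g0 (linear0 d) (linear0 par) mul0rz.
- move=> y z hy hz; rewrite !linearD /= !gD !linearD /= mulrzDl.
  by rewrite !opprD addrACA hy hz addrACA.
move=> n j x gx; congr (_ - _).
have gdx := res_d_gr gx.
rewrite (par_gr gdx) gZ linearZ /= (par_gr (gG _ _ _ gdx)) algM -epsD.
rewrite -sc_eps (@eps_eq F _ b.1 (n - 1 - b.1)) //.
by ring.
Qed.

Lemma tauf_endo b g : endo b g -> tauf g =1 fun x => sc (eps F b.1) (g x).
Proof.
move=> [gL gG].
have gD : {morph g : x y / x + y} by move=> x y; have := gL 1 x y; rewrite !scale1r.
have g0 : g 0 = 0 by apply: (addIr (g 0)); rewrite -gD !add0r.
have gZ (c : F) x : g (sc c x) = sc c (g x).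
  by have := gL c%:A x 0; rewrite !addr0 g0 addr0.
apply: (homogeneous_ind (T := [set x | tauf g x = sc (eps F b.1) (g x)])); rewrite /tauf /=.
- by rewrite (linear0 par) g0 scaler0 (linear0 par).
- by move=> y z; rewrite (linear_addm par) !gD (linear_addm par) => -> ->; rewrite scalerDr.
move=> n j x gx; rewrite (par_gr gx) gZ (linear_scalem par) (par_gr (gG _ _ _ gx)) algM -epsD.
by rewrite (@eps_eq F _ b.1 (n - b.1)) //; ring.
Qed.

End Lifting.

(** * The differential graded algebra End_A(P) *)

Section Endomorphisms.
Variables (F : fieldType) (A : graded_algebra F) (P : triv_resolution A).
Local Notation gr := (res_gr P).
Local Notation d := (res_d P).
Local Notation par := (par P).
Local Notation sc c x := (((c : F)%:A : A) *: x).
Local Notation ev := (@ev F A P).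
Implicit Types f g : P -> P.

Lemma endo_lin b f : endo b f -> linear f. Proof. by case. Qed.

(** The graded Hom consists of finite sums of bihomogeneous maps. P may be unbounded, so this is a
    proper condition on A-linear maps. *)
Inductive endos : (P -> P) -> Prop :=
| endos0 : endos (fun=> 0)
| endosS b f g : endo b f -> endos g -> endos (fun x => f x + g x).

Lemma endos_lin f : endos f -> linear f.
Proof.
elim=> [a x y|b g h [gL _] _ hL a x y]; first by rewrite scaler0 addr0.
by rewrite gL hL scalerDr addrACA.
Qed.

Lemma endos_endo b f : endo b f -> endos f.
Proof.
move=> h; have := endosS h endos0.
by rewrite (_ : (fun x => _) = f) //; apply/funext => x; rewrite addr0.
Qed.

Lemma endosD f g : endos f -> endos g -> endos (fun x => f x + g x).
Proof.
move=> hf hg; elim: hf => [|b f1 f2 h1 _ h2].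
  by rewrite (_ : (fun x => _) = g) //; apply/funext => x; rewrite add0r.
rewrite (_ : (fun x => _) = (fun x => f1 x + (f2 x + g x))); first exact: endosS h1 h2.
by apply/funext => x; rewrite addrA.
Qed.

Lemma endos_map (O : (P -> P) -> P -> P) :
  O (fun=> 0) = (fun=> 0) ->
  (forall f g, endos f -> endos g -> O (fun x => f x + g x) = (fun x => O f x + O g x)) ->
  (forall b f, endo b f -> endos (O f)) -> forall f, endos f -> endos (O f).
Proof.
move=> O0 OD Ob f; elim=> [|b f1 f2 h1 h2 IH]; first by rewrite O0; exact: endos0.
by rewrite OD //; [apply: endosD => //; exact: Ob h1|exact: endos_endo h1].
Qed.

Lemma endosZ c f : endos f -> endos (fun x => sc c (f x)).
Proof.
apply: (endos_map (O := fun f x => sc c (f x))).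
- by apply/funext => x; rewrite scaler0.
- by move=> f1 f2 _ _; apply/funext => x; rewrite scalerDr.
- move=> b g [gL gG]; apply: (@endos_endo b); split=> [a x y|n j x gx].
    by rewrite gL scalerDr alg_scaleC.
  by apply: grZ; exact: gG.
Qed.

Lemma endosN f : endos f -> endos (fun x => - f x).
Proof.
move=> /(endosZ (-1)); rewrite (_ : (fun x => _) = (fun x => - f x)) //.
by apply/funext => x; rewrite algN1_opp.
Qed.

Lemma endo_comp b c f g : endo b f -> endo c g -> endo (b + c) (f \o g).
Proof.
move=> [fL fG] [gL gG]; split=> [a x y|n j x gx] /=; first by rewrite gL fL.
have := fG _ _ _ (gG _ _ _ gx).
have e1 : n - c.1 - b.1 = n - (b.1 + c.1) by ring.
have e2 : j - c.2 - b.2 = j - (b.2 + c.2) by ring.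
by rewrite e1 e2.
Qed.

Lemma endos_comp f g : endos f -> endos g -> endos (f \o g).
Proof.
move=> hf hg; have gL := endos_lin hg.
apply: (endos_map (O := fun f => f \o g)) hf => //= b f1 h1.
have [f1L _] := h1.
have f1D : {morph f1 : x y / x + y} by move=> x y; have := f1L 1 x y; rewrite !scale1r.
apply: (endos_map (O := fun g => f1 \o g)) hg => //=.
- apply/funext => x /=; exact: (linear0 (mklin (f1L : linear f1))).
- by move=> g1 g2 _ _; apply/funext => x /=; exact: f1D.
- by move=> c g1 h; apply: endos_endo; exact: endo_comp h1 h.
Qed.

Lemma endo_id : endo (0, 0) (id : P -> P).
Proof.
split=> // n j x gx.
have e1 : n - 0 = n by ring.
have e2 : j - 0 = j by ring.
by rewrite e1 e2.
Qed.

Lemma tauf_endos f : endos f -> endos (tauf f).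
Proof.
apply: (endos_map (O := @tauf _ _ P)).
- by apply/funext => x; rewrite /tauf linear0.
- by move=> f1 f2 _ _; apply/funext => x; rewrite /tauf linearD.
- by move=> b g h; apply: (@endos_endo b); exact: endo_par.
Qed.

Lemma Df_endos f : endos f -> endos (Df f).
Proof.
apply: (endos_map (O := @Df _ _ P)).
- by apply/funext => x; rewrite /Df (linear0 d) !(linear0 par) subrr.
- move=> f1 f2 _ _; apply/funext => x.
  by rewrite /Df (linear_addm d) (linear_addm par) opprD addrACA.
- move=> b g h; apply: (@endos_endo (b + (1, 0))).
  have [gL gG] := h; split.
    exact: (Df_lin (mklin (gL : linear g))).
  move=> n j x gx; have [_ pG] := endo_par h.
  have e1 : n - (b.1 + 1) = n - b.1 - 1 by ring.
  have e2 : n - (b.1 + 1) = n - 1 - b.1 by ring.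
  rewrite /= addr0 /Df; apply: grB.
    by rewrite e1; apply/res_d_gr; exact: gG.
  by rewrite e2; exact: (pG _ _ _ (res_d_gr gx)).
Qed.

Definition endo_pred : pred (P -> P) := fun f => `[< endos f >].

Lemma endo_pred_zmod_closed : zmod_closed endo_pred.
Proof.
split=> [|f g /asboolP hf /asboolP hg]; apply/asboolP; first exact: endos0.
exact: (endosD hf (endosN hg)).
Qed.

HB.instance Definition _ :=
  GRing.isZmodClosed.Build (P -> P) endo_pred endo_pred_zmod_closed.

Definition endo_alg : Type := {f : P -> P | endo_pred f}.
HB.instance Definition _ := SubChoice.on endo_alg.
HB.instance Definition _ := [SubChoice_isSubZmodule of endo_alg by <:].

Definition mk_endo f (hf : endos f) : endo_alg := exist _ f (asboolT hf).

Lemma endo_algP (f : endo_alg) : endos (val f).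
Proof. by case: f => f /= /asboolP. Qed.

Lemma endo_alg_eq (f g : endo_alg) : val f =1 val g -> f = g.
Proof. by move=> h; apply/val_inj/funext. Qed.

Definition endo_scale (c : F) (f : endo_alg) : endo_alg := mk_endo (endosZ c (endo_algP f)).

Lemma endo_scalerA a b v : endo_scale a (endo_scale b v) = endo_scale (a * b) v.
Proof. by apply: endo_alg_eq => x /=; rewrite algM. Qed.
Lemma endo_scale1r : left_id 1 endo_scale.
Proof. by move=> v; apply: endo_alg_eq => x /=; rewrite alg1. Qed.
Lemma endo_scalerDr : right_distributive endo_scale +%R.
Proof. by move=> a u v; apply: endo_alg_eq => x /=; rewrite scalerDr. Qed.
Lemma endo_scalerDl v : {morph endo_scale^~ v : a b / a + b}.
Proof. by move=> a b; apply: endo_alg_eq => x /=; rewrite algD. Qed.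

HB.instance Definition _ := GRing.Zmodule_isLmodule.Build F endo_alg
  endo_scalerA endo_scale1r endo_scalerDr endo_scalerDl.

Definition endo_mul (f g : endo_alg) : endo_alg :=
  mk_endo (endos_comp (endo_algP f) (endo_algP g)).

Definition tauB (f : endo_alg) : endo_alg := mk_endo (tauf_endos (endo_algP f)).
Definition DB (f : endo_alg) : endo_alg := mk_endo (Df_endos (endo_algP f)).

Lemma tauB_linear : linear tauB.
Proof. by move=> c f g; apply: endo_alg_eq => x /=; rewrite /tauf !linearP. Qed.

Lemma DB_linear : linear DB.
Proof.
move=> c f g; apply: endo_alg_eq => x /=.
by rewrite /Df (linear_addm d) (linear_addm par) (linear_scalem d) (linear_scalem par)
  opprD addrACA -scalerBr.
Qed.

End Endomorphisms.

(** * Cochains, and Ext over a minimal resolution *)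

Section Cochains.
Variables (F : fieldType) (A : graded_algebra F) (M : lmodType A).
Variables (G : int -> set M) (N : set M) (P : resolution G N).
Implicit Types (phi psi : P -> F^o).

Lemma cochain_atP b (c : F) phi psi : cochain_at P b phi -> cochain_at P b psi ->
  cochain_at P b (c *: phi + psi).
Proof.
move=> [phiL phiG] [psiL psiG]; split=> [a x y|b' x ne gx].
  rewrite -[LHS]/(c * phi (a *: x + y) + psi (a *: x + y)).
  rewrite -[RHS]/(aug a * (c * phi x + psi x) + (c * phi y + psi y)).
  by rewrite phiL psiL; ring.
rewrite -[LHS]/(c * phi x + psi x).
by rewrite (phiG _ _ ne gx) (psiG _ _ ne gx) mulr0 addr0.
Qed.

Lemma cochain_at0 b : cochain_at P b 0.
Proof. by split=> // a x y; rewrite -[LHS]/(0 : F) -[RHS]/(aug a * 0 + 0) mulr0 addr0. Qed.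

Lemma cochain_at_cochain b phi : cochain_at P b phi -> cochain P phi.
Proof. by move=> h; apply: lspan_incl; exists b. Qed.

Lemma cochain_lin phi : cochain P phi ->
  forall (a : A) x y, phi (a *: x + y) = aug a * phi x + phi y.
Proof.
have h : cochain P `<=` [set phi | forall (a : A) x y, phi (a *: x + y) = aug a * phi x + phi y].
  apply: lspan_min => /=.
  - by move=> a x y; rewrite -[LHS]/(0 : F) -[RHS]/(aug a * 0 + 0) mulr0 addr0.
  - move=> u v hu hv a x y; rewrite -[LHS]/(u (a *: x + y) + v (a *: x + y)).
    rewrite -[RHS]/(aug a * (u x + v x) + (u y + v y)).
    by rewrite hu hv; ring.
  - move=> k v hv a x y; rewrite -[LHS]/(k * v (a *: x + y)).
    by rewrite -[RHS]/(aug a * (k * v x) + k * v y) hv; ring.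
  - by move=> psi [b _ [h _]].
exact: h.
Qed.

Lemma Ext_biP b (c : F) x y : Ext_bi P b x -> Ext_bi P b y -> Ext_bi P b (c *: x + y).
Proof.
move=> [phi hphi [z [zE ->]]] [psi hpsi [t [tE ->]]].
exists (c *: phi + psi); first exact: cochain_atP.
exists (c *: z + t); split; last by rewrite Ext_classD -Ext_scale_class.
by rewrite -zE -tE.
Qed.

Lemma Ext_bi0 b : Ext_bi P b 0.
Proof.
exists 0; first exact: cochain_at0.
exists 0; split=> //; apply/esym.
have := Ext_classD (0 : cocycles P) 0; rewrite addr0 => /esym/eqP.
by rewrite -subr_eq0 addrK => /eqP.
Qed.

Lemma Ext_biZ b (c : F) x : Ext_bi P b x -> Ext_bi P b (c *: x).
Proof. by move=> h; rewrite -[_ *: x]addr0; apply: Ext_biP => //; exact: Ext_bi0. Qed.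

Lemma Ext_biD b x y : Ext_bi P b x -> Ext_bi P b y -> Ext_bi P b (x + y).
Proof. by move=> h h'; rewrite -[x]scale1r; exact: Ext_biP. Qed.

Lemma Ext_bi_deg p j : Ext_bi P (p, j) `<=` Ext_deg P p.
Proof. by move=> x h; apply: lspan_incl; exists j. Qed.

Lemma Ext_deg_unique p j : (forall j', j' != j -> Ext_bi P (p, j') `<=` [set 0]) ->
  Ext_deg P p `<=` Ext_bi P (p, j).
Proof.
move=> h; apply: lspan_min; [exact: Ext_bi0|exact: Ext_biD|by move=> k v; exact: Ext_biZ|].
move=> x [j' _ hx]; have [<- //|ne] := eqVneq j' j.
by have -> : x = 0 by [exact: (h _ ne _ hx)]; exact: Ext_bi0.
Qed.

End Cochains.

Section MinimalExt.
Variables (F : fieldType) (A : graded_algebra F) (P : triv_resolution A).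
Hypothesis hmin : minimal P.
Local Notation d := (res_d P).
Local Notation par := (par P).
Local Notation ev := (@ev F A P).
Implicit Types (phi psi : P -> F^o) (x y : Ext P).

Lemma cochain_cocycle phi : cochain P phi -> cocycle phi.
Proof.
move=> h; apply/asboolP; split=> //; apply/funext => x /=.
exact: (alin_d hmin x (cochain_lin h)).
Qed.

Lemma coboundary0 (z : cocycles P) : coboundary z -> z = 0.
Proof.
move=> /asboolP[psi hpsi e]; apply: val_inj; rewrite e; apply/funext => x /=.
exact: (alin_d hmin x (cochain_lin hpsi)).
Qed.

(** Over a minimal resolution the coboundaries vanish, so a class has exactly one cocycle, and every
    cochain is one. *)
Definition rep x : P -> F^o := val (projT1 (cid (Ext_class_surj x))).

Lemma rep_class (z : cocycles P) : rep (Ext_class z) = val z.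
Proof.
rewrite /rep; case: cid => t /= /Ext_classP /coboundary0 /eqP.
by rewrite subr_eq0 => /eqP ->.
Qed.

Lemma rep_inj : injective rep.
Proof.
move=> x y; have [z <-] := Ext_class_surj x; have [t <-] := Ext_class_surj y.
by rewrite !rep_class => /val_inj ->.
Qed.

Lemma repP (c : F) x y : rep (c *: x + y) = c *: rep x + rep y.
Proof.
have [z <-] := Ext_class_surj x; have [t <-] := Ext_class_surj y.
by rewrite -[c *: _]/(Ext_scale c _) Ext_scale_class -Ext_classD !rep_class.
Qed.

Lemma rep0 : rep 0 = 0.
Proof. by have := repP (-1) 0 0; rewrite scaler0 addr0 scaleN1r addNr. Qed.

Lemma cochain_rep x : cochain P (rep x).
Proof.
have [z <-] := Ext_class_surj x; rewrite rep_class.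
by case: z => phi /= /asboolP[].
Qed.

Lemma rep_alin x : alin (rep x).
Proof. exact: cochain_lin (cochain_rep x). Qed.

Lemma rep_surj phi : cochain P phi -> exists x, rep x = phi.
Proof.
move=> h; exists (Ext_class (exist _ phi (cochain_cocycle h) : cocycles P)).
by rewrite rep_class.
Qed.

Lemma representsP x phi : represents x phi <-> rep x = phi.
Proof.
split=> [[z [<- ->]]|<-]; first exact: rep_class.
have [z <-] := Ext_class_surj x; exists z; by rewrite rep_class.
Qed.

Lemma Ext_bi_rep b x : Ext_bi P b x <-> cochain_at P b (rep x).
Proof.
split=> [[phi h /representsP ->] //|h].
by exists (rep x) => //; apply/representsP.
Qed.

Definition cls phi : Ext P :=
  if pselect (cochain P phi) is left h then projT1 (cid (rep_surj h)) else 0.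

Lemma rep_cls phi : cochain P phi -> rep (cls phi) = phi.
Proof. by rewrite /cls => h; case: pselect => // h'; case: cid. Qed.

Lemma ev_endo b f : endo b f -> cochain_at P b (ev \o f).
Proof.
move=> [fL fG]; split=> [a x y|[n j] x ne gx] /=; first by rewrite fL evP.
have := fG _ _ _ gx; apply: ev_gr; apply: contra ne => /eqP[/eqP e1 /eqP e2].
by rewrite [b]surjective_pairing xpair_eqE -subr_eq0 e1 -subr_eq0 e2.
Qed.

Lemma ev_endos f : endos f -> cochain P (ev \o f).
Proof.
elim=> [|b f1 f2 h1 h2 IH].
  rewrite (_ : _ \o _ = 0); first exact: lspan0.
  by apply/funext => x /=; exact: ev0.
rewrite (_ : _ \o _ = ((ev \o f1) : P -> F^o) + (ev \o f2)).
  by apply: lspanD => //; exact: (cochain_at_cochain (ev_endo h1)).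
by apply/funext => x; exact: (evD (f1 x) (f2 x)).
Qed.

Lemma cochain_at_par b phi : cochain_at P b phi -> phi \o par = eps F b.1 *: phi.
Proof.
move=> [phiL phiG]; apply/funext.
have aphi : alin phi by exact: phiL.
apply: (homogeneous_ind (T := [set x | (phi \o par) x = (eps F b.1 *: phi) x])) => /=.
- by rewrite -[RHS]/(eps F b.1 * phi 0) linear0 alin0 // mulr0.
- move=> x y; rewrite -![(_ *: phi) _]/(eps F b.1 * phi _) linearD !(alinD aphi) => -> ->.
  by rewrite -mulrDr.
move=> n j x gx; rewrite -[RHS]/(eps F b.1 * phi x) (par_gr gx) (alinZ _ _ aphi) aug_alg.
have [<- //|ne] := eqVneq (n, j) b.
by rewrite (phiG _ _ ne gx) !mulr0.
Qed.

Lemma cochain_par phi : cochain P phi -> cochain P (phi \o par).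
Proof.
have h : cochain P `<=` [set phi : P -> F^o | cochain P (phi \o par)].
  apply: lspan_min => /=.
  - exact: lspan0.
  - by move=> u v hu hv; exact: lspanD hu hv.
  - by move=> k v hv; exact: (lspanZ k hv).
  - move=> psi [b _ hb] /=; rewrite (cochain_at_par hb).
    by apply: lspanZ; exact: cochain_at_cochain hb.
exact: h.
Qed.

(** The parity of the shifted Ext, that is the sign (-1)^(p+1) in degree p. *)
Definition sgE x : Ext P := cls (- (rep x \o par)).

Lemma rep_sg x : rep (sgE x) = - (rep x \o par).
Proof. by apply: rep_cls; apply/lspanN/cochain_par/cochain_rep. Qed.

Lemma sgE_linear : linear sgE.
Proof.
move=> c x y; apply: rep_inj; rewrite repP !rep_sg; apply/funext => v.
rewrite repP -[LHS]/(- (c * rep x (par v) + rep y (par v))).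
by rewrite -[RHS]/(c * - rep x (par v) - rep y (par v)) mulrN opprD.
Qed.

Definition sgL : {linear Ext P -> Ext P} := mklin sgE_linear.

Lemma sgLK : involutive sgL.
Proof.
move=> x; apply: rep_inj; rewrite -![sgL _]/(sgE _) !rep_sg; apply/funext => v.
by rewrite -[LHS]/(- - rep x (par (par v))) parK opprK.
Qed.

Lemma sgL_bi b x : Ext_bi P b x -> sgL x = eps F (b.1 + 1) *: x.
Proof.
move=> /Ext_bi_rep /cochain_at_par e; apply: rep_inj; rewrite -[sgL x]/(sgE x) rep_sg e.
rewrite -[_ *: x]addr0 repP rep0 addr0 epsD eps1 mulrN1.
by rewrite scaleNr.
Qed.

Lemma sgL_deg p x : Ext_deg P p x -> sgL x = eps F (p + 1) *: x.
Proof.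
have h : Ext_deg P p `<=` [set x | sgL x = eps F (p + 1) *: x].
  apply: lspan_min => /=.
  - by rewrite scaler0; exact: (linear0 sgL).
  - by move=> u v hu hv; rewrite scalerDr -hu -hv; exact: (linear_addm sgL).
  - by move=> k v hv; rewrite scalerA mulrC -scalerA -hv; exact: (linear_scalem sgL).
  - by move=> y [j _ hy]; exact: (sgL_bi hy).
exact: h.
Qed.

End MinimalExt.

Lemma pair_ext (T1 T2 : Type) (a b : T1 * T2) : a.1 = b.1 -> a.2 = b.2 -> a = b.
Proof. by case: a b => a1 a2 [b1 b2] /= -> ->. Qed.

(** * The transferred A-infinity structure *)

Section ModelStructure.
Variables (F : fieldType) (A : graded_algebra F) (P : triv_resolution A).
Hypothesis hmin : minimal P.
Local Notation gr := (res_gr P).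
Local Notation d := (res_d P).
Local Notation par := (par P).
Local Notation sc c x := (((c : F)%:A : A) *: x).
Local Notation ev := (@ev F A P).
Variables (e0 : P) (s : P -> P).
Hypothesis ge0 : gr (0, 0) e0.
Hypothesis ev_e0 : ev e0 = 1.
Hypothesis sP : forall (c : F) x y, s (sc c x + y) = sc c (s x) + s y.
Hypothesis s_gr : forall n j x, gr (n, j) x -> gr (n + 1, j) (s x).
Hypothesis ds : forall x, d (s x) + s (d x) = x - sc (ev x) e0.
Hypothesis ss : forall x, s (s x) = 0.
Hypothesis s_e0 : s e0 = 0.
Hypothesis ev_s : forall x, ev (s x) = 0.
Hypothesis s_gen : forall x, generators x -> s x = 0.

Local Notation B := (endo_alg P).
Local Notation E := (Ext P).
Local Notation rep := (@rep F A P).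
Local Notation cls := (cls hmin).

Definition toL (f : B) : {linear P -> P} := mklin (endos_lin (endo_algP f)).

Lemma hfun_endos (f : P -> P) : endos f -> endos (hfun s f).
Proof.
apply: (endos_map (O := fun f => hfun s f)).
- apply/funext => x; apply: (@lin_eq2 _ _ P (hfun s (fun=> 0)) (lin0 P)) => b Bb /= e.
  by rewrite hfunE // e (linear0 par) oppr0 addr0 (s0 sP).
- move=> f1 f2 _ _; apply/funext => x.
  have := hfunP sP 1 f1 f2 x; rewrite alg1 => <-.
  by congr (hfun s _ x); apply/funext => y; rewrite alg1.
- by move=> b f1 h; apply: endos_endo; exact: (hfun_endo s_gr h).
Qed.

Lemma ifun_endos (phi : P -> F^o) : cochain P phi -> endos (ifun e0 s phi).
Proof.
have h : cochain P `<=` [set phi : P -> F^o | endos (ifun e0 s phi)].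
  apply: lspan_min => /=.
  - rewrite (_ : GRing.Linear.sort _ = (fun=> 0)); first exact: endos0.
    apply/funext => x; apply: (@lin_eq2 _ _ P (ifun e0 s (fun=> 0)) (lin0 P)) => b Bb /= e.
    by rewrite ifunE // e (linear0 par) alg0 (s0 sP) addr0.
  - move=> u v hu hv.
    rewrite (_ : GRing.Linear.sort _ = (fun x => ifun e0 s u x + ifun e0 s v x)); first exact: endosD.
    apply/funext => x; have := ifunP e0 sP 1 u v x; rewrite alg1 => <-.
    by congr (ifun e0 s _ x); apply/funext => y; rewrite mul1r.
  - move=> k v hv.
    rewrite (_ : GRing.Linear.sort _ = (fun x => sc k (ifun e0 s v x) + 0)); last first.
      apply/funext => x.
      have i0 : ifun e0 s (fun=> 0) x = 0.
        apply: (@lin_eq2 _ _ P (ifun e0 s (fun=> 0)) (lin0 P)) => b Bb /= e.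
        by rewrite ifunE // e (linear0 par) alg0 (s0 sP) addr0.
      have := ifunP e0 sP k v (fun=> 0) x; rewrite i0 => <-.
      by congr (ifun e0 s _ x); apply/funext => y; rewrite addr0.
    by apply: endosD; [exact: endosZ|exact: endos0].
  - by move=> psi [b _ hb]; apply: (@endos_endo _ _ _ b); exact: (ifun_endo ge0 s_gr hb).
exact: h.
Qed.

Definition hB (f : B) : B := mk_endo (hfun_endos (endo_algP f)).
Definition iB (x : E) : B := mk_endo (ifun_endos (cochain_rep hmin x)).
Definition pB (f : B) : E := cls (ev \o val f).

Lemma rep_pB f : rep (pB f) = ev \o val f.
Proof. by apply: rep_cls; exact: ev_endos (endo_algP f). Qed.

Lemma hB_linear : linear hB.
Proof. by move=> c f g; apply: endo_alg_eq => x; exact: (hfunP sP). Qed.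
Lemma iB_linear : linear iB.
Proof.
move=> c x y; apply: endo_alg_eq => v.
rewrite -[LHS]/(ifun e0 s (rep (c *: x + y)) v).
rewrite -[RHS]/(sc c (ifun e0 s (rep x) v) + ifun e0 s (rep y) v) -(ifunP e0 sP).
by congr (ifun e0 s _ v); rewrite repP.
Qed.
Lemma pB_linear : linear pB.
Proof.
move=> c f g; apply: rep_inj => //; rewrite repP // !rep_pB; apply/funext => x.
by rewrite /= evP aug_alg.
Qed.

Definition hL := mklin hB_linear.
Definition iL := mklin iB_linear.
Definition pL := mklin pB_linear.
Definition tL := mklin (@tauB_linear F A P).
Definition DL := mklin (@DB_linear F A P).
Definition sL := sgL hmin.

Local Notation mul := (@endo_mul F A P).

Lemma mulDl' (c : F) (x y z : B) : mul (c *: x + y) z = c *: mul x z + mul y z.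
Proof. by apply: endo_alg_eq. Qed.
Lemma mulDr' (c : F) (x y z : B) : mul x (c *: y + z) = c *: mul x y + mul x z.
Proof. by apply: endo_alg_eq => v; exact: (endos_lin (endo_algP x) c%:A). Qed.
Lemma mulA' (x y z : B) : mul x (mul y z) = mul (mul x y) z.
Proof. by apply: endo_alg_eq. Qed.
Lemma tau_mul' (x y : B) : tL (mul x y) = mul (tL x) (tL y).
Proof. by apply: endo_alg_eq => v /=; rewrite /tauf /= parK. Qed.
Lemma tauK' : involutive tL.
Proof. by move=> x; apply: endo_alg_eq => v /=; rewrite /tauf /= !parK. Qed.
Lemma sgK' : involutive sL.
Proof. exact: sgLK. Qed.
Lemma h_tau' (x : B) : tL (hL x) = - hL (tL x).
Proof. by apply: endo_alg_eq => v; exact: (tauf_hfun sP s_gr (toL x)). Qed.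
Lemma i_tau' (x : E) : tL (iL x) = - iL (sL x).
Proof.
apply: endo_alg_eq => v.
have h : tauf (ifun e0 s (rep x)) v = ifun e0 s (rep x \o par) v.
  by apply: (tauf_ifun ge0 sP s_gr); exact: (rep_alin hmin).
rewrite [LHS]h -[RHS]/(- ifun e0 s (rep (sgE hmin x)) v) rep_sg.
have := ifunP e0 sP (-1) (- (rep x \o par)) (fun=> 0) v.
have i0 : ifun e0 s (fun=> 0) v = 0.
  apply: (@lin_eq2 _ _ P (ifun e0 s (fun=> 0)) (lin0 P)) => b Bb /= e.
  by rewrite ifunE // e (linear0 par) alg0 (s0 sP) addr0.
rewrite i0 addr0 algN1_opp => <-; congr (ifun e0 s _ v); apply/funext => w.
by rewrite addr0 mulN1r -[RHS]/(- - rep x (par w)) opprK.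
Qed.
Lemma p_tau' (b : B) : sL (pL b) = - pL (tL b).
Proof.
apply: rep_inj => //; rewrite -[sL _]/(sgE hmin (pB b)) rep_sg rep_pB.
rewrite -scaleN1r -[_ *: _]addr0 repP // rep0 // rep_pB addr0; apply/funext => v.
by rewrite -[RHS]/(-1 * ev (par (val b (par v)))) ev_par mulN1r.
Qed.
Lemma D_mul' (x y : B) : DL (mul x y) = mul (DL x) y + mul (tL x) (DL y).
Proof.
apply: endo_alg_eq => v.
have xB z t : val x (z - t) = val x z - val x t by exact: (linearB (toL x)).
rewrite -[LHS]/(d (val x (val y v)) - par (val x (val y (par (d v))))).
rewrite -[RHS]/(d (val x (val y v)) - par (val x (par (d (val y v)))) +
  par (val x (par (d (val y v) - par (val y (par (d v))))))).
rewrite -addrA; congr (_ + _).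
by rewrite (linearB par) parK xB (linearB par) addKr.
Qed.
Lemma D_tau' (x : B) : DL (tL x) = - tL (DL x).
Proof.
apply: endo_alg_eq => v.
rewrite -[LHS]/(d (par (val x (par v))) - par (par (val x (par (par (d v)))))).
rewrite -[RHS]/(- par (d (val x (par v)) - par (val x (par (d (par v)))))).
have xN z : val x (- z) = - val x z by exact: (linearN (toL x)).
by rewrite (linearB par) !parK !d_par (linearN par) parK xN opprB addrC.
Qed.
Lemma D_i' (x : E) : DL (iL x) = 0.
Proof.
apply: endo_alg_eq => v; apply: (Df_ifun hmin ge0 ev_e0 sP ds ev_s).
exact: (rep_alin hmin).
Qed.
Lemma p_D' (b : B) : pL (DL b) = 0.
Proof.
apply: rep_inj => //; rewrite rep0 // rep_pB; apply/funext => v.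
exact: (ev_Df hmin (toL b)).
Qed.
Lemma p_i' (x : E) : pL (iL x) = x.
Proof.
apply: rep_inj => //; rewrite rep_pB; apply/funext => v.
by apply: (ev_ifun ev_e0 ev_s); exact: (rep_alin hmin).
Qed.
Lemma homotopy' (b : B) : DL (hL b) + hL (DL b) = iL (pL b) - b.
Proof.
apply: endo_alg_eq => v.
rewrite -[RHS]/(ifun e0 s (rep (pB b)) v - val b v) rep_pB.
exact: (homotopyE sP ds ev_s (toL b)).
Qed.
Lemma h_h' (b : B) : hL (hL b) = 0.
Proof. by apply: endo_alg_eq => v; exact: (hfun_hfun sP ss). Qed.
Lemma p_h' (b : B) : pL (hL b) = 0.
Proof.
apply: rep_inj => //; rewrite rep0 // rep_pB; apply/funext => v.
exact: (ev_hfun ev_s).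
Qed.
Lemma h_i' (x : E) : hL (iL x) = 0.
Proof. by apply: endo_alg_eq => v; exact: (hfun_ifun sP ss s_e0). Qed.

Lemma cochain_ev : cochain_at P (0, 0) ev.
Proof. exact: (ev_endo (endo_id P)). Qed.

Definition oneE : E := cls ev.
Lemma rep_one : rep oneE = ev.
Proof. by apply: rep_cls; exact: cochain_at_cochain cochain_ev. Qed.
Lemma i_one : iL oneE = mk_endo (endos_endo (endo_id P)).
Proof.
apply: endo_alg_eq => v; rewrite -[LHS]/(ifun e0 s (rep oneE) v) rep_one.
exact: (ifun_ev ds s_gen).
Qed.
Lemma mul1l' b : mul (iL oneE) b = b.
Proof. by rewrite i_one; apply: endo_alg_eq. Qed.
Lemma mul1r' b : mul b (iL oneE) = b.
Proof. by rewrite i_one; apply: endo_alg_eq. Qed.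
Lemma one_bi : Ext_bi P (0, 0) oneE.
Proof. by apply/Ext_bi_rep => //; rewrite rep_one; exact: cochain_ev. Qed.
Lemma sg_one' : sL oneE = - oneE.
Proof. by rewrite (sgL_bi hmin one_bi) add0r eps1 scaleN1r. Qed.

Definition model_map : seq E -> B := transfer_map mul tL hL iL.
Definition model_prod : seq E -> B := transfer_prod mul tL hL iL.
Definition model_op : seq E -> E := transfer_op mul tL hL iL pL.

Lemma model_rel xs : ins model_op sL model_map xs = model_prod xs + DL (model_map xs)
  /\ ins model_op sL model_op xs = 0.
Proof.
exact: (transfer_relations mulDl' mulDr' mulA' tau_mul' tauK' sgK' h_tau' i_tau'
  p_tau' D_mul' D_tau' D_i' p_D' p_i' homotopy' h_h' p_h').
Qed.

Lemma model_map_multilin : multilin model_map.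
Proof. exact: (transfer_multilin _ _ _ mulDl' mulDr'). Qed.
Lemma model_op_multilin : multilin model_op.
Proof. exact: (transfer_op_multilin _ _ _ _ mulDl' mulDr'). Qed.
Lemma model_op1 x : model_op [:: x] = 0.
Proof. exact: (transfer_op1 _ _ _ _ mulDl' mulDr'). Qed.
Lemma model_map_tau xs : tL (model_map xs) = - model_map (map sL xs).
Proof. exact: (tau_transfer mulDl' mulDr' tau_mul' h_tau' i_tau'). Qed.
Lemma model_op2 x y : model_op [:: x; y] = - pL (mul (iL (sL x)) (iL y)).
Proof. exact: (transfer_op2 _ _ mulDl' mulDr' i_tau'). Qed.
Lemma model_mapE x y xs : model_map (x :: y :: xs) = hL (model_prod (x :: y :: xs)).
Proof. exact: (transfer_mapE _ _ _ mulDl' mulDr'). Qed.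
Lemma model_opE xs : model_op xs = pL (model_prod xs).
Proof. by []. Qed.
Lemma model_prodE xs : model_prod xs = spl (fun u v => mul (tL (model_map u)) (model_map v)) xs.
Proof. by []. Qed.
Lemma model_op_unit u v : (2 <= size u + size v)%N -> model_op (u ++ oneE :: v) = 0.
Proof.
exact: (transfer_op_unit mulDl' mulDr' h_tau' i_tau' p_tau' h_h' p_h' h_i' sg_one' mul1l' mul1r').
Qed.
Lemma model_op_unitl x : model_op [:: oneE; x] = x.
Proof. exact: (transfer_op_unitl hL mulDl' mulDr' i_tau' p_i' sg_one' mul1l'). Qed.
Lemma model_op_unitr x : model_op [:: x; oneE] = - sL x.
Proof. exact: (transfer_op_unitr hL mulDl' mulDr' i_tau' p_i' mul1r'). Qed.

Lemma endo0 b : endo b (fun=> 0 : P).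
Proof. by split=> [a x y|n j x _]; [rewrite scaler0 addr0|exact: gr0]. Qed.

Lemma endo_add b (f g : P -> P) : endo b f -> endo b g -> endo b (fun x => f x + g x).
Proof.
move=> [fL fG] [gL gG]; split=> [a x y|n j x gx].
  by rewrite fL gL scalerDr addrACA.
by apply: grD; [exact: fG|exact: gG].
Qed.

Lemma endo_scal b (c : F) (f : P -> P) : endo b f -> endo b (fun x => sc c (f x)).
Proof.
move=> [fL fG]; split=> [a x y|n j x gx]; last by apply: grZ; exact: fG.
by rewrite fL scalerDr alg_scaleC.
Qed.

Lemma model_endo bs xs : (0 < size xs)%N -> homogeneous (Ext_bi P) bs xs ->
  endo (\sum_(b <- bs) b + (1 - (size xs)%:Z, 0)) (val (model_map xs)) /\
  endo (\sum_(b <- bs) b + (2 - (size xs)%:Z, 0)) (val (model_prod xs)).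
Proof.
have [n] := ubnP (size xs); elim: n bs xs => // n IH bs xs ltn xs0 hxs.
have hprod : endo (\sum_(b <- bs) b + (2 - (size xs)%:Z, 0)) (val (model_prod xs)).
  rewrite model_prodE; apply: (@spl_closed _ _ [set f : B | endo _ (val f)]) => /=.
    by move=> f g hf hg; exact: endo_add.
  move=> u v e.
  have [->|u0] := eqVneq u [::].
    rewrite (_ : tauf _ \o _ = (fun=> 0)); first exact: endo0.
    by apply/funext => w; exact: (linear0 par).
  have [->|v0] := eqVneq v [::].
    rewrite (_ : tauf _ \o _ = (fun=> 0)); first exact: endo0.
    apply/funext => w /=; rewrite /tauf (linear0 par).
    by rewrite [X in par X](linear0 (toL (model_map u))) (linear0 par).
  rewrite -size_eq0 -lt0n in u0; rewrite -size_eq0 -lt0n in v0.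
  have suv : (size u + size v = size xs)%N by rewrite -e size_cat.
  have hu : homogeneous (Ext_bi P) (take (size u) bs) u.
    by have := homogeneous_take (size u) hxs; rewrite -[in take _ xs]e take_size_cat.
  have hv : homogeneous (Ext_bi P) (drop (size u) bs) v.
    by have := homogeneous_drop (size u) hxs; rewrite -[in drop _ xs]e drop_size_cat.
  have ltu : (size u < n)%N.
    by move: ltn; rewrite -suv ltnS; apply: leq_trans; rewrite -addn1 leq_add2l.
  have ltv : (size v < n)%N.
    by move: ltn; rewrite -suv ltnS; apply: leq_trans; rewrite -add1n leq_add2r.
  have [hu1 _] := IH _ _ ltu u0 hu.
  have [hv1 _] := IH _ _ ltv v0 hv.
  have := endo_comp (endo_par hu1) hv1.
  have -> : \sum_(b <- take (size u) bs) b + (1 - (size u)%:Z, 0) +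
      (\sum_(b <- drop (size u) bs) b + (1 - (size v)%:Z, 0)) =
      \sum_(b <- bs) b + (2 - (size xs)%:Z, 0) :> (int * int)%type.
    rewrite -{3}[bs](cat_take_drop (size u)) big_cat /= addrACA; congr (_ + _).
    by rewrite -suv PoszD; apply: pair_ext => //=; ring.
  by [].
split=> //; case: xs xs0 hxs hprod {ltn} => [//|x [|y xs]] _ hxs hprod.
  case: bs hxs {hprod} => [|b [|b' bs]]; try by case.
  move=> /homogeneous_cons[/(Ext_bi_rep hmin) hx _].
  rewrite big_seq1 (_ : b + _ = b); first exact: (ifun_endo ge0 s_gr hx).
  by apply: pair_ext => /=; ring.
rewrite model_mapE; have := hfun_endo s_gr hprod.
move: (\sum_(b <- bs) b) (size _) => S n' h.
have e : S + (1 - n'%:Z, 0) =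
    ((S + (2 - n'%:Z, 0)).1 - 1, (S + (2 - n'%:Z, 0)).2) :> (int * int)%type.
  by apply: pair_ext => //=; ring.
by rewrite e.
Qed.

Lemma model_op_bi bs xs : (0 < size xs)%N -> homogeneous (Ext_bi P) bs xs ->
  Ext_bi P (\sum_(b <- bs) b + (2 - (size xs)%:Z, 0)) (model_op xs).
Proof.
move=> xs0 hxs; apply/(Ext_bi_rep hmin); rewrite rep_pB; apply: ev_endo.
exact: (model_endo xs0 hxs).2.
Qed.

Lemma word_in_deg ps xs : homogeneous (Ext_deg P) ps xs <->
  word_in (map (@lspan F E) (map (fun p => \bigcup_j Ext_bi P (p, j)) ps)) xs.
Proof.
elim: ps xs => [|p ps IH] [|x xs]; try by split=> //; case.
by rewrite homogeneous_cons IH.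
Qed.

Lemma word_in_bi (ps : seq int) xs : word_in (map (fun p => \bigcup_j Ext_bi P (p, j)) ps) xs ->
  exists bs, [/\ homogeneous (Ext_bi P) bs xs, map fst bs = ps &
    (\sum_(b <- bs) b).1 = \sum_(p <- ps) p].
Proof.
elim: ps xs => [|p ps IH] [|x xs] //=; first by exists [::]; rewrite !big_nil.
move=> [[j _ hx] /IH[bs [hbs e1 e2]]]; exists ((p, j) :: bs); split.
- exact/homogeneous_cons.
- by rewrite /= e1.
- by rewrite !big_cons /= e2.
Qed.

Lemma Ext_degZ p (c : F) (x : E) : Ext_deg P p x -> Ext_deg P p (c *: x).
Proof. exact: lspanZ. Qed.

Lemma model_op_deg ps xs : (0 < size xs)%N -> homogeneous (Ext_deg P) ps xs ->
  Ext_deg P (\sum_(p <- ps) p + (2 - (size xs)%:Z)) (model_op xs).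
Proof.
move=> xs0 hxs; have sxs := homogeneous_size hxs.
rewrite -sxs; move: hxs => /word_in_deg.
have ps0 : (0 < size ps)%N by rewrite sxs.
apply: multilin_span; first exact: model_op_multilin.
- exact: lspan0.
- by move=> x y; exact: lspanD.
- by move=> c x; exact: lspanZ.
move=> ys /word_in_bi[bs [hbs e1 e2]]; apply: Ext_bi_deg.
have sys : size ys = size ps by rewrite -(homogeneous_size hbs) -e1 size_map.
have := model_op_bi (ltac:(rewrite sys) : (0 < size ys)%N) hbs.
by rewrite -e2 sys [X in Ext_bi P X]surjective_pairing /=; exact.
Qed.

Definition minimal_model (xs : seq E) : E := model_op (twist sL xs).
Definition minimal_model_lift (xs : seq E) : P -> P := val (model_map (twist sL xs)).

Let sgG := sgL_deg hmin.

Lemma bi_homog_deg bs xs : homogeneous (Ext_bi P) bs xs -> homogeneous (Ext_deg P) (map fst bs) xs.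
Proof.
elim: bs xs => [|b bs IH] [|x xs]; try by case.
move=> /homogeneous_cons[hx /IH h] /=; apply/homogeneous_cons; split=> //.
by apply: (@Ext_bi_deg _ _ _ _ _ _ _ b.2); rewrite -surjective_pairing.
Qed.

Lemma minimal_model_opE ps xs : homogeneous (Ext_deg P) ps xs ->
  minimal_model xs = eps F (wt ps) *: model_op xs.
Proof. exact: (multilin_twist sgG model_op_multilin). Qed.

Lemma minimal_model_liftE ps xs : homogeneous (Ext_deg P) ps xs ->
  minimal_model_lift xs = val (eps F (wt ps) *: model_map xs).
Proof. by move=> h; rewrite /minimal_model_lift (multilin_twist sgG model_map_multilin h). Qed.

(** The unit has degree 0, so the iterates of [- sg] in the twist fix it. *)
Lemma twist_one u v : exists u' v', twist sL (u ++ oneE :: v) = u' ++ oneE :: v' /\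
  size u' = size u /\ size v' = size v.
Proof.
elim: u => [|a u [u' [v' [e [su sv]]]]] /=.
  exists [::], (twist sL v); rewrite size_twist; split=> //=; congr (_ :: _).
  have sg1 : sgE hmin oneE = - oneE := sg_one'.
  by elim: (size v) => // n IH; rewrite iterS IH sg1 opprK.
by exists (iter (size (u ++ oneE :: v)) (fun y => - sL y) a :: u'), v'; rewrite e /= su.
Qed.

Lemma minimal_model_ainf : ainf_algebra (Ext_deg P) minimal_model.
Proof.
split.
- exact: twist_multilin model_op_multilin.
- move=> ps xs xs0 hxs; rewrite (minimal_model_opE hxs).
  by apply: Ext_degZ; exact: model_op_deg.
- move=> ps xs xs0 hxs.
  have := stasheff_twist sgG model_op_multilin Ext_degZ model_op_deg model_op_multilin hxs.
  by rewrite (model_rel xs).2 scaler0; exact.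
exists oneE; split.
- exact: (Ext_bi_deg one_bi).
- exact: model_op1.
- move=> x; have tw a b : twist sL [:: a; b] = [:: - sL a; b] by [].
  rewrite /minimal_model !tw; split.
    by rewrite sg_one' opprK model_op_unitl.
  by rewrite model_op_unitr linearN opprK sgK'.
- move=> u v uv; rewrite /minimal_model; have [u' [v' [-> [su sv]]]] := twist_one u v.
  by apply: model_op_unit; rewrite su sv.
Qed.

Lemma val_scale (c : F) (f : B) x : val (c *: f) x = sc c (val f x).
Proof. by []. Qed.

Lemma tau_homog ps xs x : homogeneous (Ext_deg P) ps xs ->
  tauf (val (model_map xs)) x =
  sc (eps F (\sum_(p <- ps) (p + 1) + 1)) (val (model_map xs) x).
Proof.
move=> hxs; rewrite -[LHS]/(val (tL (model_map xs)) x) model_map_tau.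
rewrite (multilin_sg sgG model_map_multilin hxs).
rewrite -[LHS]/(- sc (eps F (\sum_(p <- ps) (p + 1))) (val (model_map xs) x)).
by rewrite epsD eps1 mulrN1 scaleNr scaleNr.
Qed.

Lemma fct_mulrz (U : Type) (W : zmodType) (f : U -> W) (z : int) x : (f *~ z) x = f x *~ z.
Proof.
have fM n (g : U -> W) : (g *+ n) x = g x *+ n.
  by elim: n => [|n IH] //; rewrite !mulrS -IH.
case: z => n; first exact: fM.
by rewrite -[LHS]/(- (f *+ n.+1) x) fM.
Qed.

Lemma DB_homog ps xs x : (0 < size xs)%N -> homogeneous (Ext_deg P) ps xs ->
  val (DL (model_map xs)) x =
  endo_d (\sum_(p <- ps) p + (1 - (size xs)%:Z)) (val (model_map xs)) x.
Proof.
move=> xs0 hxs; rewrite -[LHS]/(d (val (model_map xs) x) - val (tL (model_map xs)) (d x)).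
rewrite /endo_d; congr (_ - _).
rewrite model_map_tau (multilin_sg sgG model_map_multilin hxs).
rewrite -[LHS]/(- sc (eps F (\sum_(p <- ps) (p + 1))) (val (model_map xs) (d x))).
rewrite -sc_eps -algN1_opp algM; congr (_ *: _); congr (_ *: _).
rewrite -eps1 -epsD sum_succ (homogeneous_size hxs).
by apply: (@eps_eq _ _ _ (size xs)%:Z); ring.
Qed.

Lemma val_spl (G : seq E -> seq E -> B) xs x :
  val (spl G xs) x = spl (fun u v => val (G u v) x) xs.
Proof. by rewrite (raddf_spl (f := fun f : B => val f x)). Qed.

(** This is the first relation of [model_rel] after decalage, [stasheff_twist] giving the left-hand
    side. *)
Lemma minimal_model_lift_morphism ps xs : (0 < size xs)%N ->
  homogeneous (Ext_deg P) ps xs ->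
  let n := size xs in
  stasheff minimal_model_lift minimal_model ps xs =
  endo_d (\sum_(p <- ps) p + (1 - n%:Z)) (minimal_model_lift xs) +
  \sum_(1 <= i < n) (minimal_model_lift (take i xs) \o minimal_model_lift (drop i xs)) *~
        (-1) ^ (i%:Z - 1 + (1 - (n - i)%N%:Z) * \sum_(p <- take i ps) p).
Proof.
move=> xs0 hxs n.
have e1 : stasheff minimal_model_lift minimal_model ps xs =
    val (stasheff (fun ys => model_map (twist sL ys)) minimal_model ps xs).
  exact: (stasheff_map (val : {additive B -> (P -> P)})).
rewrite e1 (stasheff_twist sgG model_op_multilin Ext_degZ model_op_deg model_map_multilin hxs).
rewrite (model_rel xs).1 scalerDr addrC.
apply/funext => x.
rewrite -[LHS]/(val (eps F (wt ps) *: DL (model_map xs)) x + val (eps F (wt ps) *: model_prod xs) x).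
rewrite -[RHS]/(endo_d (\sum_(p <- ps) p + (1 - n%:Z)) (minimal_model_lift xs) x +
  (\sum_(1 <= i < n) (minimal_model_lift (take i xs) \o minimal_model_lift (drop i xs)) *~
        (-1) ^ (i%:Z - 1 + (1 - (n - i)%N%:Z) * \sum_(p <- take i ps) p)) x).
congr (_ + _).
  rewrite (minimal_model_liftE hxs).
  rewrite -[LHS]/(sc (eps F (wt ps)) (val (DL (model_map xs)) x)) (DB_homog x xs0 hxs).
  rewrite /endo_d -/n.
  rewrite !val_scale (linear_scalem d).
  by rewrite scalerBr; congr (_ - _); rewrite -!sc_eps !algM mulrC.
rewrite val_scale model_prodE val_spl spl_index.
pose T i := val (mul (tL (model_map (take i xs))) (model_map (drop i xs))) x.
rewrite -[X in _ *: X]/(\sum_(0 <= i < n.+1) T i).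
(* The two extreme splittings have an empty factor, on which the map vanishes; they are absent from
   the sum in the definition of a morphism. *)
have T0 : T 0%N = 0 by rewrite /T take0; exact: (linear0 par).
have Tn : T n = 0.
  rewrite /T drop_size -[LHS]/(tauf (val (model_map (take n xs))) 0) /tauf (linear0 par).
  by rewrite [X in par X](linear0 (toL (model_map (take n xs)))) (linear0 par).
rewrite big_nat_recr //= Tn addr0 big_ltn // T0 add0r scaler_sumr.
rewrite fct_sumE; apply: eq_big_nat => i /andP[i0 ltin].
have hu := homogeneous_take i hxs; have hv := homogeneous_drop i hxs.
rewrite fct_mulrz -sc_eps /= (minimal_model_liftE hu) (minimal_model_liftE hv) !val_scale.
rewrite -[T i]/(tauf (val (model_map (take i xs))) (val (model_map (drop i xs)) x)).
rewrite (tau_homog _ hu).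
have uZ c y : val (model_map (take i xs)) (sc c y) = sc c (val (model_map (take i xs)) y).
  exact: (linear_scalem (toL (model_map (take i xs)))).
rewrite uZ !algM -!epsD; congr (_ *: _); congr (_ *: _).
have sps := homogeneous_size hxs.
have -> : wt ps = (n - i)%N%:Z * (\sum_(p <- take i ps) p) + wt (take i ps) + wt (drop i ps).
  by rewrite -{1}[ps](cat_take_drop i) wt_cat size_drop sps.
have -> : \sum_(p <- take i ps) (p + 1) = \sum_(p <- take i ps) p + i%:Z.
  by rewrite sum_succ size_takel // sps ltnW.
apply: (@eps_eq _ _ _ ((n - i)%N%:Z * (\sum_(p <- take i ps) p) + 1)).
by ring.
Qed.

Lemma minimal_model_lift_spec : ainf_lift minimal_model minimal_model_lift.
Proof.
split.
- move=> c u v x y w; rewrite /minimal_model_lift.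
  by rewrite (twist_multilin sL model_map_multilin c u v x y).
- move=> bs xs xs0 hxs; rewrite (minimal_model_liftE (bi_homog_deg hxs)).
  by apply: endo_scal; exact: (model_endo xs0 hxs).1.
- exact: minimal_model_lift_morphism.
- move=> b x hx; apply/(representsP hmin); apply/funext => v.
  apply/esym; apply: (ev_ifun ev_e0 ev_s); exact: (rep_alin hmin).
Qed.

(** The Yoneda product in its classical form: the cocycle of the first factor composed with a lift
    of the second. *)
Lemma minimal_model2 x y : rep (minimal_model [:: x; y]) = rep x \o val (iL y).
Proof.
rewrite /minimal_model -[twist _ _]/[:: - sL x; y] model_op2 linearN sgK'.
rewrite linearN -[mul _ _]/(endo_mul _ _).
have -> : endo_mul (- iL x) (iL y) = (-1) *: endo_mul (iL x) (iL y).
  by apply: endo_alg_eq => v; rewrite val_scale algN1_opp.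
rewrite scaleN1r linearN opprK rep_pB; apply/funext => v.
by apply: (ev_ifun ev_e0 ev_s); exact: (rep_alin hmin).
Qed.

(** Since [eta] is a cycle, the homotopy identity shows that it differs from the chosen lift of y by
    a boundary of End_A(P). The cocycle of x annihilates such boundaries by minimality. *)
Lemma minimal_model_yoneda : is_yoneda minimal_model.
Proof.
move=> b c theta eta x y ht dt he de /(representsP hmin) rx /(representsP hmin) ry.
apply/(representsP hmin); rewrite minimal_model2; apply/funext => v.
pose eB : B := mk_endo (endos_endo he).
have hom := homotopyE sP ds ev_s (toL eB) v.
have De w : Df (toL eB) w = 0 by rewrite (Df_endo he) de.
have h0 : hfun s (Df (toL eB)) v = 0.
  apply: (@lin_eq2 _ _ P (hfun s (Df (toL eB))) (lin0 P)) => w Bw /= e.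
  by rewrite hfunE // De e (linear0 par) oppr0 addr0 (s0 sP).
rewrite h0 addr0 in hom.
have iyE : val (iL y) v = eta v + Df (hfun s (toL eB)) v.
  rewrite hom [eta v + _]addrC -[X in _ - X]/(eta v) subrK.
  by rewrite -[LHS]/(ifun e0 s (rep y) v) ry.
have ax := rep_alin hmin x.
rewrite -[LHS]/(rep x (val (iL y) v)) iyE (alinD ax).
rewrite [X in _ + X](_ : _ = 0) ?addr0; last first.
  rewrite /Df (alinD ax) (alinN _ ax) (alin_d hmin) // add0r.
  (* The second half of the boundary is an A-linear functional evaluated at [d v]. *)
  pose psi := (rep x \o par) \o (hfun s (toL eB) \o par).
  have apsi : alin psi.
    move=> a z w; rewrite /psi /= (linearP par) (linearP (hfun s (toL eB))) (linearP par).
    by rewrite ax.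
  by have := alin_d hmin v apsi; rewrite /psi /= => ->; rewrite oppr0.
by rewrite rx.
Qed.

Lemma minimal_model_ext : ainf_ext minimal_model.
Proof.
split.
- exact: minimal_model_ainf.
- exact: model_op1.
- exact: minimal_model_yoneda.
- move=> bs xs xs0 hxs; rewrite (minimal_model_opE (bi_homog_deg hxs)).
  by apply: Ext_biZ; exact: model_op_bi.
- by exists minimal_model_lift; exact: minimal_model_lift_spec.
Qed.

End ModelStructure.

(** * Generation of Ext *)

Section Coordinates.
Variables (F : fieldType) (A : graded_algebra F) (M : lmodType A).
Variables (G : int -> set M) (N : set M) (P : resolution G N).
Local Notation gr := (res_gr P).

Lemma coD (c : P) : {morph co P c : x y / x + y}.
Proof. by move=> x y; rewrite -[x]scale1r co_linear mul1r scale1r. Qed.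

Lemma coZ c a x : co P c (a *: x) = a * co P c x.
Proof. by rewrite -[a *: x]addr0 co_linear co0 addr0. Qed.

Lemma co_gr_ne n j x c : gr (n, j) x -> bas P c -> (deg c).1 != n -> co P c x = 0.
Proof.
move=> gx Bc ne; move: gx; apply: (gr_ind (T := [set x | co P c x = 0])) => /=.
- exact: co0.
- by move=> y z hy hz; rewrite coD hy hz addr0.
- move=> i a b j' _ Bb e _; rewrite coZ co_bas //.
  by case: eqP => [cb|_]; [rewrite cb e eqxx in ne|rewrite mulr0].
Qed.

Lemma gcomp0 i : gcomp i (0 : A).
Proof. by have [h _ _] := gcomp_grading A; exact: (h i).1. Qed.

Lemma gcompD i (a b : A) : gcomp i a -> gcomp i b -> gcomp i (a + b).
Proof.
have [h _ _] := gcomp_grading A; move=> ga gb; rewrite -[b]opprK.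
by apply: (h i).2 => //; rewrite -sub0r; apply: (h i).2 => //; exact: gcomp0.
Qed.

Lemma co_gr n j x c i : gr (n, j) x -> bas P c -> i%:Z + (deg c).2 = j -> gcomp i (co P c x).
Proof.
move=> gx Bc e; move: gx; apply: (gr_ind (T := [set x | gcomp i (co P c x)])) => /=.
- by rewrite co0; exact: gcomp0.
- by move=> y z hy hz; rewrite coD; exact: gcompD.
- move=> i' a b j' ga Bb eb e'; rewrite coZ co_bas //.
  case: eqP => [cb|_]; last by rewrite mulr0; exact: gcomp0.
  rewrite mulr1; suff <- : i' = i by [].
  by move: e e'; rewrite cb eb /=; lia.
Qed.

Lemma co_inj x : (forall c, bas P c -> co P c x = 0) -> x = 0.
Proof.
move=> h; have [r [_ rB _ ->]] := co_sum x.
by rewrite big_seq big1 // => b /rB Bb; rewrite h // scale0r.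
Qed.

End Coordinates.

Section DualBasis.
Variables (F : fieldType) (A : graded_algebra F) (P : triv_resolution A).
Local Notation gr := (res_gr P).

Definition dual_bas (c : P) : P -> F^o := fun x => aug (co P c x).

Lemma dual_bas_alin c : alin (dual_bas c).
Proof. by move=> a x y; rewrite /dual_bas co_linear rmorphD rmorphM. Qed.

Lemma dual_bas_cochain c : bas P c -> cochain_at P (deg c) (dual_bas c).
Proof.
move=> Bc; split; first exact: dual_bas_alin.
move=> [n j] x; case E: (deg c) => [n' j'] ne gx.
move: gx; apply: (gr_ind (T := [set x | dual_bas c x = 0])) => /=.
- by rewrite /dual_bas co0 rmorph0.
- by move=> y z hy hz; rewrite (alinD (dual_bas_alin c)) hy hz addr0.
move=> i a b k ga Bb e e'; rewrite (alinZ _ _ (dual_bas_alin c)) /dual_bas co_bas //.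
case: eqP => [cb|_]; last by rewrite rmorph0 mulr0.
rewrite rmorph1 mulr1; apply: (aug_pos _ ga); rewrite lt0n.
apply: contra ne => /eqP i0; move: e'; rewrite i0 add0r => <-.
by rewrite -e -cb E.
Qed.

End DualBasis.

(** * Nondegeneracy of the transferred operations *)

Section Nondegenerate.
Variables (F : fieldType) (A : graded_algebra F) (P : triv_resolution A).
Hypothesis hmin : minimal P.
Local Notation gr := (res_gr P).
Local Notation d := (res_d P).
Local Notation par := (par P).
Local Notation sc c x := (((c : F)%:A : A) *: x).
Local Notation ev := (@ev F A P).
Variables (e0 : P) (s : P -> P).
Hypothesis ge0 : gr (0, 0) e0.
Hypothesis ev_e0 : ev e0 = 1.
Hypothesis bas_deg0 : forall b, bas P b -> (deg b).1 = 0 -> b = sc (ev b) e0.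
Hypothesis sP : forall (c : F) x y, s (sc c x + y) = sc c (s x) + s y.
Hypothesis s_gr : forall n j x, gr (n, j) x -> gr (n + 1, j) (s x).
Hypothesis ds : forall x, d (s x) + s (d x) = x - sc (ev x) e0.
Hypothesis ss : forall x, s (s x) = 0.
Hypothesis s_e0 : s e0 = 0.
Hypothesis ev_s : forall x, ev (s x) = 0.
Hypothesis s_gen : forall x, generators x -> s x = 0.

Local Notation E := (Ext P).
Local Notation rep := (@rep F A P).
Local Notation mp := (model_map hmin ge0 sP s_gr).
Local Notation pd := (model_prod hmin ge0 sP s_gr).
Local Notation iL := (iL hmin ge0 sP s_gr).

Lemma e0_free a : a *: e0 = 0 -> a = 0.
Proof.
have [b [Bb gb eb]] := ev_bas P; move=> ae.
have db : (deg b).1 = 0 by rewrite (deg_uniq Bb gb).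
have : a *: b = 0 by rewrite (bas_deg0 Bb db) alg_scaleC ae scaler0.
by move=> /(congr1 (co P b)); rewrite coZ co_bas // eqxx mulr1 co0.
Qed.

Lemma gr_neg n j x : gr (n, j) x -> n < 0 -> x = 0.
Proof. by move=> h n0; exact: gr_neg0 n0 h. Qed.

(** The contraction recovers such a cycle as [d (s x)]. *)
Lemma s_neq0 n j x : gr (n, j) x -> d x = 0 -> ev x = 0 -> x != 0 -> s x != 0.
Proof.
move=> gx dx ex; apply: contra => /eqP sx; have := ds x.
by rewrite sx dx ex linear0 (s0 sP) addr0 alg0 subr0 => <-.
Qed.

(** In homological degree 0 the formula d s + s d = 1 - ev e0, applied to [s x], leaves nothing,
    because s s = 0, ev s = 0 and d vanishes there. *)
Lemma s_deg0 j x : gr (0, j) (s x) -> s x = 0.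
Proof.
move=> g; have := ds (s x); rewrite ss linear0 add0r (d_gr0 g) (s0 sP) ev_s alg0 subr0.
by move=> <-.
Qed.

Lemma gen_ind (T : set P) : T 0 -> (forall x y, T x -> T y -> T (x + y)) ->
  (forall c x, T x -> T (sc c x)) -> bas P `<=` T -> forall x, generators x -> T x.
Proof.
move=> T0 TD TZ TB x gx; have [r [_ rB _ ->]] := co_sum x.
rewrite big_seq; elim/big_ind: _ => // b /rB Bb; rewrite gx.
by apply: TZ; exact: TB.
Qed.

Lemma ifunE_gen phi x : alin phi -> generators x ->
  ifun e0 s phi x = sc (phi x) e0 + s (par (ifun e0 s phi (par (d x)))).
Proof.
move=> h; move: x; apply: gen_ind => /=.
- by rewrite (alin0 h) alg0 !linear0 (s0 sP) addr0.
- by move=> x y hx hy; rewrite !linearD (alinD h) algD (sD sP) addrACA /= hx hy.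
- move=> c x hx; rewrite (linear_scalem (ifun e0 s phi)) hx scalerDr (alinZ _ _ h) aug_alg algM.
  congr (_ + _); rewrite (linear_scalem d) (linear_scalem par) (linear_scalem (ifun e0 s phi)).
  by rewrite (linear_scalem par) (sZ sP).
- by move=> b Bb; exact: ifunE.
Qed.

Lemma hfunE_gen (g : {linear P -> P}) x : generators x ->
  hfun s g x = s (- g x + par (hfun s g (par (d x)))).
Proof.
move: x; apply: gen_ind => /=.
- by rewrite (linear0 (hfun s g)) (linear0 g) (linear0 d) !(linear0 par, linear0 (hfun s g)) oppr0 addr0 (s0 sP).
- move=> x y hx hy; rewrite (linear_addm (hfun s g)) hx hy (linear_addm g) (linear_addm d) -(sD sP).
  by rewrite (linear_addm par) (linear_addm (hfun s g)) (linear_addm par) opprD addrACA.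
- move=> c x hx; rewrite (linear_scalem (hfun s g)) hx -(sZ sP) scalerDr scalerN; congr (s (_ + _)).
    by rewrite (linear_scalem g).
  rewrite (linear_scalem d) (linear_scalem par) (linear_scalem (hfun s g)).
  by rewrite (linear_scalem par).
- by move=> b Bb; exact: hfunE.
Qed.

(** In the homological degree of c itself the correction term of [ifunE] comes from degree -1 and
    vanishes. *)
Lemma iL_dual c y n j w : bas P c -> (deg c).1 = n -> rep y = dual_bas c -> gr (n, j) w ->
  val (iL y) w = co P c w *: e0.
Proof.
move=> Bc dc ry.
have eyd : endo (deg c) (ifun e0 s (rep y)).
  by apply: (ifun_endo ge0 s_gr); rewrite ry; exact: dual_bas_cochain.
apply: (gr_ind (T := [set w | val (iL y) w = co P c w *: e0])) => /=.
- by rewrite co0 scale0r linear0.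
- by move=> x z hx hz; rewrite linearD coD scalerDl /= hx hz.
move=> i a b k ga Bb e _; rewrite linearZ coZ -scalerA /=; congr (_ *: _).
rewrite ifunE // ry co_bas // [X in s X](_ : _ = 0) ?(s0 sP) ?addr0.
  by rewrite /dual_bas co_bas //; case: (_ == _); rewrite ?rmorph1 ?rmorph0 ?alg1 ?alg0 ?scale1r ?scale0r.
rewrite par_dbas // linearZ /= -ry.
rewrite (gr_neg (endo_gr eyd (d_bas Bb))) ?scaler0 ?linear0 //.
by rewrite e dc /= addrAC subrr add0r oppr_lt0.
Qed.

(** The values on basis elements are of the form s y and lie in homological degree 0, so [s_deg0]
    applies. *)
Lemma hfun_deg0 b (g : P -> P) j w : endo b (hfun s g) -> gr (b.1, j) w -> hfun s g w = 0.
Proof.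
move=> eh; apply: (gr_ind (T := [set w | hfun s g w = 0])) => /=.
- by rewrite linear0.
- by move=> x z hx hz; rewrite linearD /= hx hz addr0.
move=> i a c k ga Bc e _; rewrite linearZ /=.
have gc : gr (b.1, k) c by rewrite -e; exact: deg_bas.
have := endo_gr eh gc.
by rewrite subrr hfunE // => /s_deg0 ->; rewrite scaler0.
Qed.

Local Notation ones l := (nseq l (1, 1) : seq (int * int)%type).

Lemma sum_ones l : \sum_(b <- ones l) b = (l%:Z, l%:Z) :> (int * int)%type.
Proof.
elim: l => [|l IH]; first by rewrite big_nil.
by rewrite big_cons IH; apply: pair_ext => /=; lia.
Qed.

Lemma hom_ones_take k xis : homogeneous (Ext_bi P) (ones (size xis)) xis ->
  (k <= size xis)%N -> homogeneous (Ext_bi P) (ones k) (take k xis).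
Proof.
move=> /(homogeneous_take k) + le; congr homogeneous.
exact: take_nseq.
Qed.

Lemma hom_ones_drop k xis : homogeneous (Ext_bi P) (ones (size xis)) xis ->
  (k <= size xis)%N -> homogeneous (Ext_bi P) (ones (size (drop k xis))) (drop k xis).
Proof.
move=> /(homogeneous_drop k) + le; congr homogeneous.
by rewrite drop_nseq size_drop.
Qed.

Lemma mp_ones xis : homogeneous (Ext_bi P) (ones (size xis)) xis -> (0 < size xis)%N ->
  endo (1, (size xis)%:Z) (val (mp xis)).
Proof.
move=> h xis0; have [+ _] := model_endo hmin ge0 sP s_gr xis0 h.
rewrite sum_ones; move: (size xis) => n.
have -> : (n%:Z, n%:Z) + (1 - n%:Z, 0) = (1, n%:Z) :> (int * int)%type.
  by apply: pair_ext => /=; ring.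
by [].
Qed.

Lemma hom_word xis y q j0 : homogeneous (Ext_bi P) (ones (size xis)) xis ->
  Ext_bi P (q, j0) y ->
  homogeneous (Ext_bi P) (ones (size xis) ++ [:: (q, j0)]) (xis ++ [:: y]).
Proof.
by move=> h hy; apply: homogeneous_cat => //; apply/homogeneous_cons.
Qed.

Lemma sum_word l (q j0 : int) :
  \sum_(b <- ones l ++ [:: (q, j0)]) b = (l%:Z + q, l%:Z + j0) :> (int * int)%type.
Proof. by rewrite big_cat sum_ones big_seq1. Qed.

Lemma mp_word xis y q j0 : homogeneous (Ext_bi P) (ones (size xis)) xis ->
  Ext_bi P (q, j0) y ->
  endo (q, (size xis)%:Z + j0) (val (mp (xis ++ [:: y]))).
Proof.
move=> h hy; have w0 : (0 < size (xis ++ [:: y]))%N by rewrite size_cat addn1.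
have [+ _] := model_endo hmin ge0 sP s_gr w0 (hom_word h hy).
rewrite sum_word size_cat; move: (size xis) => n.
have -> : (n%:Z + q, n%:Z + j0) + (1 - (n + size [:: y])%N%:Z, 0) = (q, n%:Z + j0) :> (int * int)%type.
  by rewrite PoszD; apply: pair_ext => /=; ring.
by [].
Qed.

(** Only the splitting after the first letter counts. A longer prefix consists of letters of E^1, so
    its value is an [hfun] of cohomological degree 1, and it is evaluated on an element of
    homological degree 1, where [hfun_deg0] kills it. *)
Lemma prod_word xi xis y q j0 j x : Ext_bi P (1, 1) xi ->
  homogeneous (Ext_bi P) (ones (size xis)) xis -> Ext_bi P (q, j0) y ->
  gr (q + 1, j) x ->
  val (pd (xi :: xis ++ [:: y])) x = - val (iL xi) (val (mp (xis ++ [:: y])) x).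
Proof.
move=> hxi h hy gx; rewrite model_prodE val_spl spl_cons.
rewrite [X in X + _](_ : _ = 0) ?add0r; last exact: (linear0 par).
case E: (xis ++ [:: y]) => [|z zs]; first by case: (xis) E.
rewrite spl_cons -E.
have e1 : val (endo_mul (tL P (mp [:: xi])) (mp (xis ++ [:: y]))) x =
    - val (iL xi) (val (mp (xis ++ [:: y])) x).
  have hi : endo (1, 1) (val (iL xi)).
    by apply: (ifun_endo ge0 s_gr); exact/(Ext_bi_rep hmin).
  rewrite -[LHS]/(tauf (val (iL xi)) (val (mp (xis ++ [:: y])) x)).
  by rewrite (tauf_endo hi) eps1 algN1_opp.
rewrite e1 -[RHS]addr0; congr (_ + _).
rewrite -[RHS](spl0 _ zs); apply: eq_spl => u v euv.
rewrite -[LHS]/(tauf (val (mp [:: xi, z & u])) (val (mp v) x)).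
have t0 (f : endo_alg P) : tauf (val f) 0 = 0.
  rewrite /tauf (linear0 par).
  by rewrite [X in par X](linear0 (toL f)) (linear0 par).
have [->|v0] := eqVneq v [::]; first exact: t0.
have ew : (z :: u) ++ v = xis ++ [:: y] by rewrite E -euv.
have le : (size (z :: u) <= size xis)%N.
  have := congr1 size ew; rewrite !size_cat /=.
  by move: v0; case: (v) => //= a b _; lia.
have uE : z :: u = take (size (z :: u)) xis.
  have := congr1 (take (size (z :: u))) ew; rewrite take_size_cat // => {1}->.
  by rewrite takel_cat.
have vE : v = drop (size (z :: u)) xis ++ [:: y].
  have := congr1 (drop (size (z :: u))) ew; rewrite drop_size_cat // => ->.
  rewrite drop_cat; case: ltnP => // ge.
  have -> : size (z :: u) = size xis by apply/eqP; rewrite eqn_leq le ge.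
  by rewrite subnn drop0 drop_size.
have hu : homogeneous (Ext_bi P) (ones (size (xi :: z :: u))) (xi :: z :: u).
  apply/homogeneous_cons; split=> //.
  by have := hom_ones_take h le; rewrite -uE.
have eu := mp_ones hu isT; rewrite model_mapE in eu *.
have gv : gr (1, j - ((size (drop (size (z :: u)) xis))%:Z + j0)) (val (mp v) x).
  have := mp_word (hom_ones_drop h le) hy; rewrite -vE => /endo_gr /(_ gx) /=.
  by rewrite addrAC subrr add0r.
have hv := @hfun_deg0 (1, (size [:: xi, z & u])%:Z) (val (pd [:: xi, z & u])) _ _ eu gv.
rewrite /tauf (par_gr gv).
rewrite -[X in par X]/(hfun s (val (pd [:: xi, z & u])) (sc (eps F 1) (val (mp v) x))).
by rewrite (linear_scalem (hfun s _)) hv scaler0 linear0.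
Qed.

Lemma sc_eps_neq0 z (x : P) : x != 0 -> sc (eps F z) x != 0.
Proof.
apply: contra => /eqP e; have : sc (eps F z) (sc (eps F z) x) = x by rewrite algM eps_sqr alg1.
by rewrite e scaler0 => ->.
Qed.

Lemma co_neq0 n j x : gr (n, j) x -> x != 0 ->
  exists c, [/\ bas P c, (deg c).1 = n & co P c x != 0].
Proof.
move=> gx x0; apply: contrapT => h; move/negP: x0; apply; apply/eqP/co_inj => c Bc.
apply: contrapT => /eqP c0; apply: h; exists c; split=> //.
by apply/eqP; apply: contraNT c0 => ne; rewrite (co_gr_ne gx Bc ne).
Qed.

Lemma s_e0_neq0 i a : (0 < i)%N -> gcomp i a -> a != 0 -> s (a *: e0) != 0.
Proof.
move=> i0 ga a0; apply: (s_neq0 (res_gr_scale ga ge0)).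
- by rewrite linearZ /= (d_e0 ge0) scaler0.
- by rewrite evZ (aug_pos i0 ga) mul0r.
- by apply: contra a0 => /eqP /e0_free ->.
Qed.

(** The word is built from its last letter y, dual to a basis element with a nonzero coordinate a in
    [d x], of degree r. The value at x is then s (a e0) in P_1, up to sign. Each letter of E^1 in
    front replaces a by a nonzero coordinate of the current element of P_1, of degree one less;
    after r letters a nonzero scalar is left. *)
Lemma model_nondegenerate (q j0 : int) (r : nat) x : (0 < r)%N -> 0 <= q ->
  (forall b, bas P b -> (deg b).1 = 1 -> (deg b).2 = 1) ->
  (forall b, bas P b -> (deg b).1 = q -> (deg b).2 = j0) ->
  generators x -> gr (q + 1, r%:Z + j0) x -> x != 0 ->
  exists xis y, [/\ size xis = r, homogeneous (Ext_bi P) (ones r) xis, Ext_bi P (q, j0) y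
    & rep (model_op hmin ge0 sP s_gr (xis ++ [:: y])) x != 0].
Proof.
move=> r0 q0 h1 hq genx gx x0.
have gdx : gr (q, r%:Z + j0) (d x) by have := res_d_gr gx; rewrite addrK.
have dx0 : d x != 0.
  apply: contra x0 => /eqP dx; apply/eqP; apply: generators_cycle => //.
  by apply: ev_gr gx; rewrite xpair_eqE negb_and; apply/orP; left; lia.
have [c [Bc dc1 c0]] := co_neq0 gdx dx0.
have dc2 := hq _ Bc dc1.
have dcE : deg c = (q, j0) by rewrite [deg c]surjective_pairing dc1 dc2.
have [y ry] := rep_surj hmin (cochain_at_cochain (dual_bas_cochain Bc)).
have hy : Ext_bi P (q, j0) y.
  by apply/(Ext_bi_rep hmin); rewrite ry -dcE; exact: dual_bas_cochain.
have ga : gcomp r (co P c (d x)) by apply: (co_gr gdx Bc); rewrite dc2.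
have pdx : par (d x) = sc (eps F q) (d x) by exact: par_gr gdx.
(* The coordinate of [d x] at c has degree r > 0, so its multiple of [e0] is a cycle of augmentation
   0, on which s is injective. *)
have T0 : val (iL y) x != 0.
  have -> : val (iL y) x = sc (eps F q) (s (co P c (d x) *: e0)).
    rewrite -[LHS]/(ifun e0 s (rep y) x) ifunE_gen //; last exact: rep_alin.
    rewrite {1}ry [dual_bas c x](_ : _ = 0); last first.
      rewrite /dual_bas (co_gr_ne gx Bc) ?rmorph0 //; apply/eqP; rewrite dc1; lia.
    rewrite alg0 add0r pdx (linear_scalem (ifun e0 s (rep y))).
    rewrite -[ifun e0 s (rep y) (d x)]/(val (iL y) (d x)) (iL_dual Bc dc1 ry gdx).
    by rewrite (linear_scalem par) (par_gr (res_gr_scale ga ge0)) alg1 (sZ sP).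
  by apply: sc_eps_neq0; apply: s_e0_neq0 ga c0.
have gw xis : homogeneous (Ext_bi P) (ones (size xis)) xis -> (size xis <= r)%N ->
    gr (1, (r - size xis)%N%:Z) (val (mp (xis ++ [:: y])) x).
  move=> hxis le; have := endo_gr (mp_word hxis hy) gx => /=.
  have -> : q + 1 - q = 1 by ring.
  by have -> : r%:Z + j0 - ((size xis)%:Z + j0) = (r - size xis)%N%:Z by lia.
(* The new letter is dual to a basis element v of P_1 at which the current element has a nonzero
   coordinate. As P_1 is generated in degree 1, that coordinate has degree one less. *)
have step xis : homogeneous (Ext_bi P) (ones (size xis)) xis -> (size xis < r)%N ->
    val (mp (xis ++ [:: y])) x != 0 ->
    exists xi a, [/\ Ext_bi P (1, 1) xi, gcomp (r - size xis).-1 a, a != 0 &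
      val (pd (xi :: xis ++ [:: y])) x = - (a *: e0)].
  move=> hxis lt w0; have gw' := gw _ hxis (ltnW lt).
  have [v [Bv dv1 v0]] := co_neq0 gw' w0.
  have dv2 := h1 _ Bv dv1.
  have [xi rxi] := rep_surj hmin (cochain_at_cochain (dual_bas_cochain Bv)).
  have hxi : Ext_bi P (1, 1) xi.
    apply/(Ext_bi_rep hmin); rewrite rxi.
    by have := dual_bas_cochain Bv; rewrite [deg v]surjective_pairing dv1 dv2.
  exists xi, (co P v (val (mp (xis ++ [:: y])) x)); split=> //.
    by apply: (co_gr gw' Bv); rewrite dv2; lia.
  by rewrite (prod_word hxi hxis hy gx) (iL_dual Bv dv1 rxi gw').
have iter l : (l < r)%N -> exists xis, [/\ size xis = l,
    homogeneous (Ext_bi P) (ones (size xis)) xis & val (mp (xis ++ [:: y])) x != 0].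
  elim: l => [|l IH] lt; first by exists [::]; split.
  have [xis [sx hxis w0]] := IH (ltnW lt).
  have ltx : (size xis < r)%N by rewrite sx ltnW.
  have [xi [a [hxi ga' a0 pdE]]] := step _ hxis ltx w0.
  have hxx : homogeneous (Ext_bi P) (ones (size (xi :: xis))) (xi :: xis).
    exact/homogeneous_cons.
  exists (xi :: xis); split; [by rewrite /= sx|exact: hxx|].
  have eh := mp_word hxx hy.
  have mE : mp (xi :: xis ++ [:: y]) = hL sP s_gr (pd (xi :: xis ++ [:: y])).
    by case: (xis) => [|z zs]; exact: model_mapE.
  rewrite -[(xi :: xis) ++ _]/(xi :: xis ++ [:: y]) in eh *.
  rewrite mE in eh *; set g := pd _ in eh pdE *.
  rewrite -[val _ x]/(hfun s (toL g) x) hfunE_gen //.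
  have h0 := @hfun_deg0 (q, (size (xi :: xis))%:Z + j0) (val g) _ _ eh gdx.
  rewrite pdx (linear_scalem (hfun s (toL g))) [hfun s (toL g) (d x)]h0 scaler0 linear0 addr0.
  rewrite -[toL g x]/(val g x) pdE opprK; apply: s_e0_neq0 ga' a0.
  by rewrite sx; lia.
(* One letter is held back: its product is read off by the projection to Ext and not fed to the
   homotopy again. *)
have [xis [sx hxis w0]] := iter r.-1 (ltac:(by rewrite prednK)).
have ltx : (size xis < r)%N by rewrite sx prednK.
have [xi [a [hxi ga' a0 pdE]]] := step _ hxis ltx w0.
exists (xi :: xis), y; split=> //.
- by rewrite /= sx prednK.
- have -> : r = size (xi :: xis) by rewrite /= sx prednK.
  exact/homogeneous_cons.
rewrite -[(xi :: xis) ++ _]/(xi :: xis ++ [:: y]) model_opE -[pL _ _]/(pB hmin _) rep_pB.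
rewrite -[X in X != 0]/(ev (val (pd (xi :: xis ++ [:: y])) x)) pdE evN evZ ev_e0 mulr1 oppr_eq0.
have g0 : gcomp 0%N a by move: ga'; rewrite sx; have -> : (r - r.-1).-1 = 0%N by lia.
by apply: contra a0 => /eqP ea; rewrite (gcomp0_alg g0) ea scale0r.
Qed.

End Nondegenerate.

(** A largest independent family in W spans W, and the columns of its cokernel annihilate W; hence
    the cokernel is 0. *)
Lemma subspace_eq_full (F : fieldType) (q : nat) (W : set 'rV[F]_q) :
  W 0 -> (forall c u v, W u -> W v -> W (c *: u + v)) ->
  (forall v : 'cV[F]_q, (forall w, W w -> w *m v = 0) -> v = 0) -> forall w, W w.
Proof.
move=> W0 WP Wperp.
pose Q k := `[< exists M : 'M[F]_(k, q), row_free M /\ forall i, W (row i M) >].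
have Q0 : exists k, Q k.
  by exists 0%N; apply/asboolP; exists (0 : 'M_(0, q)); split=> [|[]//]; rewrite /row_free mxrank0.
have Qle k : Q k -> (k <= q)%N.
  by move=> /asboolP[M [/eqP e _]]; rewrite -[X in (X <= _)%N]e; exact: rank_leq_col.
case: (ex_maxnP Q0 Qle) => k /asboolP[M [Mfree MW]] kmax.
have WM (D : 'rV_k) : W (D *m M).
  rewrite mulmx_sum_row; elim/big_ind: _ => // [u v|i _].
    by move=> hu hv; rewrite -[u]scale1r; exact: WP.
  by rewrite -[_ *: _]addr0; apply: WP.
have sub w : W w -> (w <= M)%MS.
  move=> Ww; apply: contrapT => /negP nw.
  suff /kmax : Q k.+1 by rewrite ltnn.
  apply/asboolP; rewrite -addn1; exists (col_mx M w); split; last first.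
    move=> i; rewrite -(splitK i); case: (fintype.split i) => j /=.
      by rewrite rowKu.
    by rewrite rowKd row_id.
  have lt : (\rank M < \rank (M + w)%MS)%N.
    apply: rank_ltmx; rewrite /ltmx addsmxSl /=.
    by apply: contra nw; rewrite addsmx_sub => /andP[].
  rewrite (eqP Mfree) addsmxE in lt.
  by rewrite /row_free eqn_leq rank_leq_row /= [X in (X <= _)%N]addn1.
have full : row_full M.
  rewrite -sub1mx; apply/rV_subP => u _.
  have : cokermx M = 0.
    apply/matrixP => i j; have := Wperp (col j (cokermx M)).
    move=> h; have /h/matrixP/(_ i 0) : forall w, W w -> w *m col j (cokermx M) = 0.
      move=> w /sub /submxP[D ->].
      by rewrite -mulmxA colE [M *m _]mulmxA mulmx_coker mul0mx mulmx0.
    by rewrite !mxE.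
  by rewrite submxE => ->; rewrite mulmx0.
by move=> w; have /submxP[D ->] := submx_full w full; exact: WM.
Qed.

(** * Finiteness of the basis and duality *)

Section FiniteBasis.
Variables (F : fieldType) (A : graded_algebra F) (V : lmodType A).
Local Notation sc c x := (((c : F)%:A : A) *: x).

Definition spanF (us : seq V) : set V :=
  [set x | exists c : 'I_(size us) -> F, x = \sum_i sc (c i) us`_i].

Lemma spanFP us (c : F) x y : spanF us x -> spanF us y -> spanF us (sc c x + y).
Proof.
move=> [a ->] [b ->]; exists (fun i => c * a i + b i).
by rewrite scaler_sumr -big_split; apply: eq_bigr => i _; rewrite algD algM.
Qed.

Lemma spanF0 us : spanF us 0.
Proof. by exists (fun=> 0); rewrite big1 // => i _; rewrite alg0. Qed.

Lemma spanFZ us (c : F) x : spanF us x -> spanF us (sc c x).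
Proof. by move=> h; rewrite -[sc c x]addr0; apply: spanFP => //; exact: spanF0. Qed.

Lemma spanFD us x y : spanF us x -> spanF us y -> spanF us (x + y).
Proof. by rewrite -{2}[x]alg1; exact: spanFP. Qed.

Lemma spanF_in us x : x \in us -> spanF us x.
Proof.
move=> xus; have lt : (index x us < size us)%N by rewrite index_mem.
exists (fun i => (i == Ordinal lt)%:R).
rewrite (bigD1 (Ordinal lt)) //= eqxx alg1 nth_index // big1 ?addr0 // => i /negPf ->.
by rewrite alg0.
Qed.

Lemma spanF_dep us (q : nat) (x : 'I_q -> V) : (size us < q)%N ->
  (forall i, spanF us (x i)) ->
  exists c : 'I_q -> F, (exists i, c i != 0) /\ \sum_i sc (c i) (x i) = 0.
Proof.
move=> lt hx; pose M := \matrix_(i < q, k < size us) (projT1 (cid (hx i))) k.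
have xE i : x i = \sum_k sc (M i k) us`_k.
  rewrite {1}(projT2 (cid (hx i))); apply: eq_bigr => k _.
  by rewrite mxE.
have : kermx M != 0.
  rewrite -mxrank_eq0 mxrank_ker subn_eq0 -ltnNge.
  exact: leq_ltn_trans (rank_leq_col M) lt.
move=> nz; have [i0 [j0 {}nz]] : exists i j, kermx M i j != 0.
  apply: contrapT => h; move/negP: nz; apply; apply/eqP/matrixP => i j.
  by rewrite [RHS]mxE; apply: contrapT => /eqP n0; apply: h; exists i, j.
exists (fun j => kermx M i0 j); split; first by exists j0.
have kM : kermx M *m M = 0 by exact: mulmx_ker.
under eq_bigr => j _ do rewrite xE scaler_sumr.
rewrite exchange_big big1 //= => k _.
under eq_bigr => j _ do rewrite algM.
have := congr1 (fun B : 'M_(q, size us) => B i0 k) kM; rewrite !mxE => e.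
have sumE (r : seq 'I_q) (f : 'I_q -> F) (v : V) : \sum_(j <- r) sc (f j) v = sc (\sum_(j <- r) f j) v.
  elim: r => [|j r IH]; first by rewrite !big_nil alg0.
  by rewrite !big_cons IH algD.
by rewrite sumE e alg0.
Qed.

Lemma bounded_finite (T : eqType) (S0 : set T) (q : nat) :
  (forall r : seq T, uniq r -> (forall b, b \in r -> S0 b) -> (size r <= q)%N) ->
  exists r : seq T, [/\ uniq r, forall b, b \in r -> S0 b & forall b, S0 b -> b \in r].
Proof.
move=> h; pose Q k := `[< exists r : seq T, [/\ uniq r, forall b, b \in r -> S0 b & size r = k] >].
have Q0 : exists k, Q k by exists 0%N; apply/asboolP; exists [::].
have Qle k : Q k -> (k <= q)%N by move=> /asboolP[r [ur rS <-]]; exact: h.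
case: (ex_maxnP Q0 Qle) => k /asboolP[r [ur rS sr]] kmax.
exists r; split=> // b Sb; apply: contrapT => /negP nb.
suff /kmax : Q k.+1 by rewrite ltnn.
apply/asboolP; exists (b :: r); split; rewrite /= ?nb ?sr // => b'.
by rewrite inE => /orP[/eqP ->|/rS].
Qed.

End FiniteBasis.

Section FiniteResolution.
Variables (F : fieldType) (A : graded_algebra F) (P : triv_resolution A).
Hypothesis hmin : minimal P.
Local Notation gr := (res_gr P).
Local Notation d := (res_d P).
Local Notation sc c x := (((c : F)%:A : A) *: x).
Local Notation ev := (@ev F A P).

Lemma alg_inj0 (c : F) : (c%:A : A) = 0 -> c = 0.
Proof. by move=> /eqP; rewrite scaler_eq0 oner_eq0 orbF => /eqP. Qed.

Lemma generators_sum (I : finType) (c : I -> F) (b : I -> P) :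
  (forall i, bas P (b i)) -> generators (\sum_i sc (c i) (b i)).
Proof.
have gen0 : generators (0 : P) by move=> b'; rewrite co0 rmorph0 scale0r.
move=> hb; elim/big_ind: _ => // [u v hu hv|i _].
  by rewrite -[u]alg1; exact: generatorsP.
by rewrite -[sc _ _]addr0; apply: generatorsP => //; exact: generators_bas.
Qed.

(** L is injective on the F-span of S0 and maps S0 into a space spanned by [us], so independent
    families in S0 have at most [size us] elements. *)
Lemma finite_basis_set (S0 : set P) (L : {linear P -> P}) us : S0 `<=` bas P ->
  (forall b, S0 b -> spanF us (L b)) ->
  (forall q (c : 'I_q -> F) (b : 'I_q -> P), (forall i, S0 (b i)) ->
     L (\sum_i sc (c i) (b i)) = 0 -> \sum_i sc (c i) (b i) = 0) ->
  exists r : seq P, [/\ uniq r, forall b, b \in r -> S0 b & forall b, S0 b -> b \in r].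
Proof.
move=> SB Lus Linj; apply: (@bounded_finite _ _ (size us)) => r ur rS.
rewrite leqNgt; apply/negP => lt.
pose b (i : 'I_(size r)) := tnth (in_tuple r) i.
have bS i : S0 (b i) by apply: rS; exact: mem_tnth.
have [c [[i0 ci0] e]] := spanF_dep lt (fun i => Lus _ (bS i)).
have binj : injective b.
  move=> i j /eqP; rewrite /b !(tnth_nth 0) nth_uniq // => /eqP.
  exact: ord_inj.
have e' : L (\sum_i sc (c i) (b i)) = 0.
  by rewrite linear_sum -[RHS]e; apply: eq_bigr => i _; rewrite linearZ.
have := bas_free binj (fun i => SB _ (bS i)) (Linj _ _ _ bS e') i0.
by move=> /alg_inj0 /eqP; rewrite (negPf ci0).
Qed.

Lemma gr_finite n (s : seq P) : (forall b, bas P b -> (deg b).1 = n -> b \in s) ->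
  forall j, exists us, forall x, gr (n, j) x -> spanF us x.
Proof.
move=> hs j; pose sA i := projT1 (cid (gcomp_locally_finite A i)).
have sAP i : gcomp i `<=` lspan [set` sA i] by rewrite /sA; case: cid.
pose us := [seq (a : A) *: b | b <- s, a <- sA `|j - (deg b).2|%N].
exists us => x; apply: gr_ind; [exact: spanF0|by move=> y z; exact: spanFD|].
move=> i a b j' ga Bb e e'.
have : lspan [set` sA i] a by exact: sAP.
have h : lspan [set` sA i] `<=` [set a | spanF us (a *: b)].
  apply: lspan_min => /=.
  - by rewrite scale0r; exact: spanF0.
  - by move=> u v hu hv; rewrite scalerDl; exact: spanFD.
  - by move=> k v hv; rewrite -mulr_algl -scalerA; exact: spanFZ.
  - move=> a' a's; apply: spanF_in; apply/allpairsPdep; exists b, a'; split=> //.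
      by apply: hs => //; rewrite e.
    have -> : `|j - (deg b).2|%N = i by rewrite e /=; lia.
    by [].
exact: h.
Qed.

Variable Ds : nat -> seq int.
Hypothesis hD : forall n b, bas P b -> (deg b).1 = n%:Z -> (deg b).2 \in Ds n.

(** By [generators_cycle] the differential is injective on the span of the generators of bidegree (n
    + 1, j), and its image lies in the finite-dimensional degree j part of P_n. Only the finitely
    many j in [Ds] occur. *)
Lemma finite_basis n : exists s : seq P,
  forall b, bas P b -> (deg b).1 = n%:Z -> b \in s.
Proof.
have [e0 [s [[_ _ hb0] _ _ _ _]]] := contraction_exists hmin.
elim: n => [|n [sn hsn]].
  have [|||r [_ _ hr]] := @finite_basis_set [set b | bas P b /\ (deg b).1 = 0] idfun [:: e0].
  - by move=> b [].
  - by move=> b [Bb db]; rewrite /= (hb0 b Bb db); apply/spanFZ/spanF_in; rewrite inE.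
  - by [].
  by exists r => b Bb db; apply: hr.
have hj j : exists r : seq P, forall b, bas P b -> deg b = (n.+1%:Z, j) -> b \in r.
  have [us hus] := gr_finite hsn j.
  have [|||r [_ _ hr]] := @finite_basis_set [set b | bas P b /\ deg b = (n.+1%:Z, j)] d us.
  - by move=> b [].
  - move=> b [Bb db]; apply: hus; have := d_bas Bb; rewrite db /=.
    by have -> : n.+1%:Z - 1 = n%:Z by lia.
  - move=> q c b hb dx; apply: generators_cycle => //.
      by apply: generators_sum => i; exact: (hb i).1.
    apply: (@ev_gr _ _ _ (n.+1%:Z, j)) => //.
    by apply: gr_sum => i _; apply: grZ; rewrite -(hb i).2; apply: deg_bas; exact: (hb i).1.
  by exists r => b Bb db; apply: hr.
pose rj j := projT1 (cid (hj j)).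
have rjP j b : bas P b -> deg b = (n.+1%:Z, j) -> b \in rj j.
  by rewrite /rj; case: cid => r /= h; exact: h.
exists (flatten (map rj (Ds n.+1))) => b Bb db.
apply/flattenP; exists (rj (deg b).2); first by apply: map_f; exact: hD.
by apply: rjP => //; rewrite [LHS]surjective_pairing db.
Qed.

Lemma finite_basis_at n j : exists r : seq P,
  [/\ uniq r, forall b, b \in r -> bas P b /\ deg b = (n%:Z, j)
    & forall b, bas P b -> deg b = (n%:Z, j) -> b \in r].
Proof.
have [s hs] := finite_basis n.
exists (undup [seq b <- s | `[< bas P b /\ deg b = (n%:Z, j) >]]); split.
- exact: undup_uniq.
- by move=> b; rewrite mem_undup mem_filter => /andP[/asboolP].
- move=> b Bb db; rewrite mem_undup mem_filter hs ?db // andbT; exact/asboolP.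
Qed.

(** E^n_j is the dual of the finite-dimensional span of the basis elements of bidegree (n, j), so a
    subspace that separates this span is everything. *)
Lemma Ext_generated n j (T : set (Ext P)) :
  T 0 -> (forall (c : F) u v, T u -> T v -> T (c *: u + v)) ->
  (T `<=` Ext_bi P (n%:Z, j)) ->
  (forall x, generators x -> gr (n%:Z, j) x -> (forall y, T y -> rep y x = 0) -> x = 0) ->
  Ext_bi P (n%:Z, j) `<=` T.
Proof.
move=> T0 TP TE Tnd; have [r [ur rB hr]] := finite_basis_at n j.
pose b (i : 'I_(size r)) := tnth (in_tuple r) i.
have bB i : bas P (b i) /\ deg (b i) = (n%:Z, j) by apply: rB; exact: mem_tnth.
have binj : injective b.
  move=> i k /eqP; rewrite /b !(tnth_nth 0) nth_uniq // => /eqP.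
  exact: ord_inj.
pose row_of (y : Ext P) : 'rV[F]_(size r) := \row_i (rep y (b i) : F).
have rowP' c u v : row_of (c *: u + v) = c *: row_of u + row_of v.
  by apply/rowP => i; rewrite !mxE repP.
have full := @subspace_eq_full F (size r) [set w | exists2 y, T y & w = row_of y].
have {}full w : exists2 y, T y & w = row_of y.
  apply: full => [|c u v [y Ty ->] [z Tz ->]|v hv].
  - by exists 0 => //; apply/rowP => i; rewrite !mxE rep0.
  - by exists (c *: y + z); rewrite ?rowP' //; exact: TP.
  pose x := \sum_i sc (v i 0) (b i).
  have x0 : x = 0.
    apply: Tnd.
    - by apply: generators_sum => i; exact: (bB i).1.
    - by apply: gr_sum => i _; apply: grZ; rewrite -(bB i).2; apply: deg_bas; exact: (bB i).1.
    move=> y Ty; have ay := rep_alin hmin y.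
    have /matrixP/(_ 0 0) := hv (row_of y) (ex_intro2 _ _ y Ty erefl).
    rewrite !mxE => <-; rewrite /x.
    rewrite (big_morph (rep y) (alinD ay) (alin0 ay)); apply: eq_bigr => i _.
    by rewrite (alinZ _ _ ay) aug_alg !mxE mulrC.
  apply/matrixP => i k; rewrite (ord1 k) [RHS]mxE; apply: alg_inj0.
  exact: (bas_free binj (fun i => (bB i).1) x0 i).
move=> y hy; have [z Tz e] := full (row_of y).
suff -> : y = z by [].
apply: (rep_inj hmin); apply/funext.
have /(Ext_bi_rep hmin)[_ yG] := hy; have /(Ext_bi_rep hmin)[_ zG] := TE z Tz.
apply: alin_eq => [||c Bc]; try exact: rep_alin.
have [dc|dc] := eqVneq (deg c) (n%:Z, j).
  have cr := hr c Bc dc; have lt : (index c r < size r)%N by rewrite index_mem.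
  have bc : b (Ordinal lt) = c by rewrite /b (tnth_nth 0) /= nth_index.
  by have /rowP/(_ (Ordinal lt)) := e; rewrite !mxE bc.
by rewrite (yG _ _ dc (deg_bas Bc)) (zG _ _ dc (deg_bas Bc)).
Qed.

End FiniteResolution.

Local Notation ones l := (nseq l (1, 1) : seq (int * int)%type).

Lemma Delta0 d k : Delta d (3 * k) = (2 * d * k, 2 * d * k)%N.
Proof. by rewrite /Delta mulKn // modnMr. Qed.

Lemma Delta1 d k : Delta d (3 * k + 1) = (2 * d * k + 1, 2 * d * k + 1)%N.
Proof. by rewrite /Delta mulnC modnMDl divnMDl //= addn0. Qed.

Lemma Delta2 d k : Delta d (3 * k + 2) = (2 * d * k + d, 2 * d * k + d + 1)%N.
Proof. by rewrite /Delta mulnC modnMDl divnMDl //= addn0. Qed.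

(** Extracts one term of a Stasheff identity modulo the subspace T. *)
Lemma sum_isolate (I : eqType) (V : zmodType) (T : set V) (r : seq I) (f : I -> V) i0 :
  T 0 -> (forall x y, T x -> T y -> T (x - y)) -> uniq r -> i0 \in r ->
  (forall i, i \in r -> i != i0 -> T (f i)) -> T (\sum_(i <- r) f i) -> T (f i0).
Proof.
move=> T0 TB ur ir Tf; rewrite (bigD1_seq i0) //=.
have TD x y : T x -> T y -> T (x + y).
  by move=> Tx Ty; rewrite -[y]opprK -[- y]sub0r; apply: (TB) => //; exact: TB.
set S0 := \sum_(_ <- _ | _) _ => h; rewrite -[f i0](addrK S0); apply: TB => //.
by rewrite /S0 big_seq_cond; elim/big_ind: _ => // i /andP[ii ne]; exact: Tf.
Qed.

(** * One Stasheff identity *)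

Section Stasheff3.
Variables (F : fieldType) (A : graded_algebra F) (P : triv_resolution A) (d : nat).
Hypothesis hd : (2 <= d)%N.
Hypothesis hE : forall (n : nat) j, j != (Delta d n).1%:Z -> j != (Delta d n).2%:Z ->
  Ext_bi P (n%:Z, j) `<=` [set 0].

Lemma Ext_deg_Delta n : (Delta d n).1 = (Delta d n).2 ->
  Ext_deg P n%:Z `<=` Ext_bi P (n%:Z, (Delta d n).1%:Z).
Proof. by move=> e; apply: Ext_deg_unique => j ne; apply: hE => //; rewrite -e. Qed.

Variable m : seq (Ext P) -> Ext P.
Hypothesis hm : ainf_ext m.

Lemma op_multilin : multilin m.
Proof. exact: ainf_linear (ext_ainf hm). Qed.

Lemma op_zero u v : m (u ++ 0 :: v) = 0.
Proof. exact: multiadd0 (multilin_add op_multilin) _ _. Qed.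

Lemma op_image_in Xs xs : size xs = size Xs ->
  (forall i, (i < size Xs)%N -> nth set0 Xs i (nth 0 xs i)) -> op_image m Xs (m xs).
Proof. by move=> e h; apply: lspan_incl; exists xs. Qed.

(** The summand k1 = k, k2 = k3 = 0 of U. *)
Lemma U_perm3 k s (x y z : Ext P) : perm_eq s [:: 0; 1; 2]%N -> (1 <= k)%N ->
  Ext_deg P (3 * k)%N%:Z x -> Ext_deg P 1 y -> Ext_bi P (2, d%:Z) z ->
  U d m k (m [seq nth 0 [:: x; y; z] i | i <- s]).
Proof.
move=> hs k1 hx hy hz; apply: lspan_incl; exists k, 0%N, 0%N.
split; rewrite ?addn0 //; apply: lspan_incl; exists s => //.
have ss := perm_size hs.
apply: op_image_in; rewrite ?size_map // => i lti.
rewrite !(nth_map 0%N) //.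
have : nth 0%N s i \in s by rewrite mem_nth.
rewrite (perm_mem hs) !inE => /or3P[] /eqP -> //=.
by rewrite !muln0 !add0n.
Qed.

Variable k : nat.
Hypothesis k1 : (1 <= k)%N.
Local Notation T := (op_image m [:: Ext_bi P (2, (d + 1)%N%:Z); Ext_deg P (3 * k)%N%:Z]).
Hypothesis hU : U d m k `<=` T.

(** The degree count runs over the inner operation m_t. On letters of E^1 it lands in E^2_t, which
    vanishes unless t is d or d + 1; if it involves z it lands in E^{3k+1} in lower degree 2dk + t -
    1, which vanishes unless t = 2. The case t = d leaves an m_3 in U and t = d + 1 a product in T,
    so the term with t = 2 around z lies in T as well. *)
Lemma stasheff_step xis xi z : size xis = d ->
  homogeneous (Ext_bi P) (ones d) xis -> Ext_bi P (1, 1) xi ->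
  Ext_bi P ((3 * k)%N%:Z, (2 * d * k)%N%:Z) z ->
  T (m (xis ++ [:: m [:: xi; z]])).
Proof.
move=> sx hx hxi hz.
have T0 : T 0 by exact: lspan0.
have TD x y : T x -> T y -> T (x + y) by exact: lspanD.
have TN x : T x -> T (- x) by exact: lspanN.
have TB x y : T x -> T y -> T (x - y) by move=> Tx Ty; apply: TD => //; exact: TN.
have TZ (c : int) x : T x -> T (x *~ c) by move=> Tx; rewrite -scaler_int; exact: lspanZ.
pose q : int * int := ((3 * k)%N%:Z, (2 * d * k)%N%:Z).
pose w := xis ++ [:: xi].
have sw : size w = d.+1 by rewrite size_cat sx addn1.
have hw : homogeneous (Ext_bi P) (ones d.+1) w.
  by rewrite -addn1 nseqD; apply: homogeneous_cat => //; apply/homogeneous_cons.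
pose xs := w ++ [:: z]; pose bs := ones d.+1 ++ [:: q].
have hxs : homogeneous (Ext_bi P) bs xs.
  by apply: homogeneous_cat => //; apply/homogeneous_cons.
have sxs : size xs = d.+2 by rewrite size_cat sw addn1.
have xs0 : (0 < size xs)%N by rewrite sxs.
have deg_hom (ds : seq (int * int)) ys : homogeneous (Ext_bi P) ds ys ->
    homogeneous (Ext_deg P) (map fst ds) ys.
  elim: ds ys => [|b ds IH] [|x ys]; try by case.
  move=> /homogeneous_cons[hb /IH h]; apply/homogeneous_cons; split=> //.
  by apply: (@Ext_bi_deg _ _ _ _ _ _ _ b.2); rewrite -surjective_pairing.
have := ainf_stasheff (ext_ainf hm) xs0 (deg_hom _ _ hxs).
rewrite /stasheff sxs => st.
pose X i t := m (take i xs ++ m (take t (drop i xs)) :: drop (i + t) xs).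
have inner i t : (0 < t)%N -> (i + t <= d.+2)%N ->
    Ext_bi P (\sum_(b <- take t (drop i bs)) b + (2 - t%:Z, 0)) (m (take t (drop i xs))).
  move=> t0 le.
  have st' : size (take t (drop i xs)) = t by rewrite size_take size_drop sxs; case: ltnP; lia.
  rewrite -{2}st'; apply: (ext_bidegree hm); first by rewrite st'.
  by apply/homogeneous_take/homogeneous_drop.
have sumE l (p : int * int) : \sum_(b <- ones l ++ [:: p]) b + (2 - l.+1%:Z, 0) =
    (p.1 + 1, p.2 + l%:Z) :> (int * int)%type.
  rewrite big_cat sum_ones big_seq1; apply: pair_ext => /=; last by ring.
  by rewrite -[l.+1]addn1 PoszD; ring.
have sumE' l : \sum_(b <- ones l) b + (2 - l%:Z, 0) = (2, l%:Z) :> (int * int)%type.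
  by rewrite sum_ones; apply: pair_ext => /=; ring.
have TX i t : (0 < t)%N -> (i + t <= d.+2)%N -> (i, t) != (d, 2)%N -> T (X i t).
  move=> t0 le ne; have h := inner i t t0 le.
  have Xz : m (take t (drop i xs)) = 0 -> T (X i t).
    by move=> e; rewrite /X e op_zero.
  have [t1|t1] := eqVneq t 1%N.
    apply: Xz; rewrite t1.
    have : (0 < size (drop i xs))%N by rewrite size_drop sxs; lia.
    by case: (drop i xs) => [//|x ys] _; rewrite take_cons take0; exact: (ext_minimal hm).
  (* The inner word reaches z; the excluded pair (d, 2) is the only one for which the degree is
     right. *)
  have [e|lt] := eqVneq (i + t)%N d.+2.
    apply: Xz; move: h.
    have di : drop i bs = ones (d.+1 - i) ++ [:: q].
      rewrite drop_cat size_nseq drop_nseq; case: ltnP => // le'.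
      by exfalso; lia.
    have ti : t = (d.+1 - i).+1 by lia.
    rewrite di take_oversize ?ti ?size_cat ?size_nseq ?addn1 // sumE.
    have -> : q.1 + 1 = (3 * k + 1)%N%:Z by rewrite /q /= PoszD.
    apply: hE; rewrite Delta1 /q /=; apply/eqP; move: ne; rewrite xpair_eqE; lia.
  have le' : (i + t <= d.+1)%N by lia.
  have vE : take t (drop i bs) = ones t.
    rewrite drop_cat size_nseq; case: ltnP => [lti|]; last by lia.
    by rewrite drop_nseq takel_cat ?size_nseq; [rewrite take_nseq //; lia|lia].
  rewrite vE sumE' in h.
  (* The inner value is in E^2_d and one letter of E^1 is left, before or after it: these are the
     two terms in U. *)
  have [td|td] := eqVneq t d.
    have hh : Ext_bi P (2, d%:Z) (m (take t (drop i xs))) by rewrite -td.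
    have [i0|i0] := eqVneq i 0%N.
      have -> : X i t = m [:: m (take t (drop i xs)); xi; z].
        rewrite /X i0 td take0 /= add0n; congr (m (_ :: _)).
        by rewrite /xs /w -catA drop_size_cat.
      apply: hU; apply: (@U_perm3 k [:: 2; 1; 0]%N z xi) => //; first exact: Ext_bi_deg hz.
      exact: Ext_bi_deg hxi.
    have i1 : i = 1%N by lia.
    have [x0 [ys xsE]] : exists x0 ys, w = x0 :: ys by move: sw; case: (w) => // a b _; exists a, b.
    have sy : size ys = d by move: sw; rewrite xsE => -[].
    have hx0 : Ext_bi P (1, 1) x0 by move: hw; rewrite xsE => /homogeneous_cons[].
    have -> : X i t = m [:: x0; m (take t (drop i xs)); z].
      rewrite /X i1 td /xs xsE /= take0 /=; congr (m (_ :: _ :: _)).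
      by rewrite drop_size_cat.
    apply: hU; apply: (@U_perm3 k [:: 1; 2; 0]%N z x0) => //; first exact: Ext_bi_deg hz.
    exact: Ext_bi_deg hx0.
  (* The inner value is in E^2_{d+1} and only z is left. *)
  have [td1|td1] := eqVneq t d.+1.
    have i0 : i = 0%N by lia.
    have -> : X i t = m [:: m (take t (drop i xs)); z].
      rewrite /X i0 td1 take0 /= add0n; congr (m (_ :: _)).
      by rewrite /xs drop_size_cat.
    apply: op_image_in => // -[|[|//]] _ /=; last exact: Ext_bi_deg hz.
    by move: h; rewrite td1 addn1.
  apply: Xz; move: h; apply: hE; rewrite (Delta2 d 0) /=; apply/eqP; lia.
have goalE : m (xis ++ [:: m [:: xi; z]]) = X d 2.
  rewrite /X /xs /w -catA take_size_cat // drop_size_cat //=.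
  by rewrite drop_oversize // size_cat sx addn2.
rewrite goalE.
pose Y i t := X i t *~ (-1) ^ (i%:Z + ((d.+2 - i - t) * t)%N%:Z +
    (2 - t%:Z) * \sum_(p <- take i [seq b.1 | b <- bs]) p).
have TY i t : T (X i t) -> T (Y i t) by exact: TZ.
have TYd : T (\sum_(1 <= t < (d.+2 - d).+1) Y d t).
  apply: (@sum_isolate _ _ T (index_iota 0 d.+2)
    (fun i => \sum_(1 <= t < (d.+2 - i).+1) Y i t) d T0 TB).
  - exact: iota_uniq.
  - by rewrite mem_index_iota; lia.
  - move=> i; rewrite mem_index_iota => /andP[_ lti] ne.
    rewrite big_seq; elim/big_ind: _ => // t; rewrite mem_index_iota => /andP[t0 ltt].
    by apply: TY; apply: TX => //; [lia|rewrite xpair_eqE negb_and ne].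
  by rewrite [X in T X]st.
have TY2 : T (Y d 2).
  move: TYd; apply: (@sum_isolate _ _ T (index_iota 1 (d.+2 - d).+1) (Y d) 2 T0 TB).
  - exact: iota_uniq.
  - by rewrite mem_index_iota; lia.
  - move=> t; rewrite mem_index_iota => /andP[t0 ltt] ne.
    by apply: TY; apply: TX => //; [lia|rewrite xpair_eqE negb_and ne orbT].
move: TY2; rewrite /Y mulrz_eps; set c := eps F _ => /(lspanZ c).
by rewrite scalerA eps_sqr scale1r.
Qed.

End Stasheff3.

(** * Generation of E^{3k+1} and E^{3k+2} in the transferred structure *)

Section Generation.
Variables (F : fieldType) (A : graded_algebra F) (P : triv_resolution A) (dd : nat).
Hypothesis hdd : (2 <= dd)%N.
Hypothesis hmin : minimal P.
Local Notation gr := (res_gr P).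
Local Notation d := (res_d P).
Local Notation par := (par P).
Local Notation sc c x := (((c : F)%:A : A) *: x).
Local Notation ev := (@ev F A P).

Definition Delta_degrees : Prop := forall (n : nat) b, bas P b -> (deg b).1 = n%:Z ->
  (deg b).2 \in [:: (Delta dd n).1%:Z; (Delta dd n).2%:Z].

Hypothesis hB : Delta_degrees.

Lemma cochain_Delta (n : nat) j (phi : P -> F^o) x :
  j != (Delta dd n).1%:Z -> j != (Delta dd n).2%:Z -> cochain_at P (n%:Z, j) phi -> phi x = 0.
Proof.
move=> j1 j2 [phiL phi0]; move: x; apply: alin_eq => // [a y z|b Bb].
  by rewrite mulr0 addr0.
apply: phi0 (deg_bas Bb); apply: contraTneq isT => db.
by have := hB Bb (congr1 fst db); rewrite db !inE (negPf j1) (negPf j2).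
Qed.

Lemma Ext_bi_Delta (n : nat) j : j != (Delta dd n).1%:Z -> j != (Delta dd n).2%:Z ->
  Ext_bi P (n%:Z, j) `<=` [set 0].
Proof.
move=> j1 j2 x /(Ext_bi_rep hmin) hx; apply: (rep_inj hmin); rewrite rep0 //.
by apply/funext => w; rewrite (cochain_Delta w j1 j2 hx).
Qed.
Variables (e0 : P) (s : P -> P).
Hypothesis ge0 : gr (0, 0) e0.
Hypothesis ev_e0 : ev e0 = 1.
Hypothesis bas_deg0 : forall b, bas P b -> (deg b).1 = 0 -> b = sc (ev b) e0.
Hypothesis sP : forall (c : F) x y, s (sc c x + y) = sc c (s x) + s y.
Hypothesis s_gr : forall n j x, gr (n, j) x -> gr (n + 1, j) (s x).
Hypothesis ds : forall x, d (s x) + s (d x) = x - sc (ev x) e0.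
Hypothesis ss : forall x, s (s x) = 0.
Hypothesis s_e0 : s e0 = 0.
Hypothesis ev_s : forall x, ev (s x) = 0.
Hypothesis s_gen : forall x, generators x -> s x = 0.

Local Notation m := (minimal_model hmin ge0 sP s_gr).

Let hm : ainf_ext m.
Proof. exact: minimal_model_ext. Qed.

Let h1 b : bas P b -> (deg b).1 = 1 -> (deg b).2 = 1.
Proof.
move=> Bb db; have := @hB 1 b Bb db; rewrite (Delta1 dd 0) !inE muln0 add0n orbb.
by move/eqP.
Qed.

Lemma rep_model_neq0 bs xs x : homogeneous (Ext_bi P) bs xs ->
  rep (model_op hmin ge0 sP s_gr xs) x != 0 -> rep (m xs) x != 0.
Proof.
move=> hxs; rewrite (minimal_model_opE hmin ge0 sP s_gr (bi_homog_deg hxs)).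
rewrite -[_ *: _]addr0 repP // rep0 // addr0 -[X in _ -> X != 0]/(eps F _ * rep _ x).
move=> nz; rewrite mulf_neq0 //; apply/eqP => e.
by have := eps_sqr F (wt [seq i.1 | i <- bs]); rewrite e mul0r => /eqP; rewrite eq_sym oner_eq0.
Qed.

Lemma hom_op_bi bs xs : (0 < size xs)%N -> homogeneous (Ext_bi P) bs xs ->
  Ext_bi P (\sum_(b <- bs) b + (2 - (size xs)%:Z, 0)) (m xs).
Proof. exact: (ext_bidegree hm). Qed.

Lemma word_bi xis y q j0 : homogeneous (Ext_bi P) (ones (size xis)) xis ->
  Ext_bi P (q, j0) y -> (0 < size xis)%N ->
  Ext_bi P (q + 1, (size xis)%:Z + j0) (m (xis ++ [:: y])).
Proof.
move=> h hy x0; have w0 : (0 < size (xis ++ [:: y]))%N by rewrite size_cat addn1.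
have := hom_op_bi w0 (hom_word h hy).
rewrite sum_word size_cat; move: (size xis) => n.
have -> : (n%:Z + q, n%:Z + j0) + (2 - (n + size [:: y])%N%:Z, 0) =
    (q + 1, n%:Z + j0) :> (int * int)%type.
  by rewrite PoszD; apply: pair_ext => /=; ring.
by [].
Qed.

(** By duality it is enough that the given words separate generators, which is
    [model_nondegenerate]; the signs of the twist are units. *)
Lemma generated_step (q r : nat) j0 (T : set (Ext P)) : (0 < r)%N ->
  (forall b, bas P b -> (deg b).1 = q%:Z -> (deg b).2 = j0) ->
  T 0 -> (forall (c : F) u v, T u -> T v -> T (c *: u + v)) ->
  (T `<=` Ext_bi P (q.+1%:Z, r%:Z + j0)) ->
  (forall xis y, size xis = r -> homogeneous (Ext_bi P) (ones r) xis ->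
     Ext_bi P (q%:Z, j0) y -> T (m (xis ++ [:: y]))) ->
  Ext_bi P (q.+1%:Z, r%:Z + j0) `<=` T.
Proof.
move=> r0 hq T0 TP TE Tm; apply: (Ext_generated hmin hB T0 TP TE) => x genx gx xT.
apply: contrapT => /eqP x0.
have gx' : gr (q%:Z + 1, r%:Z + j0) x.
  by have -> : q%:Z + 1 = q.+1%:Z by lia.
have [xis [y [sx hx hy nz]]] := model_nondegenerate hmin ge0 ev_e0 bas_deg0 sP s_gr ds ss ev_s
  r0 (isT : 0 <= q%:Z) h1 hq genx gx' x0.
have hx' : homogeneous (Ext_bi P) (ones (size xis)) xis by rewrite sx.
by have := rep_model_neq0 (hom_word hx' hy) nz; rewrite (xT _ (Tm _ _ sx hx hy)) eqxx.
Qed.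

Section Degree.
Variable k : nat.

Let q0 b : bas P b -> (deg b).1 = (3 * k)%N%:Z -> (deg b).2 = (2 * dd * k)%N%:Z.
Proof. by move=> Bb db; have := hB Bb db; rewrite Delta0 !inE orbb => /eqP. Qed.

Let q1 b : bas P b -> (deg b).1 = (3 * k + 1)%N%:Z -> (deg b).2 = (2 * dd * k + 1)%N%:Z.
Proof. by move=> Bb db; have := hB Bb db; rewrite Delta1 !inE orbb => /eqP. Qed.

(** The case r = 1, as the lower degrees 2dk and 2dk + 1 differ by one. *)
Lemma Ext_3k1_generated : Ext_bi P ((3 * k + 1)%N%:Z, (2 * dd * k + 1)%N%:Z) `<=`
  lspan [set y | exists xi z, [/\ Ext_bi P (1, 1) xi,
    Ext_bi P ((3 * k)%N%:Z, (2 * dd * k)%N%:Z) z & y = m [:: xi; z]]].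
Proof.
set S0 := [set y | _].
have e1 : (2 * dd * k + 1)%N%:Z = 1%N%:Z + (2 * dd * k)%N%:Z by rewrite addnC PoszD.
have e2 : (3 * k + 1)%N = (3 * k).+1 by rewrite addn1.
rewrite e1 e2; apply: (@generated_step _ 1) => //.
- exact: lspan0.
- by move=> c u v hu hv; apply: lspanD => //; exact: lspanZ.
- apply: lspan_min; [exact: Ext_bi0|exact: Ext_biD|by move=> c v; exact: Ext_biZ|].
  move=> _ [xi [z [hxi hz ->]]].
  have hx : homogeneous (Ext_bi P) (ones (size [:: xi])) [:: xi] by apply/homogeneous_cons.
  have := word_bi hx hz isT => /=.
  by have -> : (3 * k)%N%:Z + 1 = (3 * k).+1%:Z by lia.
- move=> [|xi [|? ?]] // z _ /homogeneous_cons[hxi _] hz.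
  by apply: lspan_incl; exists xi, z.
Qed.

Hypothesis k1 : (1 <= k)%N.
Local Notation T := (op_image m [:: Ext_bi P (2, (dd + 1)%N%:Z); Ext_deg P (3 * k)%N%:Z]).
Hypothesis hU : U dd m k `<=` T.

(** The case r = d, since 2dk + d + 1 exceeds 2dk + 1 by d. The last letter is a combination of
    products from E^1 and E^{3k}, and [stasheff_step] applies to each of them. *)
Lemma Ext_3k2_generated :
  Ext_bi P ((3 * k + 2)%N%:Z, (2 * dd * k + dd + 1)%N%:Z) `<=` T.
Proof.
have e1 : (2 * dd * k + dd + 1)%N%:Z = dd%:Z + (2 * dd * k + 1)%N%:Z by lia.
have e2 : (3 * k + 2)%N = (3 * k + 1).+1 by rewrite addn1 addn2.
rewrite e1 e2; apply: (@generated_step (3 * k + 1) dd) => //.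
- by lia.
- exact: lspan0.
- by move=> c u v hu hv; apply: lspanD => //; exact: lspanZ.
- apply: lspan_min; [exact: Ext_bi0|exact: Ext_biD|by move=> c v; exact: Ext_biZ|].
  move=> _ [xs [/= sxs hxs] <-].
  case: xs sxs hxs => [|y [|z [|? ?]]] // _ hxs.
  have hy : Ext_bi P (2, (dd + 1)%N%:Z) y by exact: (hxs 0%N).
  have hz : Ext_deg P (3 * k)%N%:Z z by exact: (hxs 1%N).
  have {}hz : Ext_bi P ((3 * k)%N%:Z, (2 * dd * k)%N%:Z) z.
    by have := Ext_deg_Delta Ext_bi_Delta _ hz; rewrite Delta0; apply.
  have hw : homogeneous (Ext_bi P) [:: (2, (dd + 1)%N%:Z); ((3 * k)%N%:Z, (2 * dd * k)%N%:Z)] [:: y; z].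
    by apply/homogeneous_cons; split=> //; apply/homogeneous_cons.
  have := hom_op_bi (isT : (0 < size [:: y; z])%N) hw.
  rewrite !big_cons big_nil addr0.
  set b := (X in Ext_bi P X).
  have -> // : b = ((3 * k + 1).+1%:Z, dd%:Z + (2 * dd * k + 1)%N%:Z).
  by apply: pair_ext => /=; lia.
move=> xis y sx hx /Ext_3k1_generated.
set S0 := [set y | _].
have mL := op_multilin hm.
have h : lspan S0 `<=` [set y | T (m (xis ++ [:: y]))].
  apply: lspan_min => /=.
  - by rewrite (op_zero hm); exact: lspan0.
  - by move=> u v hu hv; rewrite (multilin_add mL); exact: lspanD.
  - by move=> c v hv; rewrite multilinZ //; exact: lspanZ.
  - move=> _ [xi [z [hxi hz ->]]] /=.
    by apply: (stasheff_step hdd Ext_bi_Delta hm k1 hU sx hx hxi hz).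
exact: h.
Qed.

End Degree.

End Generation.

(** * Comparison of resolutions *)

Section Comparison.
Variables (F : fieldType) (A : graded_algebra F) (M : lmodType A).
Variables (G : int -> set M) (N : set M).
Hypothesis GB : forall i x y, G i x -> G i y -> G i (x - y).
Hypothesis Gfree : forall (s : seq int) (c : int -> M), uniq s ->
  (forall i, G i (c i)) -> \sum_(i <- s) c i = 0 -> forall i, i \in s -> c i = 0.

Section Augmentation.
Variable Q : resolution G N.
Local Notation eps := (res_eps Q).

Lemma eps_sum x : exists r : seq int, forall s, uniq s -> {subset r <= s} ->
  eps x = \sum_(j <- s) eps (pr Q (0, j) x).
Proof.
apply: (homogeneous_ind (P := Q) (T := [set x | exists r : seq int, forall s, uniq s ->
  {subset r <= s} -> eps x = \sum_(j <- s) eps (pr Q (0, j) x)])) => /=.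
- exists [::] => s _ _; rewrite (linear0 eps) big1 // => j _.
  by rewrite pr0 (linear0 eps).
- move=> x1 x2 [r1 h1] [r2 h2]; exists (r1 ++ r2) => s us rs.
  rewrite (linear_addm eps) (h1 s us) ?(h2 s us) => [|j jr|j jr].
  + by rewrite -big_split; apply: eq_bigr => j _; rewrite prD (linear_addm eps).
  + by apply: rs; rewrite mem_cat jr orbT.
  + by apply: rs; rewrite mem_cat jr.
- move=> n j {}x gx; exists [:: j] => s us js.
  have [n0|n0] := eqVneq n 0; last first.
    rewrite (res_eps_gr n0 gx) big1 // => i _; rewrite (pr_ne _ gx) ?(linear0 eps) //.
    by apply: contraNneq n0 => -[->].
  rewrite n0 in gx; rewrite (bigD1_seq j) ?js ?mem_head //= big1 ?addr0 ?pr_id // => i ij.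
  by rewrite (pr_ne _ gx) ?(linear0 eps) // xpair_eqE eqxx eq_sym (negPf ij).
Qed.

(** The element [eps x] is the sum of the images of the components (0, i) of x, and independence of
    the G i leaves only i = j. *)
Lemma eps_pr j x : G j (eps x) -> eps (pr Q (0, j) x) = eps x.
Proof.
move=> Gx; have [r hr] := eps_sum x; pose s := undup (j :: r).
have js : j \in s by rewrite mem_undup mem_head.
have us : uniq s by exact: undup_uniq.
have e : eps x = \sum_(j <- s) eps (pr Q (0, j) x).
  by apply: hr => // i ir; rewrite mem_undup inE ir orbT.
have G0 i : G i 0.
  by have := res_eps_gr0 (gr0 Q (0, i)); rewrite (linear0 eps).
have Gi i : G i (eps (pr Q (0, i) x) - (if i == j then eps x else 0)).
  apply: GB; first by apply: res_eps_gr0; exact: pr_in.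
  by have [->|_] := eqVneq i j; [exact: Gx|exact: G0].
have := Gfree us Gi; rewrite sumrB -e => /(_ _ _ js).
rewrite eqxx => h; apply/eqP; rewrite -subr_eq0; apply/eqP/h.
rewrite (bigD1_seq j) //= eqxx big1 ?addr0 ?subrr // => i /negPf ij.
by rewrite ij.
Qed.

Lemma graded_preimage n j z : res_gr Q (n, j) z -> res_d Q z = 0 -> eps z = 0 ->
  exists y, res_gr Q (n + 1, j) y /\ res_d Q y = z.
Proof.
move=> gz dz ez; have [y zy] := res_exact dz ez.
exists (pr Q (n + 1, j) y); split; first exact: pr_in.
by rewrite -pr_d addrK -zy pr_id.
Qed.

End Augmentation.

Definition chain_map (P Q : resolution G N) (f : {linear P -> Q}) : Prop :=
  [/\ forall nj x, res_gr P nj x -> res_gr Q nj (f x),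
      forall x, f (res_d P x) = res_d Q (f x)
    & forall x, res_eps Q (f x) = res_eps P x].

Section Maps.
Variables P Q : resolution G N.
Local Notation gr := (res_gr P).
Local Notation d := (res_d P).

Lemma bas_gr_ind n (R : int -> set P) :
  (forall j, R j 0) -> (forall j x y, R j x -> R j y -> R j (x + y)) ->
  (forall i a b j', gcomp i a -> bas P b -> deg b = (n, j') -> R (i%:Z + j') (a *: b)) ->
  forall j x, gr (n, j) x -> R j x.
Proof.
move=> R0 RD Rb j x gx; apply: (gr_ind (T := R j) (R0 j) (RD j) _ gx).
by move=> i a b j' ai Bb db <-; exact: Rb.
Qed.

Lemma comparison_exists : exists f : {linear P -> Q}, chain_map f.
Proof.
(* A lift of b over y in the bidegree of b, with default 0. That a lift exists is shown together
   with the chain map property, in [fbas]. *)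
pose S b y := xget 0 [set q : Q | [/\ res_gr Q (deg b) q, res_d Q q = y
  & res_eps Q q = res_eps P b]].
have [f fE] := rec_ext S.
pose R j (x : P) n := [/\ res_gr Q (n, j) (f x), f (d x) = res_d Q (f x)
  & res_eps Q (f x) = res_eps P x].
have fb n : (forall b, bas P b -> (deg b).1 = n -> R (deg b).2 b n) ->
    forall j x, gr (n, j) x -> R j x n.
  move=> hb; apply: (bas_gr_ind (R := fun j x => R j x n)) => [j|j x y|i a b j' ai Bb db].
  - by rewrite /R !linear0; split=> //; exact: gr0.
  - move=> [x1 x2 x3] [y1 y2 y3]; rewrite /R !(linear_addm f) !(linear_addm d).
    rewrite !(linear_addm f) !(linear_addm (res_eps _)) !(linear_addm (res_d _)) x2 y2 x3 y3.
    by split=> //; exact: grD.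
  - have [] := hb b Bb; rewrite ?db // => h1 h2 h3; rewrite /R (linear_scalem d).
    rewrite !(linear_scalem f) h2 (linear_scalem (res_d Q)) !(linear_scalem (res_eps _)) h3.
    by split=> //; exact: res_gr_scale.
have fbas b : bas P b -> R (deg b).2 b (deg b).1.
  move: b; apply: bas_ind => b Bb IH.
  pose n := (deg b).1; pose j := (deg b).2.
  have dbE : deg b = (n, j) by rewrite /n /j; case: (deg b).
  have gb : gr (n, j) b by rewrite -dbE; exact: deg_bas.
  suff [q [q1 q2 q3]] : exists q, [/\ res_gr Q (deg b) q, res_d Q q = f (d b)
      & res_eps Q q = res_eps P b].
    have := xgetPex 0 (ex_intro [set q | [/\ res_gr Q (deg b) q, res_d Q q = f (d b)
      & res_eps Q q = res_eps P b]] q (And3 q1 q2 q3)).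
    by rewrite -[xget _ _]/(S b (f (d b))) -fE // => -[h1 h2 h3]; split=> //; case: (deg b) h1.
  have [n0|n0] := eqVneq n 0.
    rewrite n0 in gb dbE; have [q' _ eq'] : range (res_eps Q) (res_eps P b).
      have: range (res_eps P) (res_eps P b) by exists b.
      by move: (res_eps P b) => z; rewrite (res_eps_im P) (res_eps_im Q).
    have Gb : G j (res_eps Q q') by rewrite eq'; exact: res_eps_gr0.
    exists (pr Q (0, j) q'); rewrite dbE; split; first exact: pr_in.
      by rewrite (d_gr0 gb) (linear0 f) (d_gr0 (pr_in (0, j) q')).
    by rewrite eps_pr.
  have IHn : forall j x, gr (n - 1, j) x -> R j x (n - 1).
    apply: fb => b' Bb' db'; rewrite -db'; apply: IH => //.
    by rewrite db' subrK.
  have [h1 h2 h3] := IHn _ _ (res_d_gr gb).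
  rewrite res_dd (linear0 f) in h2; rewrite res_eps_d in h3.
  have [q [gq dq]] := graded_preimage h1 (esym h2) h3.
  rewrite subrK in gq; exists q; rewrite dbE; split=> //.
  by rewrite (res_eps_gr n0 gq) (res_eps_gr n0 gb).
have fgr n j x : gr (n, j) x -> R j x n.
  by apply: fb => b Bb <-; exact: fbas.
exists f; split=> [[n j] x /fgr[]//||].
- apply: (homogeneous_ind (T := [set x | f (d x) = res_d Q (f x)])) => /= [|x y hx hy|n j x /fgr[]//].
    by rewrite !linear0.
  by rewrite (linear_addm d) !(linear_addm f) hx hy (linear_addm (res_d Q)).
- apply: (homogeneous_ind (T := [set x | res_eps Q (f x) = res_eps P x])) => /= [|x y hx hy|n j x /fgr[]//].
    by rewrite !linear0.
  by rewrite (linear_addm f) !(linear_addm (res_eps _)) hx hy.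
Qed.

Lemma homotopy_exists (g : {linear P -> Q}) :
  (forall nj x, gr nj x -> res_gr Q nj (g x)) ->
  (forall x, g (d x) = res_d Q (g x)) -> (forall x, res_eps Q (g x) = 0) ->
  exists k : {linear P -> Q},
    (forall n j x, gr (n, j) x -> res_gr Q (n + 1, j) (k x)) /\
    forall x, res_d Q (k x) + k (d x) = g x.
Proof.
move=> ggr gd geps.
pose S b y := xget 0 [set q : Q | res_gr Q ((deg b).1 + 1, (deg b).2) q /\
  res_d Q q = g b - y].
have [k kE] := rec_ext S.
pose R j (x : P) n := res_gr Q (n + 1, j) (k x) /\ res_d Q (k x) + k (d x) = g x.
have kb n : (forall b, bas P b -> (deg b).1 = n -> R (deg b).2 b n) ->
    forall j x, gr (n, j) x -> R j x n.
  move=> hb; apply: (bas_gr_ind (R := fun j x => R j x n)) => [j|j x y|i a b j' ai Bb db].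
  - by rewrite /R !linear0 addr0; split=> //; exact: gr0.
  - move=> [x1 x2] [y1 y2]; rewrite /R (linear_addm d) !(linear_addm k) (linear_addm g).
    by rewrite (linear_addm (res_d Q)) addrACA x2 y2; split=> //; exact: grD.
  - have [] := hb b Bb; rewrite ?db // => h1 h2; rewrite /R (linear_scalem d).
    rewrite !(linear_scalem k) (linear_scalem (res_d Q)) -scalerDr h2 (linear_scalem g).
    by split=> //; exact: res_gr_scale.
have kbas b : bas P b -> R (deg b).2 b (deg b).1.
  move: b; apply: bas_ind => b Bb IH.
  pose n := (deg b).1; pose j := (deg b).2.
  have dbE : deg b = (n, j) by rewrite /n /j; case: (deg b).
  have gb : gr (n, j) b by rewrite -dbE; exact: deg_bas.
  suff [q [q1 q2]] : exists q, res_gr Q (n + 1, j) q /\ res_d Q q = g b - k (d b).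
    have := xgetPex 0 (ex_intro [set q | res_gr Q (n + 1, j) q /\
      res_d Q q = g b - k (d b)] q (conj q1 q2)).
    rewrite -[xget _ _]/(S b (k (d b))) -kE // => -[h1 h2]; split=> //.
    by rewrite h2 subrK.
  have [n0|n0] := eqVneq n 0.
    rewrite n0 in gb *; rewrite (d_gr0 gb) (linear0 k) subr0.
    by apply: graded_preimage; [exact: ggr|rewrite -gd (d_gr0 gb) linear0|exact: geps].
  have IHn : forall j x, gr (n - 1, j) x -> R j x (n - 1).
    apply: kb => b' Bb' db'; rewrite -db'; apply: IH => //.
    by rewrite db' subrK.
  have [h1 h2] := IHn _ _ (res_d_gr gb).
  rewrite res_dd (linear0 k) addr0 in h2; rewrite subrK in h1.
  apply: graded_preimage; first by apply: grB => //; exact: ggr.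
    by rewrite (linearB (res_d Q)) h2 -gd subrr.
  by rewrite (linearB (res_eps Q)) geps (res_eps_gr n0 h1) subrr.
have kgr n j x : gr (n, j) x -> R j x n.
  by apply: kb => b Bb <-; exact: kbas.
exists k; split=> [n j x /kgr[]//|].
apply: (homogeneous_ind (T := [set x | res_d Q (k x) + k (d x) = g x])) => /= [|x y hx hy|n j x /kgr[]//].
  by rewrite !linear0 addr0.
by rewrite (linear_addm d) !(linear_addm k) (linear_addm (res_d Q)) addrACA hx hy (linear_addm g).
Qed.

Lemma cochain_chain_map (f : {linear P -> Q}) b phi : chain_map f ->
  cochain_at Q b phi -> cochain_at P b (phi \o f).
Proof.
move=> [fg _ _] [h1 h2]; split=> [a x y|b' x bb gx] /=.
  by rewrite linearP h1.
by apply: h2 bb _; exact: fg.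
Qed.

Lemma cochain_homotopy (k : {linear P -> Q}) p j phi :
  (forall n j x, gr (n, j) x -> res_gr Q (n + 1, j) (k x)) ->
  cochain_at Q (p, j) phi -> cochain_at P (p - 1, j) (phi \o k).
Proof.
move=> kg [h1 h2]; split=> [a x y|[n i] x bb gx] /=.
  by rewrite linearP h1.
apply: (h2 (n + 1, i)); last exact: kg.
by apply: contraNneq bb => -[<- <-]; rewrite addrK.
Qed.

End Maps.

Lemma round_trip_homotopy (P Q : resolution G N) (f : {linear P -> Q}) (g : {linear Q -> P}) :
  chain_map f -> chain_map g -> exists k : {linear P -> P},
    (forall n j x, res_gr P (n, j) x -> res_gr P (n + 1, j) (k x)) /\
    forall x, res_d P (k x) + k (res_d P x) = x - g (f x).
Proof.
move=> [f1 f2 f3] [g1 g2 g3].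
have hL : linear (fun x => x - g (f x)).
  move=> a x y; rewrite (linearP f) (linearP g) scalerBr opprD addrACA.
  by [].
apply: (@homotopy_exists P P (mklin hL)) => [nj x gx|x|x] /=.
- by apply: grB => //; apply/g1/f1.
- by rewrite f2 g2 -linearB.
- by rewrite linearB g3 f3 subrr.
Qed.

Section ExtVanishing.
Variable P : resolution G N.
Local Notation d := (res_d P).

(** Where [phi] can be nonzero, only the part of the bounding cochain of bidegree (p - 1, j) is
    seen. *)
Lemma coboundary_homogeneous p j phi : cochain_at P (p, j) phi ->
  (exists2 psi, cochain P psi & phi = psi \o d) ->
  exists2 psi, cochain_at P (p - 1, j) psi & phi = psi \o d.
Proof.
move=> hphi [_ [n [c [s [sS ->]]]] e].
have [bs bsP] := choice (fun i => match sS i with ex_intro2 b _ h => ex_intro (fun b => cochain_at P b (s i)) b h end).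
pose psi := \sum_(i < n | bs i == (p - 1, j)) c i *: s i.
have hpsi : cochain_at P (p - 1, j) psi.
  rewrite /psi; elim/big_rec: _ => [|i f /eqP bi hf]; first exact: cochain_at0.
  by apply: cochain_atP => //; rewrite -bi.
exists psi => //; apply/funext.
have hL (f : P -> F^o) b : cochain_at P b f -> {morph f : x y / x + y}.
  by move=> [h _] x y; have := h 1 x y; rewrite scale1r rmorph1 mul1r.
apply: (homogeneous_ind (T := [set x | phi x = (psi \o d) x])) => /= [|x y hx hy|n' j' x gx].
- by rewrite linear0; have := hL _ _ hphi 0 0; have := hL _ _ hpsi 0 0;
    rewrite !addr0 => /eqP; rewrite eq_sym -subr_eq0 addrK => /eqP-> /eqP;
    rewrite eq_sym -subr_eq0 addrK => /eqP->.
- by rewrite (linear_addm d) (hL _ _ hphi) (hL _ _ hpsi) hx hy.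
have [bx|bx] := eqVneq (n', j') (p, j); last first.
  rewrite (hphi.2 _ _ bx gx); symmetry; apply: (hpsi.2 (n' - 1, j')); last exact: res_d_gr.
  by apply: contraNneq bx => -[/addIr -> ->].
have gd : res_gr P (p - 1, j) (d x) by case: bx gx => -> -> /res_d_gr.
rewrite e /= /psi !fct_sumE (bigID (fun i => bs i == (p - 1, j))) /=.
rewrite [X in _ + X]big1 ?addr0 // => i bi.
rewrite -[LHS]/(c i * s i (d x)) ((bsP i).2 _ _ _ gd) ?mulr0 //.
by rewrite eq_sym.
Qed.

Lemma Ext_bi_eq0 p j : Ext_bi P (p, j) `<=` [set 0] <->
  forall phi, cochain_at P (p, j) phi -> phi \o d = 0 ->
    exists2 psi, cochain_at P (p - 1, j) psi & phi = psi \o d.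
Proof.
split=> [h phi hphi dphi|h x [phi hphi [z [ez ->]]]].
  have zP : cocycle phi by apply/asboolP; split=> //; exact: cochain_at_cochain hphi.
  pose z : cocycles P := exist _ phi zP.
  have : Ext_bi P (p, j) (Ext_class z) by exists phi => //; exists z.
  move=> /h /= z0; apply: coboundary_homogeneous => //.
  have : Ext_class z = Ext_class 0 by rewrite z0; symmetry; exact: raddf0.
  by move=> /Ext_classP; rewrite subr0 => /asboolP.
have [|psi hpsi e] := h phi hphi.
  by have /asboolP[_] := valP z; rewrite ez.
rewrite /=; have -> : 0 = Ext_class (0 : cocycles P) by symmetry; exact: raddf0.
apply/Ext_classP; rewrite subr0; apply/asboolP; exists psi; last by rewrite ez.
exact: cochain_at_cochain hpsi.
Qed.

End ExtVanishing.

(** For chain maps f, g and a homotopy k from g f to the identity, a cocycle satisfies phi = phi k d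
    + phi g f, and phi g bounds by assumption. *)
Lemma Ext_bi_eq0_transfer (P Q : resolution G N) b :
  Ext_bi P b `<=` [set 0] -> Ext_bi Q b `<=` [set 0].
Proof.
case: b => p j /Ext_bi_eq0 h; apply/Ext_bi_eq0 => phi hphi dphi.
have [f hf] := comparison_exists Q P; have [g hg] := comparison_exists P Q.
have [k [kg kE]] := round_trip_homotopy hf hg.
have [||psi hpsi e] := h (phi \o g); first exact: cochain_chain_map hphi.
  apply/funext => x /=; rewrite -[0 x]/(0 : F); have [_ -> _] := hg.
  by have := congr1 (@^~ (g x)) dphi.
have h1 : cochain_at Q (p - 1, j) (phi \o k) by exact: cochain_homotopy hphi.
have h2 : cochain_at Q (p - 1, j) (psi \o f) by exact: cochain_chain_map hpsi.
have := cochain_atP 1 h1 h2; rewrite scale1r => h3; exists ((phi \o k : Q -> F^o) + (psi \o f : Q -> F^o)) => //.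
apply/funext => x; rewrite -[RHS]/(phi (k (res_d Q x)) + psi (f (res_d Q x))).
have [_ -> _] := hf; rewrite -[psi (res_d P _)]/((psi \o res_d P) (f x)) -e /=.
have hL x1 x2 : phi (x1 + x2) = phi x1 + phi x2.
  by have := hphi.1 1 x1 x2; rewrite scale1r rmorph1 mul1r.
have -> : phi x = phi (res_d Q (k x) + k (res_d Q x) + g (f x)) by rewrite kE subrK.
rewrite !hL.
have -> : phi (res_d Q (k x)) = 0 by have := congr1 (@^~ (k x)) dphi.
by rewrite add0r.
Qed.

End Comparison.

Lemma gr_free (F : fieldType) (A : graded_algebra F) (M : lmodType A) (G : int -> set M)
    (N : set M) (P : resolution G N) (J : eqType) (h : J -> int * int) (s : seq J)
    (c : J -> P) : injective h -> uniq s -> (forall i, res_gr P (h i) (c i)) ->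
  \sum_(i <- s) c i = 0 -> forall i, i \in s -> c i = 0.
Proof.
move=> hI us cg e i si; have := congr1 (pr P (h i)) e.
rewrite pr0 /pr gproj_big (bigD1_seq i) //= big1 => [|j ji].
  by rewrite addr0 (gproj_id _ (cg i)).
by rewrite (gproj_ne _ _ (cg j)) // (inj_eq hI).
Qed.

Lemma triv_grB (F : fieldType) (A : graded_algebra F) i (x y : triv A) :
  triv_gr i x -> triv_gr i y -> triv_gr i (x - y).
Proof. by rewrite /triv_gr; case: ifP => // _ /= -> ->; rewrite subrr. Qed.

Lemma triv_gr_free (F : fieldType) (A : graded_algebra F) (s : seq int) (c : int -> triv A) :
  uniq s -> (forall i, triv_gr i (c i)) -> \sum_(i <- s) c i = 0 ->
  forall i, i \in s -> c i = 0.
Proof.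
move=> us cg e i si.
have c0 j : j != 0 -> c j = 0 by have := cg j; rewrite /triv_gr; case: eqP.
have [i0|/c0//] := eqVneq i 0.
by move: e; rewrite (bigD1_seq i) //= big1 ?addr0 // => j ji; apply: c0; rewrite -i0.
Qed.

(** * A resolution of J times a syzygy *)

Section Selection.
Variables (F : fieldType) (A : graded_algebra F) (M : lmodType A).
Variables (G : int -> set M) (N : set M) (P : resolution G N).
Local Notation gr := (res_gr P).
Local Notation d := (res_d P).

(** The projection onto the homological degrees in S; truncations are its fixed points. *)
Definition sel (S : pred int) : {linear P -> P} :=
  ext (fun b : P => if S (deg b).1 then b else 0).

Lemma sel_gr S n j x : gr (n, j) x -> sel S x = if S n then x else 0.
Proof.
apply: (gr_ind (T := [set x | sel S x = if S n then x else 0])) => /=.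
- by rewrite linear0; case: ifP.
- by move=> x1 x2 h1 h2; rewrite (linear_addm (sel S)) h1 h2; case: ifP => // _; rewrite addr0.
- move=> i a b j' _ Bb db _; rewrite (linear_scalem (sel S)) extE // db /=.
  by case: ifP; rewrite ?scaler0.
Qed.

Lemma sel_in S n j x : gr (n, j) x -> gr (n, j) (sel S x).
Proof. by move=> gx; rewrite (sel_gr S gx); case: ifP => // _; exact: gr0. Qed.

Lemma sel_sel S T x : sel S (sel T x) = sel (predI S T) x.
Proof.
apply: (homogeneous_ind (T := [set x | sel S (sel T x) = sel (predI S T) x])) => /=.
- by rewrite !linear0.
- move=> x1 x2 h1 h2.
  by rewrite (linear_addm (sel T)) (linear_addm (sel S)) (linear_addm (sel (predI S T))) h1 h2.
- move=> n j {}x gx; rewrite (sel_gr S (sel_in T gx)) (sel_gr T gx) (sel_gr (predI S T) gx) /=.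
  by case: (S n); case: (T n).
Qed.

Lemma eq_sel S T : S =1 T -> sel S =1 sel T.
Proof.
move=> ST x; apply: (homogeneous_ind (T := [set x | sel S x = sel T x])) => /=.
- by rewrite !linear0.
- by move=> x1 x2 h1 h2; rewrite (linear_addm (sel S)) (linear_addm (sel T)) h1 h2.
- by move=> n j {}x gx; rewrite (sel_gr S gx) (sel_gr T gx) ST.
Qed.

Lemma sel_map (f : {linear P -> P}) q S x :
  (forall n j x, gr (n, j) x -> exists j', gr (n - q, j') (f x)) ->
  f (sel S x) = sel (fun n => S (n + q)) (f x).
Proof.
move=> fg; set T := fun n => S (n + q).
apply: (homogeneous_ind (T := [set x | f (sel S x) = sel T (f x)])) => /=.
- by rewrite !linear0.
- move=> x1 x2 h1 h2.
  by rewrite (linear_addm (sel S)) !(linear_addm f) (linear_addm (sel T)) h1 h2.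
- move=> n j {}x gx; have [j' gf] := fg _ _ _ gx.
  by rewrite (sel_gr S gx) (sel_gr T gf) /T subrK; case: ifP; rewrite ?linear0.
Qed.

Lemma sel_d S x : d (sel S x) = sel (fun n => S (n + 1)) (d x).
Proof. by apply: sel_map => n j y gy; exists j; exact: res_d_gr. Qed.

Lemma sel0 S x : S =1 xpred0 -> sel S x = 0.
Proof.
move=> S0; apply: (homogeneous_ind (T := [set x | sel S x = 0])) => /=.
- exact: linear0.
- by move=> x1 x2 h1 h2; rewrite (linear_addm (sel S)) h1 h2 addr0.
- by move=> n j {}x gx; rewrite (sel_gr S gx) S0.
Qed.

Lemma sel_pos x : sel (fun n => 0 <= n) x = x.
Proof.
apply: (homogeneous_ind (T := [set x | sel (fun n => 0 <= n) x = x])) => /=.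
- exact: linear0.
- by move=> x1 x2 h1 h2; rewrite (linear_addm (sel _)) h1 h2.
- move=> n j {}x gx; rewrite (sel_gr _ gx); case: leP => // n0.
  by rewrite (gr_neg0 n0 gx).
Qed.

Lemma sel_split S x : sel S x + sel (predC S) x = x.
Proof.
apply: (homogeneous_ind (T := [set x | sel S x + sel (predC S) x = x])) => /=.
- by rewrite !linear0 addr0.
- move=> x1 x2 h1 h2.
  by rewrite (linear_addm (sel S)) (linear_addm (sel (predC S))) addrACA h1 h2.
- move=> n j {}x gx; rewrite (sel_gr S gx) (sel_gr (predC S) gx) /=.
  by case: (S n); rewrite ?addr0 ?add0r.
Qed.

Lemma cochain_sel (phi : P -> F^o) n j (S : pred int) x : cochain_at P (n, j) phi -> S n ->
  phi (sel S x) = phi x.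
Proof.
move=> [hL hb] Sn.
have phiD x1 x2 : phi (x1 + x2) = phi x1 + phi x2.
  by have := hL 1 x1 x2; rewrite scale1r rmorph1 mul1r.
have phi0 : phi 0 = 0.
  by have := hL (-1) 0 0; rewrite scaler0 addr0 rmorphN1 mulN1r addNr.
apply: (homogeneous_ind (T := [set x | phi (sel S x) = phi x])) => /=.
- by rewrite linear0.
- by move=> x1 x2 h1 h2; rewrite (linear_addm (sel S)) !phiD h1 h2.
- move=> n' j' {}x gx; rewrite (sel_gr S gx); case: ifP => // /negbT Sn'.
  rewrite phi0 (hb _ _ _ gx) //; apply: contraNneq Sn' => -[-> _]; exact: Sn.
Qed.

End Selection.

Arguments sel {F A M G N} P S.

Section DegreeZero.
Variables (F : fieldType) (A : graded_algebra F) (P : triv_resolution A).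
Local Notation gr := (res_gr P).
Local Notation d := (res_d P).
Local Notation sc c x := (((c : F)%:A : A) *: x).
Local Notation ev := (@ev F A P).
Variables (e0 : P).
Hypothesis ge0 : gr (0, 0) e0.
Hypothesis ev_e0 : ev e0 = 1.
Hypothesis bas_deg0 : forall b, bas P b -> (deg b).1 = 0 -> b = sc (ev b) e0.

Lemma deg_bas0 b : bas P b -> (deg b).1 = 0 -> deg b = (0, 0).
Proof.
move=> Bb db; have := gr_uniq (deg_bas Bb) _ (bas_neq0 Bb); apply.
by rewrite {1}(bas_deg0 Bb db); exact: grZ.
Qed.

(** All basis elements of homological degree 0 are scalar multiples of [e0], so the coordinate at
    one of them, b, rescaled by [ev b], is the coordinate at [e0]. *)
Lemma coordinate_exists : exists ce : P -> A,
  [/\ forall a x y, ce (a *: x + y) = a * ce x + ce y,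
      forall n j x, n != 0 -> gr (n, j) x -> ce x = 0 & ce e0 = 1].
Proof.
have [b [Bb gb evb]] := ev_bas P.
have db : deg b = (0, 0) by exact: deg_uniq.
exists (fun x => co P b x * (ev b)%:A); split=> [a x y|n j x n0 gx|].
- by rewrite co_linear mulrDl mulrA.
- by rewrite (co_gr_ne gx Bb) ?mul0r // db eq_sym.
- have -> : e0 = sc (ev b)^-1 b.
    by rewrite {2}(bas_deg0 Bb) ?db // algM mulVf // alg1.
  rewrite coZ co_bas // eqxx mulr1 -scalerAl mul1r scalerA mulVf // scale1r.
  by [].
Qed.

Definition ce : P -> A := projT1 (cid coordinate_exists).

Lemma ceP a x y : ce (a *: x + y) = a * ce x + ce y.
Proof. by rewrite /ce; case: cid => /= ? []. Qed.
Lemma ce_ne n j x : n != 0 -> gr (n, j) x -> ce x = 0.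
Proof. by move: n j x; rewrite /ce; case: cid => /= ? []. Qed.
Lemma ce_e0 : ce e0 = 1.
Proof. by rewrite /ce; case: cid => /= ? []. Qed.
Lemma ceD x y : ce (x + y) = ce x + ce y.
Proof. by have := ceP 1 x y; rewrite scale1r mul1r. Qed.
Lemma ce0 : ce 0 = 0.
Proof. by have := ceP (-1) 0 0; rewrite scaler0 addr0 mulN1r addNr. Qed.
Lemma ceZ a x : ce (a *: x) = a * ce x.
Proof. by have := ceP a x 0; rewrite ce0 !addr0. Qed.

Lemma ce_bas b : bas P b -> (deg b).1 = 0 -> ce b = (ev b)%:A.
Proof. by move=> Bb db; rewrite {1}(bas_deg0 Bb db) ceZ ce_e0 mulr1. Qed.

Lemma ce_sel x : sel P (pred1 0) x = ce x *: e0.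
Proof.
apply: (homogeneous_ind (T := [set x | sel P (pred1 0) x = ce x *: e0])) => /=.
- by rewrite linear0 ce0 scale0r.
- by move=> x1 x2 h1 h2; rewrite (linear_addm (sel _ _)) h1 h2 ceD scalerDl.
- move=> n j {}x gx; rewrite (sel_gr _ gx) /=; case: eqP => [n0|/eqP n0]; last first.
    by rewrite (ce_ne n0 gx) scale0r.
  rewrite n0 in gx; apply: (gr_ind (T := [set x | x = ce x *: e0])) gx => /=.
  - by rewrite ce0 scale0r.
  - by move=> x1 x2 {1}-> {1}->; rewrite -scalerDl ceD.
  - move=> i a b j' _ Bb db _; have db0 : (deg b).1 = 0 by rewrite db.
    by rewrite ceZ ce_bas // {1}(bas_deg0 Bb db0) scalerA.
Qed.

Lemma ce_gr j e p c x : gr (0, j) x -> gr (p, c) e -> gr (p, j + c) (ce x *: e).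
Proof.
move=> gx ge; apply: (gr_ind (T := [set x | gr (p, j + c) (ce x *: e)])) gx => /=.
- by rewrite ce0 scale0r; exact: gr0.
- by move=> x1 x2 h1 h2; rewrite ceD scalerDl; exact: grD.
- move=> i a b j' ai Bb db <-; have db0 : (deg b).1 = 0 by rewrite db.
  have := deg_bas0 Bb db0; rewrite db => -[->]; rewrite addr0 ceZ ce_bas // -scalerA.
  by apply: res_gr_scale => //; exact: grZ.
Qed.

End DegreeZero.

Lemma free_of_dual (R : pzRingType) (V : lmodType R) (B : set V) :
  (forall b, B b -> exists f : V -> R, (forall a x y, f (a *: x + y) = a * f x + f y) /\
     forall b', B b' -> f b' = (b' == b)%:R) ->
  forall k (c : 'I_k -> R) (b : 'I_k -> V), injective b -> (forall i, B (b i)) ->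
    \sum_(i < k) c i *: b i = 0 -> forall i, c i = 0.
Proof.
move=> hB k c b bI Bb e i; have [f [fL fB]] := hB _ (Bb i).
have fD x y : f (x + y) = f x + f y by have := fL 1 x y; rewrite scale1r mul1r.
have f0 : f 0 = 0 by have := fL (-1) 0 0; rewrite scaler0 addr0 mulN1r addNr.
have fZ a x : f (a *: x) = a * f x by have := fL a x 0; rewrite f0 !addr0.
have : f (\sum_(i < k) c i *: b i) = \sum_(i < k) f (c i *: b i).
  by elim/big_rec2: _ => // j y x _ <-; rewrite fD.
rewrite e f0 (bigD1 i) //= big1 => [|j ji]; last first.
  by rewrite fZ fB // (inj_eq bI) (negPf ji) mulr0.
by rewrite fZ fB // eqxx mulr1 addr0.
Qed.

Lemma pr_finite (F : fieldType) (A : graded_algebra F) (M : lmodType A) (G : int -> set M)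
    (N : set M) (P : resolution G N) (x : P) :
  exists r : seq (int * int), forall s, uniq s -> {subset r <= s} ->
    x = \sum_(i <- s) pr P i x.
Proof.
have [r [ur e h]] := gproj_sum (res_grading P) x; exists r => s us rs.
by rewrite {1}e; symmetry; apply: big_uniq_subset => // i _; exact: h.
Qed.

Lemma pr_sel (F : fieldType) (A : graded_algebra F) (M : lmodType A) (G : int -> set M)
    (N : set M) (P : resolution G N) S nj (x : P) : pr P nj (sel P S x) = sel P S (pr P nj x).
Proof.
apply: (@pr_morph _ _ _ _ _ P _ _ (res_grading P) (sel P S) id) => //.
  exact: linear_addm.
by move=> [n j] y; exact: sel_in.
Qed.

(* The cone of th = (th_v)_v : P -> P^I, where th_v lowers degrees by (p, c), with
   the summands P_0 of P^I and P_n, n <= p, of P removed.  These form a subcomplex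
   on which th induces an isomorphism from P_p to P_0^I, so that the rest resolves
   J Omega^p through the connecting map. *)
Section Cone.
Variables (F : fieldType) (A : graded_algebra F) (P : triv_resolution A).
Local Notation gr := (res_gr P).
Local Notation d := (res_d P).
Local Notation sc c x := (((c : F)%:A : A) *: x).
Local Notation ev := (@ev F A P).
Variables (e0 : P).
Hypothesis ge0 : gr (0, 0) e0.
Hypothesis ev_e0 : ev e0 = 1.
Hypothesis bas_deg0 : forall b, bas P b -> (deg b).1 = 0 -> b = sc (ev b) e0.

Variables (I : finType) (p : nat) (c : int) (e : I -> P) (th : I -> {linear P -> P}).
Hypothesis p0 : (0 < p)%N.
Hypothesis e_bas : forall v, bas P (e v).
Hypothesis e_deg : forall v, deg (e v) = (p%:Z, c).
Hypothesis e_all : forall b, bas P b -> (deg b).1 = p%:Z -> exists v, b = e v.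
Hypothesis th_gr : forall v n j x, gr (n, j) x -> gr (n - p%:Z, j - c) (th v x).
Local Notation kap := (eps F p%:Z).
Hypothesis th_d : forall v x, th v (d x) = sc kap (d (th v x)).
Hypothesis th_e : forall v w, th v (e w) = if v == w then e0 else 0.

Local Notation ce := (ce bas_deg0).
Local Notation ge1 := (fun n : int => 1 <= n).
Local Notation gep := (fun n : int => p%:Z + 1 <= n).

Local Notation W := ({ffun I -> P} * P)%type.

Definition cone_pred : pred W :=
  fun w => [forall v, sel P ge1 (w.1 v) == w.1 v] && (sel P gep w.2 == w.2).

Lemma cone_predP (w : W) : reflect ((forall v, sel P ge1 (w.1 v) = w.1 v) /\ sel P gep w.2 = w.2)
  (cone_pred w).
Proof.
apply: (iffP andP) => [[/forallP h /eqP h2]|[h h2]]; first by split=> // v; apply/eqP.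
by split; [apply/forallP => v; apply/eqP|apply/eqP].
Qed.

Lemma cone_submod_closed : GRing.subsemimod_closed cone_pred.
Proof.
split; [split|] => [|w w' /cone_predP[h1 h2] /cone_predP[h1' h2']|a w /cone_predP[h1 h2]];
  apply/cone_predP; split=> [v|] /=.
- by rewrite ffunE linear0.
- by rewrite linear0.
- by rewrite ffunE (linear_addm (sel _ _)) h1 h1'.
- by rewrite (linear_addm (sel _ _)) h2 h2'.
- by rewrite ffunE (linear_scalem (sel _ _)) h1.
- by rewrite (linear_scalem (sel _ _)) h2.
Qed.

HB.instance Definition _ :=
  GRing.isSubmodClosed.Build A W cone_pred cone_submod_closed.

Definition cone : Type := {w : W | cone_pred w}.
HB.instance Definition _ := SubChoice.on cone.
HB.instance Definition _ := [SubChoice_isSubLmodule of cone by <:].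

Lemma cone_mk_proof (x : I -> P) (y : P) :
  cone_pred ([ffun v => sel P ge1 (x v)], sel P gep y).
Proof.
apply/cone_predP; split=> [v|] /=; rewrite ?ffunE sel_sel; apply: eq_sel => n /=.
  by case: (_ <= _).
by case: (_ <= _).
Qed.

Definition cone_mk (x : I -> P) (y : P) : cone :=
  exist (fun w : W => cone_pred w) _ (cone_mk_proof x y).

Lemma compX_linear v : linear (fun w : cone => (val w).1 v).
Proof. by move=> a x y; rewrite /= !ffunE. Qed.

Lemma compY_linear : linear (fun w : cone => (val w).2).
Proof. by []. Qed.

Lemma components_exist : {XY : (I -> {linear cone -> P}) * {linear cone -> P} |
  (forall v (w : cone), XY.1 v w = (val w).1 v) /\ forall w : cone, XY.2 w = (val w).2}.
Proof. by exists (fun v => mklin (compX_linear v), mklin compY_linear). Qed.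

Definition compX v : {linear cone -> P} := (sval components_exist).1 v.
Definition compY : {linear cone -> P} := (sval components_exist).2.

Lemma compXE v (w : cone) : compX v w = (val w).1 v.
Proof. by have [h _] := svalP components_exist; exact: h. Qed.

Lemma compYE (w : cone) : compY w = (val w).2.
Proof. by have [_ h] := svalP components_exist; exact: h. Qed.

Lemma compX_mk v x y : compX v (cone_mk x y) = sel P ge1 (x v).
Proof. by rewrite compXE ffunE. Qed.

Lemma compY_mk x y : compY (cone_mk x y) = sel P gep y. Proof. exact: compYE. Qed.

Lemma compX_sel v w : sel P ge1 (compX v w) = compX v w.
Proof. by rewrite ?compXE ?compYE; case: w => w wP; case/cone_predP: (wP). Qed.

Lemma compY_sel w : sel P gep (compY w) = compY w.
Proof. by rewrite ?compXE ?compYE; case: w => w wP; case/cone_predP: (wP). Qed.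

Lemma cone_eq (w w' : cone) : (forall v, compX v w = compX v w') -> compY w = compY w' -> w = w'.
Proof.
move=> h h2; apply: val_inj; have {}h v := h v; move: h h2.
rewrite !compYE; move=> h; have {}h v : (val w).1 v = (val w').1 v by rewrite -!compXE.
move: h => /=.
case: (val w) => [x y]; case: (val w') => [x' y'] /= h ->; congr pair.
by apply/ffunP.
Qed.

Lemma mk_linear a x y x' y' :
  cone_mk (fun v => a *: x v + x' v) (a *: y + y') = a *: cone_mk x y + cone_mk x' y'.
Proof.
apply: cone_eq => [v|].
  by rewrite (linear_addm (compX v)) (linear_scalem (compX v)) !compX_mk
    (linear_addm (sel _ _)) (linear_scalem (sel _ _)).
by rewrite (linear_addm compY) (linear_scalem compY) !compY_mk
  (linear_addm (sel _ _)) (linear_scalem (sel _ _)).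
Qed.

Lemma d_sel1 x : d (sel P ge1 x) = d x.
Proof.
rewrite sel_d -[RHS]sel_pos; apply: eq_sel => n; lia.
Qed.

Lemma d_selp x : d (sel P gep x) = sel P (fun n => p%:Z <= n) (d x).
Proof. rewrite sel_d; apply: eq_sel => n; lia. Qed.

Lemma th_sel v S x : th v (sel P S x) = sel P (fun n => S (n + p%:Z)) (th v x).
Proof. by apply: sel_map => n j y gy; exists (j - c); exact: th_gr. Qed.

Lemma th_selp v x : th v (sel P gep x) = sel P ge1 (th v x).
Proof. rewrite th_sel; apply: eq_sel => n; lia. Qed.

Lemma kapK (V : lmodType A) (x : V) : sc kap (sc kap x) = x.
Proof. by rewrite algM eps_sqr alg1. Qed.

Lemma d_th v x : d (th v x) = sc kap (th v (d x)).
Proof. by rewrite th_d kapK. Qed.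

(** The factor (-1)^p makes the square of the differential vanish, because [th] commutes with d up
    to the same sign. *)
Definition cone_fun (w : cone) v : P := - sc kap (d (compX v w)) + th v (compY w).

Lemma cone_d_linear : linear (fun w => cone_mk (cone_fun w) (d (compY w))).
Proof.
move=> a w w'; rewrite -mk_linear (linearP compY) (linearP d).
congr cone_mk; apply/funext => v; rewrite /cone_fun (linearP (compX v)) (linearP compY).
rewrite (linearP d) (linearP (th v)) scalerDr -alg_scaleC opprD scalerDr scalerN.
by rewrite -!addrA; congr (_ + _); rewrite addrCA.
Qed.

Definition cone_d : {linear cone -> cone} := mklin cone_d_linear.

Lemma compX_d v w : compX v (cone_d w) = sel P ge1 (cone_fun w v).
Proof. exact: compX_mk. Qed.

Lemma compY_d w : compY (cone_d w) = sel P gep (d (compY w)).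
Proof. exact: compY_mk. Qed.

Lemma d_fun w v : d (cone_fun w v) = sc kap (th v (d (compY w))).
Proof.
rewrite /cone_fun (linear_addm d) (linearN d) (linear_scalem d) res_dd scaler0 oppr0 add0r.
exact: d_th.
Qed.

Lemma cone_dd w : cone_d (cone_d w) = 0.
Proof.
apply: cone_eq => [v|]; last first.
  by rewrite compY_d compY_d d_selp res_dd linear0 (linear0 (sel _ _)) (linear0 compY).
rewrite compX_d (linear0 (compX v)) {1}/cone_fun compX_d d_sel1 d_fun kapK compY_d th_selp.
rewrite (linear_addm (sel _ _)) (linearN (sel _ _)) sel_sel.
by rewrite (@eq_sel _ _ _ _ _ _ (predI ge1 ge1) ge1) ?addNr // => n /=; case: (1 <= n).
Qed.

(** The inverse of [th] from P_p to the sum of the copies of P_0, as [lam_th] and [th_lam] show. *)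
Definition lam (x : I -> P) : P := \sum_v ce (x v) *: e v.

Lemma lam_th x : lam (fun v => th v x) = sel P (pred1 p%:Z) x.
Proof.
apply: (basis_span_ind (bas_span P)
  (T := [set x | lam (fun v => th v x) = sel P (pred1 p%:Z) x])) x => /=.
- rewrite /lam (linear0 (sel _ _)) big1 // => v _; rewrite (linear0 (th v)).
  by rewrite ce0 scale0r.
- move=> x y hx hy; rewrite (linear_addm (sel _ _)) -hx -hy -big_split.
  by apply: eq_bigr => v _; rewrite (linear_addm (th v)) ceD scalerDl.
- move=> a x hx; rewrite (linear_scalem (sel _ _)) -hx /lam scaler_sumr.
  by apply: eq_bigr => v _; rewrite (linear_scalem (th v)) ceZ scalerA.
move=> b Bb /=; have gb := deg_bas Bb; rewrite [deg b]surjective_pairing in gb.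
rewrite (sel_gr _ gb) /=; case: eqP => [db|/eqP db].
  have [w ->] := e_all Bb db; rewrite /lam (bigD1 w) //= th_e eqxx ce_e0 scale1r.
  by rewrite big1 ?addr0 // => v /negPf vw; rewrite th_e vw ce0 scale0r.
rewrite /lam big1 // => v _; rewrite (ce_ne _ _ (th_gr v gb)) ?scale0r //.
by rewrite subr_eq0.
Qed.

Lemma th_lam w x : th w (lam x) = sel P (pred1 0) (x w).
Proof.
rewrite (ce_sel bas_deg0) /lam (linear_sum (th w)) (bigD1 w) //= (linear_scalem (th w)) th_e eqxx.
rewrite big1 ?addr0 // => v /negPf vw.
by rewrite (linear_scalem (th w)) th_e eq_sym vw scaler0.
Qed.

Lemma lamP a x y : lam (fun v => a *: x v + y v) = a *: lam x + lam y.
Proof.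
rewrite /lam scaler_sumr -big_split; apply: eq_bigr => v _.
by rewrite ceP scalerDl scalerA.
Qed.

Lemma lam_sel x : sel P (pred1 p%:Z) (lam x) = lam x.
Proof.
rewrite /lam (linear_sum (sel _ _)); apply: eq_bigr => v _; rewrite (linear_scalem (sel _ _)).
by have := deg_bas (e_bas v); rewrite e_deg => /(sel_gr (pred1 p%:Z)) ->; rewrite /= eqxx.
Qed.

(** The connecting map: the boundaries of the components in P_1 lie in the removed copies of P_0 and
    are carried to the removed P_p. A further d then gives the augmentation. *)
Definition cone_lift (w : cone) : P := lam (fun v => d (compX v w)).

Lemma cone_eps_linear : linear (fun w => d (cone_lift w)).
Proof.
move=> a w w'; rewrite -(linearP d) -lamP; congr (d (lam _)).
by apply/funext => v; rewrite (linearP (compX v)) (linearP d).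
Qed.

Definition cone_eps : {linear cone -> P} := mklin cone_eps_linear.

Lemma cone_eps_d w : cone_eps (cone_d w) = 0.
Proof.
rewrite -[LHS]/(d (cone_lift (cone_d w))) /cone_lift.
have -> : (fun v => d (compX v (cone_d w))) = fun v => sc kap (th v (d (compY w))) + 0.
  by apply/funext => v; rewrite compX_d d_sel1 d_fun addr0.
rewrite lamP [X in _ + X]big1 ?addr0 => [|v _]; last by rewrite ce0 scale0r.
by rewrite lam_th (linear_scalem d) sel_d res_dd linear0 scaler0.
Qed.

Lemma ev_sel S x : S 0 = false -> ev (sel P S x) = 0.
Proof.
move=> S0; apply: (homogeneous_ind (T := [set x | ev (sel P S x) = 0])) => /=.
- by rewrite linear0 ev0.
- by move=> x1 x2 h1 h2; rewrite (linear_addm (sel _ _)) evD h1 h2 addr0.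
- move=> n j {}x gx; rewrite (sel_gr _ gx); case: ifP; last by rewrite ev0.
  move=> Sn; apply: ev_gr gx; apply/eqP => -[n0 _]; by rewrite n0 S0 in Sn.
Qed.

(** The element u of P_p fills in the removed part: y + (-1)^p u is a cycle of P, hence some d y'.
    Then each x_v - th_v y', with y' cut to degrees above p, is a cycle as well, and exactness of P
    is used a second time. *)
Lemma cone_exact w : cone_d w = 0 -> cone_eps w = 0 -> exists w', w = cone_d w'.
Proof.
move=> dw ew; pose x v := compX v w; pose y := compY w; pose u := cone_lift w.
have du : d u = 0 by exact: ew.
have u_sel : sel P (pred1 p%:Z) u = u by exact: lam_sel.
have thu v : th v u = sel P (pred1 0) (d (x v)) by exact: th_lam.
have y_selp : sel P gep y = y by exact: compY_sel.
(* In degrees at least 1 this is [cone_d w = 0]; in degree 0 it is the choice of u. *)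
have key v : th v (y + sc kap u) = sc kap (d (x v)).
  have h0 : sel P ge1 (cone_fun w v) = 0 by rewrite -compX_d dw linear0.
  have := sel_split (pred1 0) (cone_fun w v).
  rewrite [X in _ + X](_ : _ = 0); last first.
    rewrite -[X in sel P _ X]sel_pos sel_sel -[RHS]h0; apply: eq_sel => n /=; lia.
  rewrite addr0 /cone_fun (linear_addm (sel _ _)) (linearN (sel _ _)) (linear_scalem (sel _ _)).
  rewrite -/(x v) -thu -/y -{1}y_selp th_selp sel_sel sel0 => [|n /=]; last by lia.
  rewrite addr0 (linear_addm (th v)) (linear_scalem (th v)) => h.
  by rewrite -[sc kap (th v u)]opprK h opprD opprK addrCA subrr addr0.
(* The boundary of y is concentrated in degree p, where [th] is injective by [lam_th]. *)
have dy : d y = 0.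
  have dyp : sel P (pred1 p%:Z) (d y) = d y.
    have h0 : sel P gep (d y) = 0 by rewrite -compY_d dw linear0.
    have := sel_split (pred1 p%:Z) (d y).
    rewrite [X in _ + X](_ : _ = 0) ?addr0 // -{1}y_selp d_selp sel_sel -[RHS]h0.
    by apply: eq_sel => n /=; lia.
  rewrite -dyp -lam_th /lam big1 // => v _.
  have := congr1 d (key v); rewrite (linear_scalem d) res_dd scaler0 d_th.
  rewrite (linear_addm d) (linear_scalem d) du scaler0 addr0 => h.
  by rewrite -[th v _]kapK h scaler0 ce0 scale0r.
have [y' y'E] : exists y', y + sc kap u = d y'.
  apply: exactP; first by rewrite (linear_addm d) (linear_scalem d) du dy scaler0 addr0.
  rewrite evD evZ -y_selp -u_sel !ev_sel ?mulr0 ?addr0 //=; lia.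
pose y1 := sel P gep y'.
have dy1 : d y1 = y + sc kap u.
  rewrite d_selp -y'E (linear_addm (sel _ _)) (linear_scalem (sel _ _)).
  rewrite -{1}y_selp -{1}u_sel !sel_sel.
  congr (_ + sc kap _); first by rewrite -[RHS]y_selp; apply: eq_sel => n /=; lia.
  by rewrite -[RHS]u_sel; apply: eq_sel => n /=; lia.
have x_sel1 v : sel P ge1 (x v) = x v by exact: compX_sel.
have /choice[x' x'E] v : exists x', x v - th v y1 = d x'.
  apply: exactP; first by rewrite (linearB d) d_th dy1 key kapK subrr.
  by rewrite evB -x_sel1 /y1 th_selp !ev_sel // subrr.
exists (cone_mk (fun v => - sc kap (x' v)) y1); apply: cone_eq => [v|].
  rewrite compX_d /cone_fun compX_mk compY_mk d_sel1 (linearN d) (linear_scalem d).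
  rewrite scalerN opprK kapK -x'E /y1 sel_sel.
  rewrite (@eq_sel _ _ _ _ _ _ (predI gep gep) gep) => [|n /=]; last by case: (_ <= n).
  by rewrite subrK x_sel1.
rewrite compY_d compY_mk /y1 sel_sel.
rewrite (@eq_sel _ _ _ _ _ _ (predI gep gep) gep) => [|n /=]; last by case: (_ <= n).
rewrite -/y1 dy1 (linear_addm (sel _ _)) (linear_scalem (sel _ _)) y_selp.
rewrite -u_sel sel_sel sel0 ?scaler0 ?addr0 //.
by move=> n /=; lia.
Qed.

(** The shifts put P_1 of every copy in degree 0 and P_{p+1} in degree 1, so degree 0 of the cone
    consists of the copies of P_1, which cover the copies of J P_0. *)
Definition cone_gr (b : int * int) : set cone :=
  [set w | (forall v, gr (b.1 + 1, b.2 - c) (compX v w)) /\ gr (p%:Z + b.1, b.2) (compY w)].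

Lemma cone_grading : is_grading cone_gr.
Proof.
split=> [b|w|s f us fg f0 b bs].
- split=> [|w w' [w1 w2] [w1' w2']]; split=> [v|].
  + by rewrite linear0; exact: gr0.
  + by rewrite linear0; exact: gr0.
  + by rewrite (linearB (compX v)); exact: grB.
  + by rewrite (linearB compY); exact: grB.
- pose f (b : int * int) := cone_mk (fun v => pr P (b.1 + 1, b.2 - c) (compX v w))
    (pr P (p%:Z + b.1, b.2) (compY w)).
  have fX v b : compX v (f b) = pr P (b.1 + 1, b.2 - c) (compX v w).
    by rewrite compX_mk -pr_sel compX_sel.
  have fY b : compY (f b) = pr P (p%:Z + b.1, b.2) (compY w).
    by rewrite compY_mk -pr_sel compY_sel.
  have [rX hX] := choice (fun v => pr_finite (compX v w)); have [rY hY] := pr_finite (compY w).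
  pose hx (b : int * int) := (b.1 + 1, b.2 - c).
  pose hy (b : int * int) := (p%:Z + b.1, b.2).
  have hxI : injective hx by move=> [? ?] [? ?] [/addIr -> /addIr ->].
  have hyI : injective hy by move=> [? ?] [? ?] [/addrI -> ->].
  pose s := undup (flatten [seq [seq (b.1 - 1, b.2 + c) | b <- rX v] | v <- enum I] ++
    [seq (b.1 - p%:Z, b.2) | b <- rY]).
  exists s, f; split=> [|b|]; first exact: undup_uniq.
    by split=> [v|]; [rewrite fX; exact: pr_in|rewrite fY; exact: pr_in].
  apply: cone_eq => [v|].
    rewrite (linear_sum (compX v)); under eq_bigr do rewrite fX.
    rewrite -(big_map hx xpredT (fun b => pr P b (compX v w))).
    apply: hX; first by rewrite map_inj_uniq ?undup_uniq.
    move=> b br; apply/mapP; exists (b.1 - 1, b.2 + c); last by rewrite /hx /= subrK addrK -surjective_pairing.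
    rewrite mem_undup mem_cat; apply/orP; left; apply/flattenP.
    by exists [seq (b.1 - 1, b.2 + c) | b <- rX v]; apply: map_f; rewrite ?mem_enum.
  rewrite (linear_sum compY); under eq_bigr do rewrite fY.
  rewrite -(big_map hy xpredT (fun b => pr P b (compY w))).
  apply: hY; first by rewrite map_inj_uniq ?undup_uniq.
  move=> b br; apply/mapP; exists (b.1 - p%:Z, b.2); last first.
    by rewrite /hy /= addrCA subrr addr0 -surjective_pairing.
  by rewrite mem_undup mem_cat; apply/orP; right; apply: map_f.
- apply: cone_eq => [v|]; rewrite linear0.
    apply: (gr_free (P := P) (h := fun b => (b.1 + 1, b.2 - c)) (c := fun b => compX v (f b))) bs => //.
    + by move=> [? ?] [? ?] [/addIr -> /addIr ->].
    + by move=> i; have [+ _] := fg i; exact.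
    + by rewrite -(linear_sum (compX v)) f0 linear0.
  apply: (gr_free (P := P) (h := fun b => (p%:Z + b.1, b.2)) (c := fun b => compY (f b))) bs => //.
  + by move=> [? ?] [? ?] [/addrI -> ->].
  + by move=> i; have [_ +] := fg i; exact.
  + by rewrite -(linear_sum compY) f0 linear0.
Qed.

Lemma cone_gr_scale i n j a w : gcomp i a -> cone_gr (n, j) w -> cone_gr (n, i%:Z + j) (a *: w).
Proof.
move=> ai [h1 h2]; split=> [v|] /=.
  by rewrite (linear_scalem (compX v)) -addrA; exact: res_gr_scale (h1 v).
by rewrite (linear_scalem compY); exact: res_gr_scale h2.
Qed.

Lemma cone_gr_neg n j : n < 0 -> cone_gr (n, j) = [set 0].
Proof.
move=> n0; apply/seteqP; split=> [w [h1 h2]|_ ->]; last first.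
  by split=> [v|]; rewrite linear0; exact: gr0.
apply: cone_eq => [v|]; rewrite linear0.
  by rewrite -compX_sel (sel_gr _ (h1 v)) /= ifF //; lia.
by rewrite -compY_sel (sel_gr _ h2) /= ifF //; lia.
Qed.

Lemma cone_d_gr n j w : cone_gr (n, j) w -> cone_gr (n - 1, j) (cone_d w).
Proof.
move=> [/= h1 h2]; have h2d := res_d_gr h2; split=> [v|] /=.
  rewrite compX_d; apply/sel_in/grD.
    apply/grN/grZ; have := res_d_gr (h1 v); rewrite addrK subrK; exact.
  by have := th_gr v h2; rewrite subrK addrAC subrr add0r; exact.
by rewrite compY_d addrA; exact: sel_in.
Qed.

Lemma cone_eps_gr0 j w : cone_gr (0, j) w -> gr (p%:Z - 1, j) (cone_eps w).
Proof.
move=> [/= h1 _]; apply: res_d_gr; apply: gr_sum => v _.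
have := res_d_gr (h1 v); rewrite add0r subrr => hd.
have ge : gr (p%:Z, c) (e v) by rewrite -(e_deg v); exact/deg_bas.
by have := ce_gr ge0 bas_deg0 hd ge; rewrite subrK.
Qed.

Lemma cone_eps_gr n j w : n != 0 -> cone_gr (n, j) w -> cone_eps w = 0.
Proof.
move=> n0 [/= h1 _]; rewrite -[LHS]/(d (cone_lift w)) /cone_lift /lam big1 ?linear0 // => v _.
by have := res_d_gr (h1 v); rewrite addrK => /(ce_ne _ n0) ->; rewrite scale0r.
Qed.

Definition inX v (b : P) : cone := cone_mk (fun u => if u == v then b else 0) 0.
Definition inY (b : P) : cone := cone_mk (fun=> 0) b.

Lemma inX_linear v : linear (inX v).
Proof.
move=> a x y; rewrite /inX -mk_linear scaler0 addr0; congr cone_mk.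
by apply/funext => u; case: ifP => // _; rewrite scaler0 addr0.
Qed.

Lemma inY_linear : linear inY.
Proof.
move=> a x y; rewrite /inY -mk_linear; congr cone_mk.
by apply/funext => u; rewrite scaler0 addr0.
Qed.

Lemma compX_inX u v b : compX u (inX v b) = if u == v then sel P ge1 b else 0.
Proof. by rewrite compX_mk; case: ifP => // _; rewrite linear0. Qed.
Lemma compY_inX v b : compY (inX v b) = 0. Proof. by rewrite compY_mk linear0. Qed.
Lemma compX_inY u b : compX u (inY b) = 0. Proof. by rewrite compX_mk linear0. Qed.
Lemma compY_inY b : compY (inY b) = sel P gep b. Proof. exact: compY_mk. Qed.

Lemma cone_sum w : w = \sum_v inX v (compX v w) + inY (compY w).
Proof.
apply: cone_eq => [v|].
  rewrite (linear_addm (compX v)) compX_inY addr0 (linear_sum (compX v)) (bigD1 v) //=.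
  rewrite compX_inX eqxx compX_sel big1 ?addr0 // => u uv.
  by rewrite compX_inX eq_sym (negPf uv).
rewrite (linear_addm compY) compY_inY compY_sel (linear_sum compY) big1 ?add0r // => v _.
exact: compY_inX.
Qed.

Definition cone_bas : set cone :=
  [set w | (exists v b, [/\ bas P b, 1 <= (deg b).1 & w = inX v b]) \/
           (exists b, [/\ bas P b, p%:Z + 1 <= (deg b).1 & w = inY b])].

Lemma sel_bas S b : bas P b -> sel P S b = if S (deg b).1 then b else 0.
Proof.
move=> Bb; have := deg_bas Bb; rewrite [deg b]surjective_pairing => /(sel_gr S) ->.
by [].
Qed.

Lemma inX_gr v n j b : gr (n, j) b -> cone_gr (n - 1, j + c) (inX v b).
Proof.
move=> gb; split=> [u|] /=; last by rewrite compY_inX; exact: gr0.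
rewrite compX_inX subrK addrK; case: ifP => _; [exact: sel_in|exact: gr0].
Qed.

Lemma inY_gr n j b : gr (n, j) b -> cone_gr (n - p%:Z, j) (inY b).
Proof.
move=> gb; split=> [u|] /=; first by rewrite compX_inY; exact: gr0.
by rewrite compY_inY addrCA subrr addr0; exact: sel_in.
Qed.

Lemma cone_bas_span : lspan cone_bas = setT.
Proof.
apply/seteqP; split=> // w _; rewrite [w]cone_sum; apply: lspanD.
  apply: lspan_sum => v _; move: (compX v w).
  apply: (basis_span_ind (bas_span P) (T := [set x | lspan cone_bas (inX v x)])) => /=.
  - by rewrite -[inX v]/(mklin (inX_linear v) : _ -> _) linear0; exact: lspan0.
  - move=> x y hx hy; rewrite -[inX v]/(mklin (inX_linear v) : _ -> _) linearD.
    exact: lspanD.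
  - move=> a x hx; rewrite -[inX v]/(mklin (inX_linear v) : _ -> _) (linear_scalem (mklin _)).
    exact: lspanZ.
  - move=> b Bb /=; case: (boolP (1 <= (deg b).1)) => db.
      by apply: lspan_incl; left; exists v, b.
    have -> : inX v b = 0; last exact: lspan0.
    apply: cone_eq => [u|]; rewrite linear0 ?compY_inX // compX_inX sel_bas // (negPf db).
    by case: ifP.
move: (compY w).
apply: (basis_span_ind (bas_span P) (T := [set x | lspan cone_bas (inY x)])) => /=.
- by rewrite -[inY]/(mklin inY_linear : _ -> _) linear0; exact: lspan0.
- by move=> x y hx hy; rewrite -[inY]/(mklin inY_linear : _ -> _) linearD; exact: lspanD.
- move=> a x hx; rewrite -[inY]/(mklin inY_linear : _ -> _) (linear_scalem (mklin _)).
  exact: lspanZ.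
- move=> b Bb /=; case: (boolP (p%:Z + 1 <= (deg b).1)) => db.
    by apply: lspan_incl; right; exists b.
  have -> : inY b = 0; last exact: lspan0.
  apply: cone_eq => [u|]; rewrite linear0 ?compX_inY // compY_inY sel_bas //.
  by rewrite (negPf db).
Qed.

Lemma cone_bas_dual w : cone_bas w -> exists f : cone -> A,
  (forall a x y, f (a *: x + y) = a * f x + f y) /\
  forall w', cone_bas w' -> f w' = (w' == w)%:R.
Proof.
case=> [[v [b [Bb db ->]]]|[b [Bb db ->]]].
  exists (co P b \o compX v); split=> [a x y|w'] /=.
    by rewrite (linearP (compX v)) co_linear.
  have vb : compX v (inX v b) = b by rewrite compX_inX eqxx sel_bas // db.
  have [->|nw] := eqVneq w' (inX v b); first by rewrite vb co_bas // eqxx.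
  case=> [[v' [b' [Bb' db' e']]]|[b' [Bb' db' ->]]]; last by rewrite compX_inY co0.
  rewrite e' compX_inX; case: eqP => [vv|_]; last by rewrite co0.
  rewrite sel_bas // db' co_bas //; case: eqP => // bb.
  by move: nw; rewrite e' vv bb eqxx.
exists (co P b \o compY); split=> [a x y|w'] /=.
  by rewrite (linearP compY) co_linear.
have vb : compY (inY b) = b by rewrite compY_inY sel_bas // db.
have [->|nw] := eqVneq w' (inY b); first by rewrite vb co_bas // eqxx.
case=> [[v' [b' [Bb' db' ->]]]|[b' [Bb' db' e']]]; first by rewrite compY_inX co0.
rewrite e' compY_inY sel_bas // db' co_bas //; case: eqP => // bb.
by move: nw; rewrite e' bb eqxx.
Qed.

Lemma cone_free : exists B : set cone,
  [/\ forall b, B b -> exists nj, cone_gr nj b, lspan B = setT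
    & forall k (a : 'I_k -> A) (b : 'I_k -> cone), injective b -> (forall i, B (b i)) ->
        \sum_(i < k) a i *: b i = 0 -> forall i, a i = 0].
Proof.
exists cone_bas; split; [|exact: cone_bas_span|exact: free_of_dual cone_bas_dual].
move=> w [[v [b [Bb _ ->]]]|[b [Bb _ ->]]]; have := deg_bas Bb;
  rewrite [deg b]surjective_pairing => gb; eexists.
  exact: inX_gr gb.
exact: inY_gr gb.
Qed.

Lemma syzygyP x : syzygy P p x <-> exists y, sel P (pred1 p%:Z) y = y /\ x = d y.
Proof.
have compP y : res_comp P (p%:Z - 1) y <-> sel P (pred1 (p%:Z - 1)) y = y.
  split=> [|h].
    move: y; apply: lspan_min => /=.
    - exact: linear0.
    - by move=> u v hu hv; rewrite (linear_addm (sel _ _)) hu hv.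
    - by move=> a v hv; rewrite (linear_scalem (sel _ _)) hv.
    - by move=> y [j _ gy]; rewrite (sel_gr _ gy) /= eqxx.
  rewrite -h; apply: (homogeneous_ind (T := [set y | res_comp P (p%:Z - 1) (sel P (pred1 (p%:Z - 1)) y)])) => /=.
  - by rewrite linear0; exact: lspan0.
  - by move=> u v hu hv; rewrite (linear_addm (sel _ _)); exact: lspanD.
  - move=> n j z gz; rewrite (sel_gr _ gz) /=; case: eqP => [n1|_]; last exact: lspan0.
    by apply: lspan_incl; exists j => //; rewrite -n1.
split=> [[/compP hx dx ex]|[y [hy ->]]].
  have [y xy] := exactP dx ex; exists (sel P (pred1 p%:Z) y); split.
    by rewrite sel_sel; apply: eq_sel => n /=; case: (_ == _).
  by rewrite sel_d -xy -{1}hx; apply: eq_sel => n /=; rewrite [LHS]eq_sym subr_eq eq_sym.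
split; [apply/compP|exact: res_dd|exact: ev_d].
rewrite -hy sel_d sel_sel; apply: eq_sel => n /=.
by rewrite [n == _]eq_sym subr_eq eq_sym andbb.
Qed.

(** The boundaries from P_1 are exactly J e0; through [lam] they fill J P_p, which d maps onto J
    Omega^p. *)
Lemma cone_eps_im : range cone_eps = Jmul (syzygy P p).
Proof.
apply/seteqP; split=> [_ [w _ <-]|].
  rewrite -[cone_eps w]/(d (cone_lift w)) /cone_lift /lam (linear_sum d).
  apply: lspan_sum => v _; apply: lspan_incl; exists (ce (d (compX v w))), (d (e v)).
  split; last by rewrite (linear_scalem d).
    apply/aug_ideal_aug; move: (d _) (ev_d (compX v w)) => z.
    rewrite -{1}(sel_split (pred1 0) z) evD (@ev_sel (predC (pred1 0))) // addr0 (ce_sel bas_deg0) evZ.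
    by rewrite ev_e0 mulr1.
  apply/syzygyP; exists (e v); split=> //.
  by rewrite sel_bas // e_deg /= eqxx.
apply: lspan_min => [|x y [w _ <-] [w' _ <-]|a x [w _ <-]|_ [a [x [aJ /syzygyP[y [hy ->]] ->]]]].
- by exists 0 => //; rewrite linear0.
- by exists (w + w') => //; rewrite (linear_addm cone_eps).
- by exists (a *: w) => //; rewrite (linear_scalem cone_eps).
(* The coefficient lies in J because a does, so the multiple of [e0] is a boundary. *)
have /choice[z zE] v : exists z, (a * ce (th v y)) *: e0 = d z.
  have a0 : aug (a * ce (th v y)) = 0.
    have a0 : aug a = 0 by apply/aug_ideal_aug.
    by rewrite rmorphM /= a0 mul0r.
  apply: exactP; last by rewrite evZ a0 mul0r.
  by rewrite (linear_scalem d) (d_gr0 ge0) scaler0.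
exists (cone_mk z 0) => //; rewrite -[LHS]/(d (cone_lift (cone_mk z 0))) /cone_lift.
have -> : lam (fun v => d (compX v (cone_mk z 0))) = a *: lam (fun v => th v y).
  rewrite /lam scaler_sumr; apply: eq_bigr => v _.
  by rewrite compX_mk d_sel1 -zE ceZ ce_e0 mulr1 scalerA.
by rewrite lam_th hy (linear_scalem d).
Qed.

Definition cone_resolution : resolution (fun j => gr (p%:Z - 1, j)) (Jmul (syzygy P p)) :=
  Resolution cone_grading cone_gr_scale cone_gr_neg cone_free cone_d_gr cone_eps_gr0
    cone_eps_gr cone_dd cone_eps_d cone_exact cone_eps_im.

Hypothesis hmin : minimal P.

Lemma cochain_inX (psi : cone -> F^o) v n j : cochain_at cone_resolution (n, j) psi ->
  cochain_at P (n + 1, j - c) (psi \o inX v).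
Proof.
move=> [h1 h2]; split=> [a x y|[n' j'] x bb gx] /=.
  by rewrite inX_linear h1.
apply: h2 (inX_gr v gx); apply: contraNneq bb => -[<- <-].
by rewrite subrK addrK.
Qed.

Lemma cochain_inY (psi : cone -> F^o) n j : cochain_at cone_resolution (n, j) psi ->
  cochain_at P (p%:Z + n, j) (psi \o inY).
Proof.
move=> [h1 h2]; split=> [a x y|[n' j'] x bb gx] /=.
  by rewrite inY_linear h1.
apply: h2 (inY_gr gx); apply: contraNneq bb => -[<- <-].
by rewrite addrCA subrr addr0.
Qed.

Lemma cochain_compY (chi : P -> F^o) n j : cochain_at P (p%:Z + n, j) chi ->
  cochain_at cone_resolution (n, j) (chi \o compY).
Proof.
move=> [h1 h2]; split=> [a x y|[n' j'] w bb [_ gy]] /=.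
  by rewrite (linearP compY) h1.
by apply: h2 gy; apply: contraNneq bb => -[/addrI -> ->].
Qed.

Lemma cochain_compX (psi : P -> F^o) v n j : cochain_at P (n + 1, j - c) psi ->
  cochain_at cone_resolution (n, j) (psi \o compX v).
Proof.
move=> [h1 h2]; split=> [a x y|[n' j'] w bb [gx _]] /=.
  by rewrite (linearP (compX v)) h1.
by apply: h2 (gx v); apply: contraNneq bb => -[/addIr -> /addIr ->].
Qed.

Lemma cochain_at_sum (n j : int) (ps : I -> cone -> F^o) :
  (forall v, cochain_at cone_resolution (n, j) (ps v)) ->
  cochain_at cone_resolution (n, j) (fun w => \sum_v ps v w).
Proof.
move=> h; have -> : (fun w => \sum_v ps v w) = \sum_v ps v.
  by apply/funext => w; rewrite fct_sumE.
elim/big_rec: _ => [|v f _ hf]; first exact: cochain_at0.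
by have := cochain_atP 1 (h v) hf; rewrite scale1r.
Qed.

Lemma cochain_cone (psi : cone -> F^o) b w : cochain_at cone_resolution b psi ->
  psi w = \sum_v psi (inX v (compX v w)) + psi (inY (compY w)).
Proof.
move=> [hL _].
have hD x y : psi (x + y) = psi x + psi y.
  by have := hL 1 x y; rewrite scale1r rmorph1 mul1r.
have h0 : psi 0 = 0.
  by have := hL (-1) 0 0; rewrite scaler0 addr0 rmorphN1 mulN1r addNr.
rewrite {1}[w]cone_sum hD; congr (_ + _).
by elim/big_rec2: _ => [|v y x _ <-] //; rewrite hD.
Qed.

(** The components of a 2-cochain on the copies of P have bidegree (3, q) and vanish by [h3]; its
    component on P has bidegree (p + 2, c + q). In the coboundary of a 1-cochain, the internal
    differentials contribute 0 by minimality, so only the sum of the psi_v th_v remains. *)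
Lemma cone_Ext (q : int) : (forall phi, cochain_at P (3, q) phi -> forall x, phi x = 0) ->
  Ext_bi cone_resolution (2, c + q) `<=` [set 0] <->
  forall chi, cochain_at P (p%:Z + 2, c + q) chi -> exists psi : I -> P -> F^o,
    (forall v, cochain_at P (2, q) (psi v)) /\ forall x, chi x = \sum_v psi v (th v x).
Proof.
move=> h3; have cq : c + q - c = q by rewrite addrAC subrr add0r.
split=> [/Ext_bi_eq0 h chi hchi|h].
  have [||psi hpsi e2] := h (chi \o compY); first exact: cochain_compY.
    apply/funext => w; rewrite -[LHS]/(chi (compY (cone_d w))) compY_d.
    rewrite (cochain_sel (S := gep) _ hchi) /=; last by lia.
    by rewrite (alin_d hmin) //; case: hchi.
  exists (fun v => psi \o inX v); split=> [v|x].
    by have := cochain_inX v hpsi; rewrite cq subrK.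
  have <- : chi (compY (inY x)) = chi x.
    by rewrite compY_inY (cochain_sel (S := gep) _ hchi) //=; lia.
  have := congr1 (@^~ (inY x)) e2 => /= ->; rewrite (cochain_cone _ hpsi).
  have hY := cochain_inY hpsi.
  have -> : psi (inY (compY (cone_d (inY x)))) = 0.
    rewrite compY_d compY_inY -[LHS]/((psi \o inY) _).
    rewrite (cochain_sel (S := gep) _ hY) /=; last by lia.
    by apply: (alin_d hmin (phi := psi \o inY)); case: hY.
  rewrite addr0; apply: eq_bigr => v _; rewrite compX_d /=.
  have hX := cochain_inX v hpsi; rewrite -[LHS]/((psi \o inX v) _).
  rewrite (cochain_sel (S := ge1) _ hX) //= /cone_fun compX_inY !linear0 scaler0 oppr0 add0r.
  rewrite compY_inY th_selp -[LHS]/((psi \o inX v) _) (cochain_sel (S := ge1) _ hX) //.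
apply/Ext_bi_eq0 => phi hphi dphi.
have phiX v x : phi (inX v x) = 0.
  by have := cochain_inX v hphi; rewrite cq => /h3; exact.
have phiE w : phi w = phi (inY (compY w)).
  by rewrite (cochain_cone w hphi) big1 ?add0r.
have [psi [hpsi psiE]] := h _ (cochain_inY hphi).
exists (fun w => \sum_v psi v (compX v w)).
  by apply: cochain_at_sum => v; apply: cochain_compX; rewrite cq.
apply/funext => w; rewrite phiE -[LHS]/((phi \o inY) (compY w)) psiE /=.
apply: eq_bigr => v _; rewrite compX_mk (cochain_sel (S := ge1) _ (hpsi v)) //.
have pL : alin (psi v) by case: (hpsi v).
rewrite /cone_fun (alinD pL) (alinN _ pL) (alinZ _ _ pL) (alin_d hmin _ pL).
by rewrite mulr0 oppr0 add0r.
Qed.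

End Cone.

(** * The equivalence *)

Section DeltaDegrees.
Variables (F : fieldType) (A : graded_algebra F) (dd : nat).

(** The bi-Koszul condition provides one resolution in the prescribed degrees; the vanishing of Ext
    carries this to every resolution. *)
Lemma bi_koszul_Ext (P0 P : triv_resolution A) (n : nat) j :
  (forall n : nat, res_comp P0 n = lspan (res_gr P0 (n%:Z, (Delta dd n).1%:Z) `|`
     res_gr P0 (n%:Z, (Delta dd n).2%:Z))) ->
  j != (Delta dd n).1%:Z -> j != (Delta dd n).2%:Z -> Ext_bi P (n%:Z, j) `<=` [set 0].
Proof.
move=> hP0 j1 j2; apply: (Ext_bi_eq0_transfer (@triv_grB _ _) (@triv_gr_free _ _) (P := P0)).
apply/Ext_bi_eq0 => phi [phiL phi0] _; exists 0; first exact: cochain_at0.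
apply/funext => x; rewrite -[RHS]/(0 : F).
apply: (homogeneous_ind (T := [set x | phi x = 0])) => /= [|x1 x2 h1 h2|n' j' {}x gx].
- exact: (alin0 phiL).
- by rewrite (alinD phiL) h1 h2 addr0.
have [[n'E j'E]|/eqP nj] := eqVneq (n', j') (n%:Z, j); last by apply: phi0 gx; apply/eqP.
have : res_comp P0 n x by apply: lspan_incl; exists j' => //; rewrite -n'E.
rewrite hP0; move: x {gx}; apply: lspan_min => /= [|u v hu hv|a v hv|v [gv|gv]].
- exact: (alin0 phiL).
- by rewrite (alinD phiL) hu hv addr0.
- by rewrite (alinZ _ _ phiL) hv mulr0.
- by apply: phi0 gv; rewrite xpair_eqE eqxx eq_sym.
- by apply: phi0 gv; rewrite xpair_eqE eqxx eq_sym.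
Qed.

Variable P : triv_resolution A.
Hypothesis hmin : minimal P.

(** The class dual to a basis element is nonzero over a minimal resolution, so vanishing of Ext
    confines the degrees of the basis. *)
Lemma minimal_Delta :
  (forall (n : nat) j, j != (Delta dd n).1%:Z -> j != (Delta dd n).2%:Z ->
     Ext_bi P (n%:Z, j) `<=` [set 0]) -> Delta_degrees P dd.
Proof.
move=> h n b Bb db; rewrite !inE; apply: contrapT => /negP; rewrite negb_or => /andP[j1 j2].
have dE : deg b = (n%:Z, (deg b).2) by rewrite -db -surjective_pairing.
have hb := dual_bas_cochain Bb; rewrite dE in hb.
have [|psi hpsi e] := (Ext_bi_eq0 P _ _).1 (h n _ j1 j2) _ hb.
  by apply/funext => x; rewrite -[LHS]/(dual_bas b (res_d P x)) alin_d //; exact: dual_bas_alin.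
have := congr1 (@^~ b) e; rewrite /= alin_d //; last by case: hpsi.
rewrite /dual_bas co_bas // eqxx rmorph1 => /eqP.
by rewrite oner_eq0.
Qed.

End DeltaDegrees.

(** * Factorization through lifts of a basis of E^{3k} *)

Section Factorization.
Variables (F : fieldType) (A : graded_algebra F) (P : triv_resolution A) (dd : nat).
Hypothesis hdd : (2 <= dd)%N.
Hypothesis hmin : minimal P.
Hypothesis hB : Delta_degrees P dd.
Local Notation gr := (res_gr P).
Local Notation d := (res_d P).
Local Notation par := (par P).
Local Notation sc c x := (((c : F)%:A : A) *: x).
Local Notation ev := (@ev F A P).
Variables (e0 : P) (s : P -> P).
Hypothesis ge0 : gr (0, 0) e0.
Hypothesis ev_e0 : ev e0 = 1.
Hypothesis bas_deg0 : forall b, bas P b -> (deg b).1 = 0 -> b = sc (ev b) e0.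
Hypothesis sP : forall (c : F) x y, s (sc c x + y) = sc c (s x) + s y.
Hypothesis s_gr : forall n j x, gr (n, j) x -> gr (n + 1, j) (s x).
Hypothesis ds : forall x, d (s x) + s (d x) = x - sc (ev x) e0.
Hypothesis ss : forall x, s (s x) = 0.
Hypothesis s_e0 : s e0 = 0.
Hypothesis ev_s : forall x, ev (s x) = 0.
Hypothesis s_gen : forall x, generators x -> s x = 0.

Variable k : nat.
Hypothesis k1 : (1 <= k)%N.

Lemma degree_basis : exists (r : nat) (e : 'I_r -> P), [/\ injective e,
  forall v, bas P (e v), forall v, deg (e v) = ((3 * k)%N%:Z, (2 * dd * k)%N%:Z)
  & forall b, bas P b -> (deg b).1 = (3 * k)%N%:Z -> exists v, b = e v].
Proof.
have [bs [ubs bsP bsA]] := finite_basis_at hmin hB (3 * k) (2 * dd * k)%N%:Z.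
exists (size bs), (fun v => nth 0 bs v); split=> [v w /eqP|v|v|b Bb db].
- by rewrite nth_uniq // => /eqP/ord_inj.
- by have [] := bsP _ (mem_nth 0 (ltn_ord v)).
- by have [] := bsP _ (mem_nth 0 (ltn_ord v)).
have bb : b \in bs.
  apply: bsA => //; have := hB Bb db; rewrite Delta0 !inE orbb => /eqP <-.
  by rewrite -db -surjective_pairing.
have ib : (index b bs < size bs)%N by rewrite index_mem.
by exists (Ordinal ib); rewrite /= nth_index.
Qed.

Variables (I : finType) (e : I -> P).
Hypothesis e_inj : injective e.
Hypothesis e_bas : forall v, bas P (e v).
Hypothesis e_deg : forall v, deg (e v) = ((3 * k)%N%:Z, (2 * dd * k)%N%:Z).
Hypothesis e_all : forall b, bas P b -> (deg b).1 = (3 * k)%N%:Z -> exists v, b = e v.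

Local Notation th v := (ifun e0 s (dual_bas (e v))).

Lemma ifun_endo_d b phi : cochain_at P b phi -> endo_d b.1 (ifun e0 s phi) = fun=> 0.
Proof.
move=> hphi; have phiL : alin phi by case: hphi.
apply/funext => x; rewrite -(Df_endo (ifun_endo ge0 s_gr hphi)).
exact: (Df_ifun hmin ge0 ev_e0 sP ds ev_s).
Qed.

Lemma th_endo v : endo ((3 * k)%N%:Z, (2 * dd * k)%N%:Z) (th v).
Proof. by rewrite -(e_deg v); apply: (ifun_endo ge0 s_gr); exact: dual_bas_cochain. Qed.

Lemma th_endo_d v : endo_d (3 * k)%N%:Z (th v) = fun=> 0.
Proof. by have := ifun_endo_d (dual_bas_cochain (e_bas v)); rewrite e_deg. Qed.

Lemma th_gr v n j x : gr (n, j) x -> gr (n - (3 * k)%N%:Z, j - (2 * dd * k)%N%:Z) (th v x).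
Proof. by move=> gx; have := endo_gr (th_endo v) gx. Qed.

Lemma th_d v x : th v (d x) = sc (eps F (3 * k)%N%:Z) (d (th v x)).
Proof.
have /eqP := congr1 (@^~ x) (th_endo_d v); rewrite /endo_d subr_eq0 => /eqP ->.
by rewrite -sc_eps algM eps_sqr alg1.
Qed.

Lemma th_e v w : th v (e w) = if v == w then e0 else 0.
Proof.
rewrite ifunE //; have gd := d_bas (e_bas w).
rewrite (par_gr gd) (linear_scalem (ifun _ _ _)) (gr_neg0 _ (th_gr v gd)); last first.
  by rewrite e_deg /=; lia.
rewrite scaler0 (linear0 par) (s0 sP) addr0 /dual_bas co_bas // (inj_eq e_inj).
by case: (v == w); rewrite ?rmorph1 ?rmorph0 ?alg1 ?alg0.
Qed.

Let k3 : (0 < 3 * k)%N. Proof. by rewrite muln_gt0. Qed.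

Definition model_cone : resolution (fun j => gr ((3 * k)%N%:Z - 1, j)) (Jmul (syzygy P (3 * k))) :=
  cone_resolution ge0 ev_e0 bas_deg0 k3 e_bas e_deg e_all th_gr th_d th_e.

Lemma model_cone_Ext :
  Ext_bi model_cone (2, (2 * k * dd + dd + 1)%N%:Z) `<=` [set 0] <->
  forall chi, cochain_at P ((3 * k + 2)%N%:Z, (2 * dd * k + dd + 1)%N%:Z) chi ->
  exists psi : I -> P -> F^o,
    (forall v, cochain_at P (2, (dd + 1)%N%:Z) (psi v)) /\ forall x, chi x = \sum_v psi v (th v x).
Proof.
have -> : (2 * k * dd + dd + 1)%N = (2 * dd * k + (dd + 1))%N by lia.
rewrite -addnA !PoszD; apply: cone_Ext => // phi hphi x.
(* E^3 lives in lower degree 2d, which differs from d + 1 because d is at least 2. *)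
have [D1 D2] : (Delta dd 3).1 = (2 * dd)%N /\ (Delta dd 3).2 = (2 * dd)%N.
  by rewrite (Delta0 dd 1) muln1.
by apply: (cochain_Delta hB (n := 3)) hphi; rewrite ?D1 ?D2; lia.
Qed.

Lemma ifun_sum (a : I -> F) (phi : I -> P -> F) x :
  ifun e0 s (fun x => \sum_v a v * phi v x) x = \sum_v sc (a v) (ifun e0 s (phi v) x).
Proof.
have i0 : ifun e0 s (fun=> 0) x = 0.
  have := ifunP e0 sP (-1) (fun=> 0) (fun=> 0) x; rewrite algN1_opp addNr => <-.
  by congr (ifun e0 s _ x); apply/funext => y; rewrite mulr0 addr0.
elim: (index_enum I) => [|v r IH].
  by rewrite big_nil -i0; congr (ifun e0 s _ x); apply/funext => y; rewrite big_nil.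
rewrite big_cons -IH -(ifunP e0 sP); congr (ifun e0 s _ x).
by apply/funext => y; rewrite big_cons.
Qed.

Lemma dual_expansion phi : cochain_at P ((3 * k)%N%:Z, (2 * dd * k)%N%:Z) phi ->
  phi = fun x => \sum_v phi (e v) * dual_bas (e v) x.
Proof.
move=> [phiL phi0]; apply/funext; apply: alin_eq => // [a x y|b Bb].
  rewrite mulr_sumr -big_split; apply: eq_bigr => v _.
  by rewrite dual_bas_alin mulrDr mulrCA.
have [db|db] := eqVneq (deg b).1 (3 * k)%N%:Z.
  have [w ->] := e_all Bb db; rewrite (bigD1 w) //= big1 => [|v vw].
    by rewrite /dual_bas co_bas // eqxx rmorph1 mulr1 addr0.
  by rewrite /dual_bas co_bas // (inj_eq e_inj) (negPf vw) rmorph0 mulr0.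
rewrite (phi0 _ _ _ (deg_bas Bb)); last by apply: contraNneq db => ->.
rewrite big1 // => v _; rewrite /dual_bas co_bas //; case: eqP => [eb|_]; last by rewrite rmorph0 mulr0.
by rewrite -eb e_deg eqxx in db.
Qed.

Local Notation m := (minimal_model hmin ge0 sP s_gr).
Hypothesis hU : U dd m k `<=`
  op_image m [:: Ext_bi P (2, (dd + 1)%N%:Z); Ext_deg P (3 * k)%N%:Z].

(** A product of y in E^2_{d+1} and z in E^{3k} is the cocycle of y composed with the lift of z.
    Lifts depend linearly on z, so expanding z in the dual basis gives the factorization, with
    coefficients in E^2_{d+1}. *)
Lemma model_factorization chi : cochain_at P ((3 * k + 2)%N%:Z, (2 * dd * k + dd + 1)%N%:Z) chi ->
  exists psi : I -> P -> F^o,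
    (forall v, cochain_at P (2, (dd + 1)%N%:Z) (psi v)) /\ forall x, chi x = \sum_v psi v (th v x).
Proof.
move=> hchi; have hc := cochain_at_cochain hchi; rewrite -(rep_cls hmin hc).
have : Ext_bi P ((3 * k + 2)%N%:Z, (2 * dd * k + dd + 1)%N%:Z) (cls hmin chi).
  by apply/(Ext_bi_rep hmin); rewrite rep_cls.
move/(Ext_3k2_generated hdd hB ev_e0 bas_deg0 ds ss s_e0 ev_s s_gen k1 hU).
move: (cls hmin chi); apply: lspan_min => /= [|u v [f [hf fE]] [g [hg gE]]|a u [f [hf fE]]|].
- exists (fun=> 0); split=> [v|x]; first exact: cochain_at0.
  by rewrite rep0 // big1.
- exists (fun w => f w + g w); split=> [w|x].
    by have := cochain_atP 1 (hf w) (hg w); rewrite scale1r.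
  rewrite -[u]scale1r repP // scale1r -[LHS]/(rep u x + rep v x) fE gE -big_split.
  by [].
- exists (fun w => a *: f w); split=> [w|x].
    by have := cochain_atP a (hf w) (cochain_at0 _ _); rewrite addr0.
  rewrite -[a *: u]addr0 repP // rep0 // addr0 -[LHS]/(a * rep u x) fE mulr_sumr.
  by [].
move=> _ [xs [/= sxs hxs] <-].
case: xs sxs hxs => [|y [|z [|? ?]]] // _ hxs.
have hy : Ext_bi P (2, (dd + 1)%N%:Z) y by exact: (hxs 0%N).
have hz : Ext_deg P (3 * k)%N%:Z z by exact: (hxs 1%N).
have {}hz : Ext_bi P ((3 * k)%N%:Z, (2 * dd * k)%N%:Z) z.
  by have := Ext_deg_Delta (Ext_bi_Delta hmin hB) _ hz; rewrite Delta0; apply.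
have hry := (Ext_bi_rep hmin _ _).1 hy; have hrz := (Ext_bi_rep hmin _ _).1 hz.
exists (fun v => rep z (e v) *: rep y); split=> [v|x].
  by have := cochain_atP (rep z (e v) : F) hry (cochain_at0 _ _); rewrite addr0.
rewrite (minimal_model2 hmin ge0 ev_e0 sP s_gr ev_s).
rewrite -[LHS]/(rep y (ifun e0 s (rep z) x)) {1}(dual_expansion hrz) ifun_sum.
have yL := rep_alin hmin y.
have hD := alinD yL; have h0 := alin0 yL.
rewrite (big_morph _ hD h0); apply: eq_bigr => v _.
by rewrite (alinZ _ _ yL) aug_alg.
Qed.

End Factorization.

(** * Transport to an arbitrary resolution *)

Section Represented.
Variables (F : fieldType) (A : graded_algebra F) (M : lmodType A).
Variables (G : int -> set M) (N : set M) (P : resolution G N).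

Lemma represents_sum (I : finType) (x : I -> Ext P) (f : I -> P -> F^o) :
  (forall v, represents (x v) (f v)) ->
  represents (\sum_v x v) (fun w => \sum_v f v w).
Proof.
move=> /choice[z zP]; exists (\sum_v z v); split.
  rewrite raddf_sum; apply/funext => w; rewrite fct_sumE; apply: eq_bigr => v _.
  by have [e _] := zP v; rewrite -[LHS]/(val (z v) w) e.
have -> : Ext_class (\sum_v z v) = \sum_v Ext_class (z v) by exact: raddf_sum.
by apply: eq_bigr => v _; have [_ ->] := zP v.
Qed.

Lemma represents_eq (x y : Ext P) (f g kap : P -> F^o) :
  represents x f -> represents y g -> cochain P kap ->
  (forall w, f w = g w + kap (res_d P w)) -> x = y.
Proof.
move=> [z [zf ->]] [t [tg ->]] hk h; apply/Ext_classP/asboolP; exists kap => //.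
apply/funext => w; rewrite raddfB /= zf tg -[LHS]/(f w - g w) h addrAC subrr add0r.
by [].
Qed.

Lemma represented b (f : P -> F^o) : cochain_at P b f -> f \o res_d P = 0 ->
  exists x, Ext_bi P b x /\ represents x f.
Proof.
move=> hf df; have zP : cocycle f.
  by apply/asboolP; split=> //; exact: cochain_at_cochain hf.
pose z : cocycles P := exist _ f zP.
have hz : represents (Ext_class z) f by exists z.
by exists (Ext_class z); split=> //; exists f.
Qed.

End Represented.

Section Transport.
Variables (F : fieldType) (A : graded_algebra F) (P0 P : triv_resolution A).
Hypothesis hmin : minimal P0.
Local Notation gr := (res_gr P0).
Local Notation d := (res_d P0).
Local Notation sc c x := (((c : F)%:A : A) *: x).
Local Notation ev := (@ev F A P0).
Variables (e0 : P0) (s : P0 -> P0).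
Hypothesis ge0 : gr (0, 0) e0.
Hypothesis ev_e0 : ev e0 = 1.
Hypothesis sP : forall (c : F) x y, s (sc c x + y) = sc c (s x) + s y.
Hypothesis s_gr : forall n j x, gr (n, j) x -> gr (n + 1, j) (s x).
Hypothesis ds : forall x, d (s x) + s (d x) = x - sc (ev x) e0.
Hypothesis ev_s : forall x, ev (s x) = 0.

Variables (al : {linear P -> P0}) (be : {linear P0 -> P}).
Hypothesis hal : chain_map al.
Hypothesis hbe : chain_map be.

Lemma endo_transport b f : endo b f -> endo_d b.1 f = (fun=> 0) ->
  endo (P := P) b (be \o f \o al) /\ endo_d (P := P) b.1 (be \o f \o al) = fun=> 0.
Proof.
have [a1 a2 a3] := hal; have [b1 b2 b3] := hbe.
move=> hf df; split.
  split=> [a x y|n j x gx] /=; first by rewrite (linearP al) (endo_lin hf) (linearP be).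
  by apply/b1/(endo_gr hf)/a1.
apply/funext => x; have := congr1 (@^~ (al x)) df; rewrite /endo_d /= => e.
rewrite -b2 a2 -!sc_eps -[in X in _ - X](linear_scalem be) -(linearB be) sc_eps e.
exact: linear0.
Qed.

(** The composite [al \o be] is homotopic to the identity, and cochains on a minimal resolution
    annihilate boundaries. *)
Lemma round_trip_cochain b psi x : cochain_at P0 b psi -> psi (al (be x)) = psi x.
Proof.
move=> [psiL _]; have [k [_ kE]] := round_trip_homotopy hbe hal.
have kL : alin (psi \o k) by move=> a u v /=; rewrite (linearP k) psiL.
have := congr1 psi (kE x); rewrite (alinD psiL) (alin_d hmin _ psiL) add0r.
rewrite -[psi (k _)]/((psi \o k) (d x)) (alin_d hmin _ kL) (alinD psiL) (alinN _ psiL).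
by move/eqP; rewrite eq_sym subr_eq0 => /eqP ->.
Qed.

(** Neither P nor [m] is a constructed object here. The factorization is made on P0 for the pullback
    of a cocycle, and the factors are carried to End_A(P) by conjugation with the comparison maps,
    where the Yoneda property determines m_2 on their classes. *)
Lemma Ext_factorization (b c : int * int) (I : finType) (th : I -> {linear P0 -> P0})
    (m : seq (Ext P) -> Ext P) : ainf_ext m ->
  (forall v, endo c (th v)) -> (forall v, endo_d c.1 (th v) = fun=> 0) ->
  (forall chi, cochain_at P0 (b + c) chi -> exists psi : I -> P0 -> F^o,
     (forall v, cochain_at P0 b (psi v)) /\ forall x, chi x = \sum_v psi v (th v x)) ->
  Ext_bi P (b + c) `<=` op_image m [:: Ext_bi P b; Ext_bi P c].
Proof.
move=> hm hth dth hfac x [phi hphi rphi].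
have [a1 a2 a3] := hal; have [b1 b2 b3] := hbe.
have [psi [hpsi psiE]] := hfac _ (cochain_chain_map hbe hphi).
have psiL v : alin (psi v) by case: (hpsi v).
have [i1 i2] : (forall v, endo b (ifun e0 s (psi v))) /\
    (forall v, endo_d b.1 (ifun e0 s (psi v)) = fun=> 0).
  split=> v; first exact: (ifun_endo ge0 s_gr (hpsi v)).
  exact: (ifun_endo_d hmin ge0 ev_e0 sP s_gr ds ev_s (hpsi v)).
have /choice[y yP] v : exists y, Ext_bi P b y /\ represents y (psi v \o al).
  apply: represented; first exact: cochain_chain_map (hpsi v).
  by apply/funext => w /=; rewrite a2 (alin_d hmin _ (psiL v)).
have /choice[z zP] v : exists z, Ext_bi P c z /\ represents z ((ev \o th v) \o al).
  have hz := ev_endo (hth v).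
  apply: represented; first exact: cochain_chain_map hz.
  apply/funext => w; rewrite -[LHS]/((ev \o th v) (al (res_d P w))) a2.
  by apply: (alin_d hmin); case: hz.
have ry v : represents (y v) (res_eps P \o (be \o ifun e0 s (psi v) \o al)).
  have -> : res_eps P \o (be \o ifun e0 s (psi v) \o al) = psi v \o al.
    by apply/funext => w /=; rewrite b3; exact: (ev_ifun ev_e0 ev_s).
  by case: (yP v).
have rz v : represents (z v) (res_eps P \o (be \o th v \o al)).
  have -> : res_eps P \o (be \o th v \o al) = (ev \o th v) \o al.
    by apply/funext => w /=; rewrite b3.
  by case: (zP v).
have rm v := let: conj h1 h2 := endo_transport (i1 v) (i2 v) in
  let: conj h3 h4 := endo_transport (hth v) (dth v) in
  ext_yoneda hm h1 h2 h3 h4 (ry v) (rz v).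
have [k [kg kE]] := round_trip_homotopy hal hbe.
have hk : cochain_at P ((b + c).1 - 1, (b + c).2) (phi \o k).
  by apply: cochain_homotopy => //; rewrite -surjective_pairing.
(* The cocycles on both sides differ by the coboundary of [phi \o k], as [be \o al] is homotopic to
   the identity. *)
have -> : x = \sum_v m [:: y v; z v].
  apply: (represents_eq rphi (represents_sum rm) (cochain_at_cochain hk)) => w.
  have phiL : forall (a : A) u v, phi (a *: u + v) = aug a * phi u + phi v by case: hphi.
  have phiD u v : phi (u + v) = phi u + phi v.
    by have := phiL 1 u v; rewrite scale1r rmorph1 mul1r.
  have dphi : phi (res_d P (k w)) = 0.
    case: rphi => t [te _]; have /asboolP[_] := valP t; rewrite te.
    by move=> /(congr1 (@^~ (k w))).
  have -> : phi w = phi (res_d P (k w) + k (res_d P w) + be (al w)) by rewrite kE subrK.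
  rewrite !phiD dphi add0r addrC; congr (_ + _).
  rewrite -[LHS]/((phi \o be) (al w)) psiE; apply: eq_bigr => v _ /=.
  rewrite b3 -[RHS]/(ev (ifun e0 s (psi v) (al (be (th v (al w)))))).
  by rewrite (ev_ifun ev_e0 ev_s _ (psiL v)) (round_trip_cochain _ (hpsi v)).
apply: lspan_sum => v _; apply: lspan_incl; exists [:: y v; z v] => //.
by split=> // -[|[|i]] //= _; [case: (yP v)|case: (zP v)].
Qed.

End Transport.

(** * Bidegrees of U and V *)

Section UV.
Variables (F : fieldType) (A : graded_algebra F) (P : triv_resolution A) (dd : nat).
Variable m : seq (Ext P) -> Ext P.
Hypothesis hm : ainf_ext m.

Lemma perm_image_bi b1 b2 b3 X Y Z : X `<=` Ext_bi P b1 -> Y `<=` Ext_bi P b2 ->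
  Z `<=` Ext_bi P b3 -> perm_image m X Y Z `<=` Ext_bi P (b1 + b2 + b3 + (-1, 0)).
Proof.
move=> hX hY hZ; set b := (X in Ext_bi P X).
have cl := @lspan_min F (Ext P) _ (Ext_bi P b) (Ext_bi0 _ _) (@Ext_biD _ _ _ _ _ _ _)
  (fun k v => Ext_biZ k (x := v)).
apply: (cl) => y [s s3]; apply: (cl) => _ [xs [sxs hxs] <-].
rewrite size_map (perm_size s3) in sxs hxs.
have -> : b = \sum_(c <- [seq nth 0 [:: b1; b2; b3] i | i <- s]) c + (2 - (size xs)%:Z, 0).
  rewrite big_map (perm_big _ s3) /= !big_cons big_nil sxs addr0 addrA /b.
  by congr (_ + _).
apply: (ext_bidegree hm); first by rewrite sxs.
split=> [|i ixs]; first by rewrite size_map (perm_size s3) sxs.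
rewrite sxs in ixs; have := hxs i ixs.
have si : (i < size s)%N by rewrite (perm_size s3).
rewrite !(nth_map 0%N) //.
have : nth 0%N s i \in [:: 0; 1; 2]%N by rewrite -(perm_mem s3) mem_nth.
by rewrite !inE => /or3P[] /eqP -> /=; [exact: hX|exact: hY|exact: hZ].
Qed.

Hypothesis hE : forall (n : nat) j, j != (Delta dd n).1%:Z -> j != (Delta dd n).2%:Z ->
  Ext_bi P (n%:Z, j) `<=` [set 0].

Lemma U_bi k : U dd m k `<=` Ext_bi P ((3 * k + 2)%N%:Z, (2 * dd * k + dd + 1)%N%:Z).
Proof.
apply: lspan_min; [exact: Ext_bi0|exact: Ext_biD|by move=> c v; exact: Ext_biZ|].
move=> y [k1 [k2 [k3 [_ ek]]]].
have h1 : Ext_deg P (3 * k1)%N%:Z `<=` Ext_bi P ((3 * k1)%N%:Z, (2 * dd * k1)%N%:Z).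
  by have := @Ext_deg_Delta _ _ _ _ hE (3 * k1); rewrite Delta0; exact.
have h2 : Ext_deg P (3 * k2 + 1)%N%:Z `<=` Ext_bi P ((3 * k2 + 1)%N%:Z, (2 * dd * k2 + 1)%N%:Z).
  by have := @Ext_deg_Delta _ _ _ _ hE (3 * k2 + 1); rewrite Delta1; exact.
move/(perm_image_bi h1 h2 (@subset_refl _ _)); congr (Ext_bi P _ y).
by apply: pair_ext => /=; rewrite -ek; lia.
Qed.

Lemma V_bi k : V dd m k `<=` Ext_bi P ((3 * k + 2)%N%:Z, (2 * dd * k + dd + 1)%N%:Z).
Proof.
apply: lspan_min; [exact: Ext_bi0|exact: Ext_biD|by move=> c v; exact: Ext_biZ|].
move=> y [k1 [k2 [k3 [ek]]]].
move/(perm_image_bi (@subset_refl _ _) (@subset_refl _ _) (@subset_refl _ _)).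
congr (Ext_bi P _ y).
by apply: pair_ext => /=; rewrite -ek; lia.
Qed.

End UV.

Theorem proposition3p7 (F : fieldType) (A : graded_algebra F) (d : nat)
    (hd : (2 <= d)%N) (hA : bi_koszul A d) :
  strongly_bi_koszul A d <->
  forall (P : triv_resolution A) (m : seq (Ext P) -> Ext P), ainf_ext m ->
  forall k : nat, (1 <= k)%N ->
    U d m k `<=`
      op_image m [:: Ext_bi P (2, (d + 1)%N%:Z); Ext_deg P (3 * k)%N%:Z] /\
    V d m k `<=` W m k.
Proof.
have [P0 [min0 hP0]] := hA.
have hE (P : triv_resolution A) n j := @bi_koszul_Ext F A d P0 P n j hP0.
split=> [[_ strong] P m hm k k1|hUV]; last first.
  split=> // P hmin k k1 Q.
  have hB := minimal_Delta hmin (hE P).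
  have [e0 [s [[ge0 ev_e0 bas_deg0] sP s_gr ds [ss s_e0 ev_s s_gen]]]] := contraction_exists hmin.
  have [r [e [e_inj e_bas e_deg e_all]]] := degree_basis hmin hB k.
  (* The hypothesis is used for one structure only, the transferred one on the given minimal
     resolution. *)
  have [hU _] := hUV P _ (minimal_model_ext hmin ge0 ev_e0 sP s_gr ds ss s_e0 ev_s s_gen) k k1.
  have hfac := model_factorization hd hB ev_e0 bas_deg0 ds ss s_e0 ev_s s_gen k1 e_inj
    e_bas e_deg e_all hU.
  apply/seteqP; split=> [|_ ->]; last exact: Ext_bi0.
  have := (model_cone_Ext hd hmin hB ge0 ev_e0 bas_deg0 sP s_gr ds ev_s k1 e_inj e_bas
    e_deg e_all).2 hfac.
  (* The vanishing passes from the cone to the given resolution Q of the same module. *)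
  apply: Ext_bi_eq0_transfer; first by move=> j x y; exact: grB.
  by move=> js c ujs cg; apply: (gr_free (h := pair ((3 * k)%N%:Z - 1))) => // ? ? [].
have hB := minimal_Delta min0 (hE P0).
have [e0 [s [[ge0 ev_e0 bas_deg0] sP s_gr ds [ss s_e0 ev_s s_gen]]]] := contraction_exists min0.
have [r [e [e_inj e_bas e_deg e_all]]] := degree_basis min0 hB k.
have [al hal] := comparison_exists (@triv_grB _ _) (@triv_gr_free _ _) P P0.
have [be hbe] := comparison_exists (@triv_grB _ _) (@triv_gr_free _ _) P0 P.
pose b2 : int * int := (2, (d + 1)%N%:Z); pose b3 : int * int := ((3 * k)%N%:Z, (2 * d * k)%N%:Z).
have bE : b2 + b3 = ((3 * k + 2)%N%:Z, (2 * d * k + d + 1)%N%:Z).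
  by apply: pair_ext => /=; lia.
have hT : Ext_bi P (b2 + b3) `<=` op_image m [:: Ext_bi P b2; Ext_bi P b3].
  apply: (Ext_factorization min0 ge0 ev_e0 sP s_gr ds ev_s hal hbe hm).
  - exact: (th_endo ge0 s_gr e_bas e_deg).
  - exact: (th_endo_d min0 ge0 ev_e0 sP s_gr ds ev_s e_bas e_deg).
  rewrite bE; apply/(model_cone_Ext hd min0 hB ge0 ev_e0 bas_deg0 sP s_gr ds ev_s k1
    e_inj e_bas e_deg e_all).
  (* The cone is among the resolutions of J Omega^{3k} that the strong condition covers. *)
  by rewrite strong.
rewrite bE in hT.
have sub X1 X2 Y1 Y2 : X1 `<=` Y1 -> X2 `<=` Y2 ->
    op_image m [:: X1; X2] `<=` op_image m [:: Y1; Y2].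
  move=> h1 h2; apply: lspan_min; [exact: lspan0|exact: lspanD|by move=> *; exact: lspanZ|].
  move=> _ [xs [sxs hxs] <-]; apply: lspan_incl; exists xs => //; split=> // -[|[|i]] //= _.
    exact/h1/(hxs 0%N).
  exact/h2/(hxs 1%N).
have b3E : Ext_bi P b3 `<=` Ext_deg P (3 * k)%N%:Z by exact: Ext_bi_deg.
split=> y.
  by move/(U_bi hm (hE P))/hT; apply: sub.
(* V falls into the summand k1 = 0, k2 = k of the second sum, where E^2 contains E^2_{d+1}. *)
move/(V_bi hm)/hT => hy; apply: lspan_incl; right; exists 0%N, k; split=> //.
by apply: sub hy => //; exact: Ext_bi_deg.
Qed.
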